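(* In the setting described in the context, for every $x>0$, $$\mathbb{P}\left(\max_{i\le N}W_i(\infty)>xc_N\right)\ \longrightarrow\ \mathbb{P}\left(\sup_{t>0}(X_t-\mu t)>x\right)\qquad\text{as }N\to\infty.$$
   Context: Random variables. Fix constants $0<\alpha<1$, $q>0$, $\beta>1$, $\mu>0$. Let $(A_{i,j},\,i\ge1,j\ge1)$ be i.i.d. positive random variables with $\log\mathbb{P}(A_{i,j}>x)\sim -qx^{\alpha}$ as $x\to\infty$. Let $(B_j,\,j\ge1)$ be i.i.d. positive random variables with $\mathbb{P}(B_j>x)=L(x)/x^{\beta}$, where $L$ is a slowly varying function. Let $(T_j,\,j\ge1)$ be i.i.d. positive random variables with $\mathbb{E}[A_{i,j}B_j-T_j]=-\mu$. The three families are independent of each other. Waiting times. The waiting time at server $i$ upon arrival of the $(n+1)$-st job is $W_i(n)=\sup_{0\le k\le n}\sum_{j=k+1}^n(A_{i,j}B_j-T_j)$ (empty sums equal $0$). The maximum steady-state waiting time $\max_{i\le N}W_i(\infty)$ (the limit in distribution of $\max_{i\le N}W_i(n)$ as $n\to\infty$) is given in distribution by $$\max_{i\le N}W_i(\infty)=\max_{i\le N}\sup_{k\ge0}\sum_{j=1}^k(A_{i,j}B_j-T_j).$$ Scaling. Let $b_N=(\log N/q)^{1/\alpha}$ and $c_N:=\tilde L(b_N)\,b_N^{\beta/(\beta-1)}$, where $\tilde L$ is a slowly varying function given by $$\tilde L(x)x^{\beta/(\beta-1)}=\left(\left(\left(\frac{x}{\left(x^\beta/L(x)\right)^{\leftarrow}}\right)^*\right)^{\leftarrow}\right)^*,$$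 with $H(y)^{\leftarrow}=\inf\{s:H(s)\ge y\}$ the generalized inverse, and $f(x)^*$ denoting a monotone function with $f(x)^*\sim f(x)$ as $x\to\infty$. The sequence satisfies $c_N\sim (c_N/b_N)^{\beta}/L(c_N/b_N)$ and $c_N/b_N\to\infty$ as $N\to\infty$. Limiting process. $(X_{(s,t)},\,0\le s\le t)$ is a stochastic process with $X_{(t,t)}=0$ and: for $r<s<t$, $X_{(r,t)}=\max(X_{(r,s)},X_{(s,t)})$; $X_{(s,t)}$ and $X_{(u,v)}$ are independent if and only if the intervals $(s,t)$ and $(u,v)$ are disjoint (and variables attached to pairwise disjoint intervals are jointly independent); $X_{(s,t)}\overset{d}{=}X_{t-s}$, where $X_t=X_{(0,t)}$; and $\mathbb{P}(X_t\le x)=\exp(-t/x^{\beta})$ for $x>0$. A version of $(X_t)_{t\ge0}$ with cadlag paths is taken. *)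

(* Defs.v *)
From HB Require Import structures.
From mathcomp Require Import all_boot all_order all_algebra.
From mathcomp Require Import all_classical all_reals all_analysis.
Set Implicit Arguments.
Unset Strict Implicit.
Unset Printing Implicit Defensive.
Import Order.TTheory GRing.Theory Num.Theory.
Import numFieldNormedType.Exports.
Local Open Scope classical_set_scope.
Local Open Scope ring_scope.

(* [landau] needs a filter bundled with the proof that it is one. *)
Definition pinfty_filter_on (R : realType) : filter_on R :=
  FilterType (pinfty_nbhs R) _.

(* [f = g + o(g)] at [+oo]. *)
Definition equiv_pinfty (R : realType) (f g : R -> R) : Prop :=
  f ~_(pinfty_filter_on R) g.

(* The functions below are functions of a positive real variable: their values
   at [x <= 0] are never used. *)
Section regular_variation.
Variable R : realType.
Implicit Types (f g L : R -> R).

Definition slowly_varying L : Prop :=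
  [/\ measurable_fun (`]0, +oo[ : set R) L,
      (\forall x \near +oo, 0 < L x) &
      forall a : R, 0 < a -> L (a * x) / L x @[x --> +oo] --> (1 : R)].

Definition generalized_inverse f (y : R) : R :=
  inf [set s | 0 < s /\ y <= f s].

Definition monotone_pos f : Prop :=
  {in (`]0, +oo[ : interval R) &, {homo f : x y / x <= y}} \/
  {in (`]0, +oo[ : interval R) &, {homo f : x y /~ x <= y}}.

(* [g] is one of the functions denoted [f^*]. *)
Definition monotone_version f g : Prop := monotone_pos g /\ equiv_pinfty g f.

(* [Lt x * x ^ (beta / (beta - 1))
      = (((x / (x ^ beta / L x)^<-)^* )^<-)^*], for some choice of the two
   monotone versions. *)
Definition inverse_scaling (beta : R) L (Lt : R -> R) : Prop :=
  slowly_varying Lt /\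
  exists g h : R -> R,
  [/\ monotone_version
        (fun x => x / generalized_inverse (fun s => s `^ beta / L s) x) g,
      monotone_version (generalized_inverse g) h &
      forall x, 0 < x -> Lt x * x `^ (beta / (beta - 1)) = h x].

Definition b_scale (alpha q : R) (N : nat) : R :=
  (ln N%:R / q) `^ alpha^-1.

Definition c_scale (alpha q beta : R) (Lt : R -> R) (N : nat) : R :=
  Lt (b_scale alpha q N) * b_scale alpha q N `^ (beta / (beta - 1)).

Definition cadlag f : Prop :=
  (forall t, 0 <= t -> f s @[s --> t^'+] --> f t) /\
  (forall t, 0 < t -> cvg (f s @[s --> t^'-])).

End regular_variation.

Section independence.
Context d (T : measurableType d) (R : realType) (P : probability T R).
Local Open Scope ereal_scope.

Definition independent_systems (I : eqType) (G : I -> set (set T)) : Prop :=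
  forall (s : seq I) (E : I -> set T), uniq s ->
    (forall i, i \in s -> G i (E i)) ->
    P (\big[setI/setT]_(i <- s) E i) = \big[mule/1]_(i <- s) P (E i).

Definition independent_RVs (I : eqType) (X : I -> {RV P >-> R}) : Prop :=
  independent_systems (fun i => preimage_set_system setT (X i) measurable).

Definition sigma_of (I : Type) (X : I -> {RV P >-> R}) : set (set T) :=
  <<s \bigcup_i preimage_set_system setT (X i) measurable >>.

Definition same_law (X Y : {RV P >-> R}) : Prop :=
  forall U : set R, measurable U -> distribution P X U = distribution P Y U.

Definition iid (I : eqType) (X : I -> {RV P >-> R}) : Prop :=
  independent_RVs X /\ forall i j, same_law (X i) (X j).

Definition positive_RV (X : {RV P >-> R}) : Prop :=
  {ae P, forall w, (0 < X w)%R}.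

End independence.

Section model.
Context d (T : measurableType d) (R : realType) (P : probability T R).

(* The steady-state maximum max_{i <= N} W_i(oo), up to equality in law: the
   limit in distribution, as n -> oo, of the maximum over i <= N of
   W_i(n) = sup_{0 <= k <= n} sum_{j = k+1}^n (A_{i,j} B_j - T_j).
   Servers and jobs are numbered from 0, so the sum over [j < k] is over the
   first [k] jobs; [Tau] is the family of the T_j.  The sup over [k] may be
   [+oo], on a null set. *)
Definition max_steady_waiting (A : nat -> nat -> {RV P >-> R})
    (B Tau : nat -> {RV P >-> R}) (N : nat) (w : T) : \bar R :=
  \big[maxe/-oo%E]_(i < N)
    ereal_sup (range (fun k : nat =>
      (\sum_(j < k) (A i j w * B j w - Tau j w))%:E)).

(* [X s t] is only meaningful for [0 <= s <= t]; equalities between random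
   variables are almost sure ones. *)
Record extremal_process (beta : R) (X : R -> R -> {RV P >-> R}) : Prop := {
  extremal_diag : forall t, 0 <= t -> {ae P, forall w, X t t w = 0} ;
  extremal_max : forall r s t, 0 <= r -> r < s -> s < t ->
    {ae P, forall w, X r t w = Num.max (X r s w) (X s t w)} ;
  extremal_indep2 : forall s t u v, 0 <= s <= t -> 0 <= u <= v ->
    independent_RVs (fun k : bool => if k then X s t else X u v) <->
    `]s, t[%classic `&` `]u, v[%classic = set0 ;
  extremal_indep : forall (n : nat) (s t : 'I_n -> R),
    (forall i, 0 <= s i <= t i) ->
    trivIset setT (fun i => `]s i, t i[%classic) ->
    independent_RVs (fun i => X (s i) (t i)) ;
  extremal_stationary : forall s t, 0 <= s <= t ->
    same_law (X s t) (X 0 (t - s)) ;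
  extremal_cdf : forall t x, 0 <= t -> 0 < x ->
    cdf (X 0 t) x = (expR (- (t / x `^ beta)))%:E ;
  extremal_cadlag : forall w, cadlag (fun t => X 0 t w)
}.

Definition sup_drifted (mu : R) (X : R -> R -> {RV P >-> R}) (w : T) : \bar R :=
  ereal_sup [set (X 0 t w - mu * t)%:E | t in `]0, +oo[%classic].

End model.

(* Main.v *)
(* A large value of the maximum is caused by one long job.  Write b = b_N and
   c = c_N.  Among the N factors A_{i,j} of job j the largest is about b, and it
   meets all of job j, so that one of the N walks jumps by about b * B_j; up to
   and after that time the walks follow their drift - mu.  Hence the maximum
   exceeds x * c about when B_j > (c / b) * (x + mu * j / c) for some j.  These
   events are independent, and c * P(B > y * c / b) -> y^(- beta), so their
   probabilities add up to a Riemann sum of the integral I of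
   (x + mu * t)^(- beta) over t > 0, that is x^(1 - beta) / (mu * (beta - 1)),
   and the limit is 1 - exp(- I).  The extremal process exceeds the line
   x + mu * t with the same probability: on a grid of times this is a product
   over independent increments, again a Riemann sum of I.

   Upper bound: let r_k = 1 + mu * k / (x * c).  Away from the rare event that
   A_{i,j} > m_j or B_j > y_j, with m_j close to b * r_j^e and y_j close to
   x * (c / b) * r_j^(1 - e), the exponent th * A * B may be replaced in
   Chernoff's bound by its minimum with c0 * A^alpha, which has an exponential
   moment, although A * B has none.
   Lower bound: job j is independent of the first j steps of the walks, which
   obey a weak law of large numbers. *)
Require Import Defs.
From HB Require Import structures.
From mathcomp Require Import all_boot all_order all_algebra.
From mathcomp Require Import all_classical all_reals all_analysis.
From mathcomp Require Import measurable_realfun ring lra.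
Import Order.TTheory GRing.Theory Num.Theory.
Import numFieldNormedType.Exports.
Local Open Scope classical_set_scope.
Local Open Scope ring_scope.
Set Implicit Arguments.
Unset Strict Implicit.
Unset Printing Implicit Defensive.

(** * Independence *)

(** Three obstacles shape the estimates. The union over [N] servers costs a factor [N], so
    Chernoff's bound must bring about [exp (- (1 + e) log N)] at level [x * c]; this forces [th] of
    order [log N / c]. Since [log N = q * b ^ alpha = o(c)], [th] tends to 0, and a first-order
    expansion of the moment at 0, hence the drift alone, suffices. The union over the jobs is
    infinite: in the exponent [log N] is multiplied by a small power of [r_k], the sum over [k] is
    then of order [c], and [c] is at most a power of [log N], which a small power of [N] absorbs. In
    the lower bound the weak law has no rate and cannot pay for [N] servers; but the first server
    with a large factor is determined by the factors of job [j], and the probabilities of its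
    possible values add up to at most 1. The formula for [c] is inverted by brackets: each
    asymptotic equivalence becomes a factor [k > 1], and [k] tends to 1 at the end. All
    probabilities are estimated at a finite horizon [n], the upper bound uniformly in [n], the lower
    one for some [n]. *)

Section independence_theory.
Context d (T : measurableType d) (R : realType) (P : probability T R).
Local Open Scope ereal_scope.
Implicit Types F G : set (set T).

Definition indep2 F G :=
  forall E1 E2, F E1 -> G E2 -> P (E1 `&` E2) = P E1 * P E2.

Lemma indep2C F G : indep2 F G -> indep2 G F.
Proof. by move=> FG E1 E2 GE FE; rewrite setIC muleC; exact: FG. Qed.

(** Dynkin's argument: for fixed [E2] the events [E] that satisfy the product formula form a
    lambda-system, which contains [<<s F >>] once it contains the pi-system [F]. *)
Lemma indep2_g_sigma F G : setI_closed F -> F `<=` measurable ->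
  G `<=` measurable -> indep2 F G -> indep2 <<s F >> G.
Proof.
move=> FI Fm Gm FG E1 E2 + GE2.
have mE2 := Gm _ GE2.
pose H := [set E | measurable E /\ P (E `&` E2) = P E * P E2].
suff : <<s F >> `<=` H by move=> /[apply] -[].
have /fineK PE2 : P E2 \is a fin_num by exact: fin_num_measure.
apply: lambda_system_subset => //; last first.
  by move=> E FE; split; [exact: Fm|exact: FG].
apply/dynkin_lambda_system; split.
- by split => //; rewrite setTI probability_setT mul1e.
- move=> E [mE PE]; split; first exact: measurableC.
  rewrite probability_setC//.
  have -> : P (~` E `&` E2) = P E2 - P (E `&` E2).
    by rewrite setIC -setDE measureD// ?(setIC E2)// ltey_eq fin_num_measure.
  by rewrite PE muleBl ?mul1e// ?fin_num_measure// fin_num_adde_defr.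
- move=> E tE HE; split; first by apply: bigcup_measurable => k _; case: (HE k).
  rewrite setI_bigcupl measure_bigcup//; last 2 first.
  + by move=> i _; apply: measurableI => //; case: (HE i).
  + by move=> i j; apply: trivIset_setIr.
  rewrite measure_bigcup//; last by move=> i _; case: (HE i).
  rewrite muleC -PE2 -nneseriesZl//.
  by apply: eq_eseriesr => i _; rewrite PE2 muleC; case: (HE i).
Qed.

Lemma g_sigma_sub_measurable F : F `<=` measurable -> <<s F >> `<=` measurable.
Proof. by apply: smallest_sub; exact: sigma_algebra_measurable. Qed.

Lemma indep2_g_sigma2 F G : setI_closed F -> setI_closed G ->
  F `<=` measurable -> G `<=` measurable -> indep2 F G ->
  indep2 <<s F >> <<s G >>.
Proof.
move=> FI GI Fm Gm FG.
apply: indep2_g_sigma => //; first exact: g_sigma_sub_measurable.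
by apply: indep2C; apply: indep2_g_sigma => //; exact: indep2C.
Qed.

Section grouping.
Context (I : choiceType) (Z : I -> {RV P >-> R}).

(** The events of the definition are preimages only for indices in [s]; taking [setT] elsewhere
    gives a family [U] defined for every index, which big operators can handle. *)
Lemma independent_RVsP : independent_RVs Z <->
  forall (s : seq I) (U : I -> set R), uniq s ->
  (forall i, measurable (U i)) ->
  P (\big[setI/setT]_(i <- s) (Z i @^-1` U i)) =
  \big[mule/1]_(i <- s) P (Z i @^-1` U i).
Proof.
split=> [iZ s U us mU|H s E us Es].
  by apply: iZ => // i _; exists (U i) => //; rewrite setTI.
have /choice[U UE] : forall i, exists U,
    measurable U /\ (i \in s -> E i = Z i @^-1` U).
  move=> i; have [/Es[U mU <-]|_] := boolP (i \in s); last by exists setT.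
  by exists U; split => //; rewrite setTI.
rewrite (eq_big_seq (fun i => Z i @^-1` U i)); last by move=> i; exact: (UE i).2.
rewrite H//; last by move=> i; exact: (UE i).1.
by apply: eq_big_seq => i si; rewrite (UE i).2.
Qed.

Definition gen_on (S : set I) : set (set T) :=
  \bigcup_(i in S) preimage_set_system setT (Z i) measurable.

(** [gen_on S] is not closed under intersection; these finite intersections form a pi-system that
    contains it. *)
Definition pi_on (S : set I) : set (set T) :=
  [set E | exists (s : seq I) (U : I -> set R),
    [/\ uniq s, [set` s] `<=` S, (forall i, measurable (U i)) &
        E = \big[setI/setT]_(i <- s) (Z i @^-1` U i)]].

Lemma gen_on_measurable S : gen_on S `<=` measurable.
Proof.
move=> _ [i Si [U mU <-]]; exact: (measurable_funP (Z i)).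
Qed.

Lemma measurable_big_preimage (s : seq I) (U : I -> set R) :
  (forall i, measurable (U i)) ->
  measurable (\big[setI/setT]_(i <- s) (Z i @^-1` U i)).
Proof.
move=> mU; apply: bigsetI_measurable => i _.
by rewrite -[_ @^-1` _]setTI; exact: (measurable_funP (Z i)).
Qed.

Lemma pi_on_measurable S : pi_on S `<=` measurable.
Proof. by move=> _ [s [U [_ _ mU ->]]]; exact: measurable_big_preimage. Qed.

Lemma pi_on_setI S : setI_closed (pi_on S).
Proof.
move=> _ _ [s1 [U1 [us1 s1S mU1 ->]]] [s2 [U2 [us2 s2S mU2 ->]]].
exists (undup (s1 ++ s2)), (fun i => (if i \in s1 then U1 i else setT) `&`
  (if i \in s2 then U2 i else setT)); split.
- exact: undup_uniq.
- by move=> i /=; rewrite mem_undup mem_cat => /orP[/s1S|/s2S].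
- by move=> i; apply: measurableI; case: ifP.
- rewrite -!bigcap_seq; apply/seteqP; split => w.
    by move=> [H1 H2] i /=; rewrite mem_undup mem_cat => _; split;
      case: ifPn => // si; [exact: H1|exact: H2].
  move=> H; split => i /= si.
    by have /(_ _)[|] := H i; rewrite /= ?mem_undup ?mem_cat ?si.
  by have /(_ _)[|] := H i; rewrite /= ?mem_undup ?mem_cat ?si ?orbT.
Qed.

Lemma sub_gen_pi_on S : gen_on S `<=` pi_on S.
Proof.
move=> _ [i Si [U mU <-]]; exists [:: i], (fun=> U); split => //.
  by move=> j /=; rewrite inE => /eqP ->.
by rewrite big_seq1 setTI.
Qed.

(** By the Dynkin argument it is enough to treat the two pi-systems; there disjointness lets the two
    index lists be concatenated without repetition, and the product formula splits. *)
Lemma indep2_gen_on S1 S2 : independent_RVs Z -> S1 `&` S2 = set0 ->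
  indep2 <<s gen_on S1 >> <<s gen_on S2 >>.
Proof.
move=> /independent_RVsP iZ S12 E1 E2 sE1 sE2.
have gp S E : <<s gen_on S >> E -> <<s pi_on S >> E.
  apply: smallest_sub; first exact: smallest_sigma_algebra.
  exact: (subset_trans (@sub_gen_pi_on S) (@sub_gen_smallest _ _ _)).
move: {sE1 sE2} (gp _ _ sE1) (gp _ _ sE2).
apply: indep2_g_sigma2; [exact: pi_on_setI|exact: pi_on_setI|
  exact: pi_on_measurable|exact: pi_on_measurable|].
move=> _ _ [s1 [U1 [us1 s1S mU1 ->]]] [s2 [U2 [us2 s2S mU2 ->]]].
have s12 i : i \in s2 -> i \in s1 = false.
  move=> i2; apply/negP => i1; suff : (S1 `&` S2) i by rewrite S12.
  by split; [exact: s1S|exact: s2S].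
pose U i := if i \in s1 then U1 i else U2 i.
have -> : \big[setI/setT]_(i <- s1) (Z i @^-1` U1 i) =
    \big[setI/setT]_(i <- s1) (Z i @^-1` U i).
  by apply: eq_big_seq => i i1; rewrite /U i1.
have -> : \big[setI/setT]_(i <- s2) (Z i @^-1` U2 i) =
    \big[setI/setT]_(i <- s2) (Z i @^-1` U i).
  by apply: eq_big_seq => i i2; rewrite /U s12.
have mU i : measurable (U i) by rewrite /U; case: ifP.
have us : uniq (s1 ++ s2).
  rewrite cat_uniq us1 us2 andbT /=; apply/hasPn => i /s12 /=.
  by move=> ->.
by rewrite -big_cat (iZ _ _ us mU) big_cat/= -!iZ.
Qed.

End grouping.

End independence_theory.

Section joint_law.
Context d (T : measurableType d) (R : realType) (P : probability T R).
Local Open Scope ereal_scope.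

Definition indep_mfun d1 d2 (T1 : measurableType d1) (T2 : measurableType d2)
    (X : T -> T1) (Y : T -> T2) :=
  forall U V, measurable U -> measurable V ->
    P (X @^-1` U `&` Y @^-1` V) = P (X @^-1` U) * P (Y @^-1` V).

Context d1 d2 (T1 : measurableType d1) (T2 : measurableType d2).

Lemma pushforward_pair (X : {mfun T >-> T1}) (Y : {mfun T >-> T2}) :
  indep_mfun X Y -> forall E : set (T1 * T2), measurable E ->
  P ((fun w => (X w, Y w)) @^-1` E) =
  (distribution P X \x distribution P Y) E.
Proof.
move=> XY E mE.
have mXY : measurable_fun setT (fun w => (X w, Y w)).
  exact: measurable_fun_pair.
pose XYm : {mfun T >-> (T1 * T2)%type} := HB.pack (fun w => (X w, Y w))
  (isMeasurableFun.Build _ _ _ _ _ mXY).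
rewrite (@product_measure_unique _ _ _ _ _ _ _ (distribution P XYm))//.
Qed.

(** Both joint laws agree with the same product measure on rectangles, and such a measure is
    unique. *)
Lemma same_law_pair (X X' : {mfun T >-> T1}) (Y Y' : {mfun T >-> T2}) :
  indep_mfun X Y -> indep_mfun X' Y' ->
  (forall U, measurable U -> P (X @^-1` U) = P (X' @^-1` U)) ->
  (forall U, measurable U -> P (Y @^-1` U) = P (Y' @^-1` U)) ->
  forall E : set (T1 * T2), measurable E ->
  P ((fun w => (X w, Y w)) @^-1` E) = P ((fun w => (X' w, Y' w)) @^-1` E).
Proof.
move=> XY XY' XX' YY' E mE; rewrite [RHS](pushforward_pair XY')//.
have mXY : measurable_fun setT (fun w => (X w, Y w)).
  exact: measurable_fun_pair.
pose XYm : {mfun T >-> (T1 * T2)%type} := HB.pack (fun w => (X w, Y w))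
  (isMeasurableFun.Build _ _ _ _ _ mXY).
rewrite (@product_measure_unique _ _ _ _ _ _ _ (distribution P XYm))//.
move=> U V mU mV; transitivity (P (X @^-1` U) * P (Y @^-1` V)).
  exact: XY.
by rewrite XX'// YY'.
Qed.

Lemma ge0_integral_pair (X : {mfun T >-> T1}) (Y : {mfun T >-> T2})
    (f : T1 * T2 -> \bar R) :
  indep_mfun X Y -> measurable_fun [set: T1 * T2] f -> (forall z, 0 <= f z) ->
  \int[P]_w f (X w, Y w) = \int[distribution P X \x distribution P Y]_z f z.
Proof.
move=> XY mf f0.
have mXY : measurable_fun setT (fun w => (X w, Y w)).
  exact: measurable_fun_pair.
pose XYm : {mfun T >-> (T1 * T2)%type} := HB.pack (fun w => (X w, Y w))
  (isMeasurableFun.Build _ _ _ _ _ mXY).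
rewrite (eq_measure_integral (distribution P XYm)); last first.
  by move=> E mE _; apply/esym/pushforward_pair.
by rewrite ge0_integral_distribution.
Qed.

End joint_law.

Section product_expectation.
Context d (T : measurableType d) (R : realType) (P : probability T R).
Local Open Scope ereal_scope.

Lemma ge0_integralM_indep (X Y : {RV P >-> R}) :
  indep_mfun P X Y -> (forall w, 0 <= X w)%R -> (forall w, 0 <= Y w)%R ->
  \int[P]_w (X w * Y w)%:E = \int[P]_w (X w)%:E * \int[P]_w (Y w)%:E.
Proof.
move=> XY X0 Y0.
(* Tonelli is applied on all of [R * R], so the integrand has to be nonnegative outside the ranges
   of [X] and [Y] as well. *)
pose g (x : R) : \bar R := `|x|%:E.
have mg : measurable_fun setT g by apply/measurable_EFinP; exact: normr_measurable.
have g0 x : 0 <= g x by rewrite lee_fin.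
pose f (z : R * R) : \bar R := g z.1 * g z.2.
have mf : measurable_fun setT f.
  by apply: emeasurable_funM; exact: measurableT_comp.
have f0 z : 0 <= f z by rewrite /f /g mule_ge0.
transitivity (\int[P]_w f (X w, Y w)).
  by apply: eq_integral => w _; rewrite /f /g/= -EFinM !ger0_norm.
rewrite (ge0_integral_pair XY)// fubini_tonelli1//.
transitivity (\int[distribution P X]_x (g x * \int[distribution P Y]_y g y)).
  apply: eq_integral => x _; rewrite /fubini_F/=.
  by rewrite /f/= ge0_integralZl//.
have gY : \int[distribution P Y]_y g y = \int[P]_w (Y w)%:E.
  rewrite ge0_integral_distribution//.
  by apply: eq_integral => w _ /=; rewrite /g ger0_norm.
rewrite gY ge0_integralZr//; last first.
  by apply: integral_ge0 => w _; rewrite lee_fin.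
congr (_ * _); rewrite ge0_integral_distribution//.
  by apply: eq_integral => w _ /=; rewrite /g ger0_norm.
Qed.

Context (I : choiceType) (Z : I -> {RV P >-> R}).

Lemma gen_on_mfun d1 (T1 : measurableType d1) S (X : T -> T1) :
  measurable_fun setT (X : g_sigma_algebraType (gen_on Z S) -> T1) ->
  measurable_fun setT X.
Proof.
move=> mX _ U mU; apply: (g_sigma_sub_measurable (@gen_on_measurable _ _ _ _ _ Z S)).
exact: mX.
Qed.

Lemma measurable_gen_on (S : set I) i : S i ->
  measurable_fun setT (Z i : g_sigma_algebraType (gen_on Z S) -> R).
Proof.
move=> Si _ U mU; apply: sub_gen_smallest; exists i => //; by exists U.
Qed.

Lemma gen_onS (S S' : set I) : S `<=` S' ->
  <<s gen_on Z S >> `<=` <<s gen_on Z S' >>.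
Proof.
move=> SS'; apply: smallest_sub; first exact: smallest_sigma_algebra.
apply: subset_trans (@sub_gen_smallest _ _ _).
by move=> E [i Si ZE]; exists i => //; exact: SS'.
Qed.

Lemma gen_on_mfunS d1 (T1 : measurableType d1) (S S' : set I) (X : T -> T1) :
  S `<=` S' ->
  measurable_fun setT (X : g_sigma_algebraType (gen_on Z S) -> T1) ->
  measurable_fun setT (X : g_sigma_algebraType (gen_on Z S') -> T1).
Proof. by move=> SS' mX _ U mU; apply: (gen_onS SS'); exact: mX. Qed.

Lemma indep_mfun_gen_on d1 d2 (T1 : measurableType d1) (T2 : measurableType d2)
    S1 S2 (X : T -> T1) (Y : T -> T2) :
  independent_RVs Z -> S1 `&` S2 = set0 ->
  measurable_fun setT (X : g_sigma_algebraType (gen_on Z S1) -> T1) ->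
  measurable_fun setT (Y : g_sigma_algebraType (gen_on Z S2) -> T2) ->
  indep_mfun P X Y.
Proof.
move=> iZ S12 mX mY U V mU mV; apply: (indep2_gen_on iZ S12).
  by have := mX measurableT U mU; rewrite setTI.
by have := mY measurableT V mV; rewrite setTI.
Qed.

(** Induction on [k]: the product of the earlier factors is measurable for the union of their index
    sets, which is disjoint from [S k]. *)
Lemma ge0_integral_prod_indep (V : nat -> T -> R) (S : nat -> set I) k :
  independent_RVs Z -> trivIset setT S ->
  (forall j, measurable_fun setT
     (V j : g_sigma_algebraType (gen_on Z (S j)) -> R)) ->
  (forall j w, 0 <= V j w)%R ->
  \int[P]_w (\prod_(j < k) V j w)%:E = \big[mule/1]_(j < k) \int[P]_w (V j w)%:E.
Proof.
move=> iZ tS mV V0; elim: k => [|k IH].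
  under eq_integral do rewrite big_ord0; rewrite big_ord0 integral_cst//.
  rewrite mul1e; exact: probability_setT.
rewrite big_ord_recr/= -IH.
pose S' := \bigcup_(j in `I_k) S j.
have mp : measurable_fun setT ((fun w => \prod_(j < k) V j w)%R :
    g_sigma_algebraType (gen_on Z S') -> R).
  apply: measurable_prod => j _; apply: (gen_on_mfunS _ (mV j)) => i Si.
  by exists j => //=.
pose X : {RV P >-> R} := HB.pack (fun w => \prod_(j < k) V j w)%R
  (isMeasurableFun.Build _ _ _ _ _ (gen_on_mfun mp)).
pose Y : {RV P >-> R} := HB.pack (V k)
  (isMeasurableFun.Build _ _ _ _ _ (gen_on_mfun (mV k))).
rewrite -(@ge0_integralM_indep X Y)//.
- by apply: eq_integral => w _; rewrite big_ord_recr.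
- apply: (@indep_mfun_gen_on _ _ _ _ S' (S k)) => //.
  rewrite -subset0 => i [[j /= jk Sji] Ski].
  have jkE : j = k by apply: tS => //; exists i.
  by rewrite jkE ltnn in jk.
- by move=> w; apply: prodr_ge0.
- by move=> w; exact: V0.
Qed.

End product_expectation.

Section merge.
Context (I J K : eqType).

(** Partial inverses of the three injections; [pmap] with them splits a list of mixed indices by
    family. *)
Definition inlo (x : I + (J + K)) := if x is inl a then Some a else None.
Definition inmo (x : I + (J + K)) := if x is inr (inl b) then Some b else None.
Definition inro (x : I + (J + K)) := if x is inr (inr c) then Some c else None.

Lemma inloK : ocancel inlo inl. Proof. by case. Qed.
Lemma inmoK : ocancel inmo (fun b => inr (inl b)). Proof. by case=> [|[]]. Qed.
Lemma inroK : ocancel inro (fun c => inr (inr c)). Proof. by case=> [|[]]. Qed.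

Lemma big_sum3 (Rt : Type) (idx : Rt) (op : Monoid.com_law idx)
    (s : seq (I + (J + K))) (F : I + (J + K) -> Rt) :
  \big[op/idx]_(i <- s) F i =
  op (\big[op/idx]_(i <- pmap inlo s) F (inl i))
     (op (\big[op/idx]_(i <- pmap inmo s) F (inr (inl i)))
         (\big[op/idx]_(i <- pmap inro s) F (inr (inr i)))).
Proof.
elim: s => [|[a|[b|c]] s IH] /=; first by rewrite !big_nil !Monoid.mulm1.
- by rewrite !big_cons IH Monoid.mulmA.
- by rewrite !big_cons IH -Monoid.mulmA Monoid.mulmCA.
- by rewrite !big_cons IH Monoid.mulmCA; congr (op _ _); rewrite Monoid.mulmCA.
Qed.

End merge.

Section model_independence.
Context d (T : measurableType d) (R : realType) (P : probability T R).
Context (A : nat -> nat -> {RV P >-> R}) (B Tau : nat -> {RV P >-> R}).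
Context (A_indep : independent_RVs (fun ij : nat * nat => A ij.1 ij.2))
  (B_indep : independent_RVs B) (Tau_indep : independent_RVs Tau)
  (families_indep : independent_systems P
     (tnth [tuple sigma_of (fun ij : nat * nat => A ij.1 ij.2);
                  sigma_of B; sigma_of Tau])).

(** With all variables under one index type, the independence of the model is a single statement,
    and any two events that use disjoint sets of indices are independent by grouping. *)
Definition primitives (i : (nat * nat) + (nat + nat)) : {RV P >-> R} :=
  match i with
  | inl ij => A ij.1 ij.2
  | inr (inl j) => B j
  | inr (inr j) => Tau j
  end.

Lemma sigma_of_big (I : eqType) (X : I -> {RV P >-> R}) (s : seq I)
    (U : I -> set R) : (forall i, measurable (U i)) ->
  sigma_of X (\big[setI/setT]_(i <- s) (X i @^-1` U i)).
Proof.
move=> mU.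
have : @measurable _ (g_sigma_algebraType
    (\bigcup_i preimage_set_system setT (X i) measurable))
    (\big[setI/setT]_(i <- s) (X i @^-1` U i)).
  apply: bigsetI_measurable => i _; apply: sub_gen_smallest.
  by exists i => //; exists (U i) => //; rewrite setTI.
by [].
Qed.

Lemma primitives_independent : independent_RVs primitives.
Proof.
apply/independent_RVsP => s U us mU.
rewrite (big_sum3 setI) (big_sum3 mule)/=.
have uA := pmap_uniq (@inloK _ _ _) us.
have uB := pmap_uniq (@inmoK _ _ _) us.
have uT := pmap_uniq (@inroK _ _ _) us.
pose E (k : 'I_3) := tnth [tuple
  \big[setI/setT]_(i <- pmap (@inlo _ _ _) s) (A i.1 i.2 @^-1` U (inl i));
  \big[setI/setT]_(i <- pmap (@inmo _ _ _) s) (B i @^-1` U (inr (inl i)));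
  \big[setI/setT]_(i <- pmap (@inro _ _ _) s) (Tau i @^-1` U (inr (inr i)))] k.
have sE k : tnth [tuple sigma_of (fun ij : nat * nat => A ij.1 ij.2);
                  sigma_of B; sigma_of Tau] k (E k).
  by case: k => -[|[|[|//]]] ?; rewrite /E /tnth/=; apply: sigma_of_big => ?; exact: mU.
have := families_indep (s := [:: ord0; lift ord0 ord0; ord_max]) (E := E).
rewrite !big_cons !big_nil setIT mule1 => -> //.
rewrite /E /tnth/=.
have eA := (independent_RVsP _).1 A_indep _ (fun i => U (inl i)) uA (fun=> mU _).
have eB := (independent_RVsP _).1 B_indep _ (fun i => U (inr (inl i))) uB
  (fun=> mU _).
have eT := (independent_RVsP _).1 Tau_indep _ (fun i => U (inr (inr i))) uT
  (fun=> mU _).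
by congr (_ * (_ * _))%E; [exact: eA|exact: eB|exact: eT].
Qed.

End model_independence.

(** * Regular variation and the scaling *)

Section regular_variation_theory.
Context {R : realType}.
Implicit Types (f g Q : R -> R).

Lemma equiv_pinftyP f g : equiv_pinfty f g ->
  forall e, 0 < e -> \forall x \near +oo, `|f x - g x| <= e * `|g x|.
Proof.
by move=> /eqaddoP fg e e0; have := fg _ e0.
Qed.

Lemma exprn_unbounded (l w : R) : 1 < l -> exists n, w <= l ^+ n.
Proof.
move=> l1; have h : 0 < ln l by rewrite ln_gt0.
set n := (Num.truncn (w / ln l)).+1; exists n.
have -> : l ^+ n = expR (ln l * n%:R) by rewrite expRM_natr lnK// posrE; lra.
apply: (@le_trans _ _ (1 + w)); first by rewrite lerDr ler01.
rewrite (le_trans (expR_ge1Dx _))// ler_expR mulrC -ler_pdivrMr//.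
by rewrite ltW// truncnS_gt.
Qed.

Lemma ltr_gt1_powR (l x y : R) : 1 < l -> x < y -> l `^ x < l `^ y.
Proof.
by move=> l1 xy; rewrite /powR gt_eqF ?ltr_expR ?ltr_pM2r ?ln_gt0//; lra.
Qed.

Lemma powRVN (l b : R) : 0 < l -> l^-1 `^ b = l `^ (- b).
Proof. by move=> l0; rewrite -powR_inv1 ?ltW// -powRrM mulN1r. Qed.

(** Potter's bounds. Regular variation controls one step [y -> l * y] up to [l ^ e]; iterating it
    while [w <= l ^ n] gives the power of [w]. The prefactors in [l] pay for the last, incomplete
    step, where only monotonicity of [Q] is available. *)
Lemma potter Q (y0 b : R) :
  (forall y z, y0 <= y -> y <= z -> Q z <= Q y) ->
  (forall y, y0 <= y -> 0 < Q y) ->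
  (forall l, 1 < l -> Q (l * y) / Q y @[y --> +oo] --> l `^ (- b)) ->
  forall l e, 1 < l -> 0 < e -> e <= b ->
  exists2 y1, 0 < y1 & forall y w, y1 <= y -> 1 <= w ->
    l `^ (- (b + e)) * w `^ (- (b + e)) * Q y <= Q (w * y) <=
    l `^ (b - e) * w `^ (- (b - e)) * Q y.
Proof.
move=> Qni Q0 RV l e l1 e0 eb.
have l0 : 0 < l by lra.
have llo : l `^ (- (b + e)) < l `^ (- b) by apply: ltr_gt1_powR => //; lra.
have lhi : l `^ (- b) < l `^ (- (b - e)) by apply: ltr_gt1_powR => //; lra.
have [M [Mr HM]] : \forall y \near +oo,
   [/\ y0 <= y, 0 < y, l `^ (- (b + e)) <= Q (l * y) / Q y &
       Q (l * y) / Q y <= l `^ (- (b - e))].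
  near=> y; split; near: y.
  - by apply: nbhs_pinfty_ge; exact: num_real.
  - by apply: nbhs_pinfty_gt; exact: num_real.
  - by have /cvgr_ge := RV _ l1; apply.
  - by have /cvgr_le := RV _ l1; apply.
exists (Num.max 1 (M + 1)); first by rewrite lt_max ltr01.
have H y : Num.max 1 (M + 1) <= y -> [/\ y0 <= y, 0 < y,
    l `^ (- (b + e)) * Q y <= Q (l * y) & Q (l * y) <= l `^ (- (b - e)) * Q y].
  rewrite ge_max => /andP[_ My]; have [yy0 y_gt0 h1 h2] := HM y ltac:(lra).
  by split=> //; [rewrite -ler_pdivlMr ?Q0|rewrite -ler_pdivrMr ?Q0].
move=> y w + w1; have [n] := exprn_unbounded w l1.
elim: n y w w1 => [|n IH] y w w1 wn Hy.
  have -> : w = 1 by apply/eqP; rewrite eq_le w1 andbT.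
  have [yy0 y_gt0 h1 h2] := H _ Hy; rewrite mul1r powR1 mulr1.
  have h3 : 1 <= l `^ (b - e) by rewrite -(powRr0 l) ler_powR//; lra.
  have h4 : l `^ (- (b + e)) <= 1 by rewrite -(powRr0 l) ler_powR//; lra.
  by rewrite ler_piMl ?ler_peMl// ltW ?Q0.
have [yy0 y_gt0 h1 h2] := H _ Hy.
have [wl|lw] := leP w l.
  apply/andP; split.
    apply: le_trans (_ : Q (l * y) <= _); last first.
      by apply: Qni; [nra|rewrite ler_pM2r].
    apply: le_trans h1; rewrite ler_pM2r ?Q0// ler_piMr ?powR_ge0//.
    by rewrite -(powRr0 w) ler_powR//; lra.
  apply: le_trans (_ : Q y <= _); first by apply: Qni => //; rewrite ler_peMl// ltW.
  rewrite ler_peMl ?(ltW (Q0 _ _))// powRN ler_pdivlMr ?mul1r ?powR_gt0//; last lra.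
  by apply: ge0_ler_powR; rewrite ?nnegrE//; lra.
have [w' wE] : exists w', w = l * w'.
  by exists (w / l); rewrite mulrC divfK// gt_eqF.
have w'1 : 1 <= w' by rewrite -(ler_pM2l l0) mulr1 -wE ltW.
have w'n : w' <= l ^+ n by rewrite -(ler_pM2l l0) -exprS -wE.
have Hly : Num.max 1 (M + 1) <= l * y.
  by apply: le_trans Hy _; rewrite ler_peMl// ltW.
have /andP[i1 i2] := IH (l * y) w' w'1 w'n Hly.
have -> : w * y = w' * (l * y) by rewrite wE; ring.
rewrite wE !powRM; try lra.
apply/andP; split.
  apply: le_trans i1; rewrite -!mulrA ler_pM2l ?powR_gt0// mulrCA.
  by rewrite ler_pM2l ?powR_gt0//; lra.
apply: (le_trans i2); rewrite -!mulrA ler_pM2l ?powR_gt0// mulrCA.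
by rewrite ler_pM2l ?powR_gt0//; lra.
Unshelve. all: end_near.
Qed.
End regular_variation_theory.

Section generalized_inverse_theory.
Context {R : realType}.
Implicit Types (f g Q : R -> R).

Lemma cvgr_powR_pinfty (p : R) : 0 < p -> x `^ p @[x --> +oo] --> +oo.
Proof.
move=> p0; apply/cvgryPge => A; near=> x.
have hx : (1 + `|A|) `^ p^-1 <= x.
  by near: x; apply: nbhs_pinfty_ge; exact: num_real.
have x0 : 0 <= x by apply: le_trans hx; exact: powR_ge0.
apply: le_trans (_ : ((1 + `|A|) `^ p^-1) `^ p <= _); last first.
  by apply: ge0_ler_powR; rewrite ?nnegrE ?powR_ge0// ltW.
rewrite -powRrM mulVf ?gt_eqF// powRr1 ?addr_ge0//.
by rewrite (le_trans (ler_norm _))// lerDr.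
Unshelve. all: end_near.
Qed.

Lemma cvgr_powRN_pinfty (p : R) : 0 < p -> x `^ (- p) @[x --> +oo] --> 0.
Proof.
move=> p0; under eq_fun do rewrite powRN.
by apply/gtr0_cvgV0; [near=> x; rewrite powR_gt0|exact: cvgr_powR_pinfty].
Unshelve. all: end_near.
Qed.

Let below f y := [set s | 0 < s /\ y <= f s].

Lemma below_lb f y : has_lbound (below f y).
Proof. by exists 0 => s [/ltW]. Qed.

(** The strict inequality matters: the infimum need not be attained, so [y <= f v] can fail at
    [v = generalized_inverse f y]. *)
Lemma generalized_inverse_lt f y v :
  {in `]0, +oo[ &, {homo f : x y / x <= y}} ->
  below f y !=set0 -> generalized_inverse f y < v -> y <= f v.
Proof.
move=> fnd y0 /(inf_lt y0)[s [s0 ys] sv].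
by apply: (le_trans ys); apply: fnd; rewrite ?in_itv/= ?andbT// ?(ltW sv)//; lra.
Qed.

Lemma lt_generalized_inverse f y v :
  0 < v -> v < generalized_inverse f y -> f v < y.
Proof.
move=> v0 vy; rewrite ltNge; apply/negP => yv.
by have := @ge_inf _ _ (below_lb f y) v (conj v0 yv); rewrite leNgt vy.
Qed.

Lemma le_generalized_inverse f y v :
  {in `]0, +oo[ &, {homo f : x y / x <= y}} ->
  below f y !=set0 -> 0 < v -> f v < y -> v <= generalized_inverse f y.
Proof.
move=> fnd y0 v0 fvy; apply: lb_le_inf => // s [s0 ys].
rewrite leNgt; apply/negP => sv.
have := fnd s v; rewrite !in_itv/= !andbT => /(_ s0 v0 (ltW sv)).
by rewrite leNgt (lt_le_trans fvy).
Qed.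

Lemma generalized_inverse_le f y v :
  0 < v -> y <= f v -> generalized_inverse f y <= v.
Proof. by move=> v0 yv; apply: ge_inf => //; exact: below_lb. Qed.

End generalized_inverse_theory.

Section scaling.
Context {R : realType}.
Context (b : R) (Q f g h : R -> R).
Hypotheses (b1 : 1 < b)
  (Qni : forall y z, 0 < y -> y <= z -> Q z <= Q y)
  (Q0 : forall y, 0 < y -> 0 < Q y)
  (RV : forall l, 0 < l -> Q (l * y) / Q y @[y --> +oo] --> l `^ (- b))
  (fE : forall s, 0 < s -> f s = (Q s)^-1)
  (gE : monotone_version (fun x => x / generalized_inverse f x) g)
  (hE : monotone_version (generalized_inverse g) h).

(** An exponent strictly between 1 and [b]: above 1, so that [s * Q s] vanishes, and below [b], so
    that Potter's bound applies. *)
Let b' := (b + 1) / 2.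

Lemma tail_le_powR : exists C y1, [/\ 0 < C, 0 < y1 &
  forall s, y1 <= s -> Q s <= C * s `^ (- b')].
Proof.
have b_gt1 := b1.
have h1 : 1 < 2 :> R by lra.
have h2 : 0 < (b - 1) / 2 by lra.
have h3 : (b - 1) / 2 <= b by lra.
have [y1 y10 H] := @potter _ Q 1 b (fun y z y1 => Qni (lt_le_trans ltr01 y1))
  (fun y y1 => Q0 (lt_le_trans ltr01 y1)) (fun l l1 => RV (lt_trans ltr01 l1))
  2 ((b - 1) / 2) h1 h2 h3.
exists (2 `^ b' * y1^-1 `^ (- b') * Q y1), y1; split => //.
  by rewrite !mulr_gt0 ?powR_gt0 ?Q0 ?invr_gt0.
move=> s s1; have s0 : 0 < s by lra.
have := H y1 (s / y1) (lexx _); rewrite ler_pdivlMr// mul1r divfK ?gt_eqF//.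
move=> /(_ s1)/andP[_].
have -> : b - (b - 1) / 2 = b' by rewrite /b'; field.
rewrite powRM ?invr_ge0 ?(ltW s0) ?(ltW y10)// => hs; apply: (le_trans hs).
by rewrite le_eqVlt; apply/orP; left; apply/eqP; ring.
Qed.

Lemma cvg_mul_tail : s * Q s @[s --> +oo] --> 0.
Proof.
have b_gt1 := b1.
have [C [y1 [C0 y10 H]]] := tail_le_powR.
apply: (@squeeze_cvgr _ _ _ _ (fun=> 0) (fun s => C * s `^ (- (b' - 1)))).
- near=> s; have s0 : 0 < s.
    by near: s; apply: nbhs_pinfty_gt; exact: num_real.
  rewrite mulr_ge0 ?(ltW (Q0 _)) ?(ltW s0)//=.
  rewrite opprB powRD ?(gt_eqF s0) ?implybT// powRr1 ?(ltW s0)// mulrCA ler_pM2l//.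
  by apply: H; near: s; apply: nbhs_pinfty_ge; exact: num_real.
- exact: cvg_cst.
- rewrite -(mulr0 C); apply: cvgMr; apply: cvgr_powRN_pinfty.
  by rewrite /b'; lra.
Unshelve. all: end_near.
Qed.

Let F := generalized_inverse f.
Let G := generalized_inverse g.

Let fnd : {in `]0, +oo[ &, {homo f : x y / x <= y}}.
Proof.
move=> y z; rewrite !in_itv/= !andbT => y0 z0 yz.
by rewrite !fE// lef_pV2 ?posrE ?Q0//; exact: Qni.
Qed.

Lemma f_pinfty : f s @[s --> +oo] --> +oo.
Proof.
apply/cvgryPge => K; near=> s.
have s1 : 1 <= s by near: s; apply: nbhs_pinfty_ge; exact: num_real.
have s0 : 0 < s by rewrite (lt_le_trans ltr01).
have QK : s * Q s <= (1 + `|K|)^-1.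
  near: s; have /cvgr_le := cvg_mul_tail; apply.
  by rewrite invr_gt0 ltr_pwDl.
have K0 : 0 < 1 + `|K| by rewrite ltr_pwDl.
rewrite fE// (le_trans (ler_norm _))//.
apply: (@le_trans _ _ (1 + `|K|)); first by rewrite lerDr.
rewrite -[leLHS]invrK lef_pV2 ?posrE ?invr_gt0 ?Q0//.
by apply: le_trans QK; rewrite ler_peMl// ltW// Q0.
Unshelve. all: end_near.
Qed.

Let f_below y : [set s | 0 < s /\ y <= f s] !=set0.
Proof.
have /cvgryPge/(_ y)[M [_ HM]] := f_pinfty.
exists (`|M| + 1); split; first by rewrite ltr_wpDl.
by apply: HM; rewrite (le_lt_trans (ler_norm _))// ltrDl.
Qed.

Lemma inverse_pinfty : F y @[y --> +oo] --> +oo.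
Proof.
apply/cvgryPge => K; near=> y.
apply: (@le_trans _ _ (1 + `|K|)).
  by rewrite (le_trans (ler_norm _))// lerDr.
apply: (le_generalized_inverse fnd (f_below _)); first by rewrite ltr_pwDl.
by near: y; apply: nbhs_pinfty_gt; exact: num_real.
Unshelve. all: end_near.
Qed.

(** [y / F y >= K1] follows from [y <= f s] at [s = y / K1], that is from [s * Q s <= K1^-1]. *)
Lemma div_inverse_pinfty : y / F y @[y --> +oo] --> +oo.
Proof.
apply/cvgryPge => K; pose K1 := 1 + `|K|.
have K0 : 0 < K1 by rewrite ltr_pwDl.
have [M [_ HM]] : \forall s \near +oo, s * Q s <= K1^-1.
  by have /cvgr_le := cvg_mul_tail; apply; rewrite invr_gt0.
near=> y.
have y0 : 0 < y by near: y; apply: nbhs_pinfty_gt; exact: num_real.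
have F1 : 1 <= F y by near: y; move/cvgryPge : inverse_pinfty; exact.
have F0 : 0 < F y by rewrite (lt_le_trans ltr01).
have s0 : 0 < y / K1 by rewrite divr_gt0.
apply: (@le_trans _ _ K1); first by rewrite (le_trans (ler_norm _))// lerDr.
rewrite ler_pdivlMr// mulrC -ler_pdivlMr//.
apply: generalized_inverse_le => //; rewrite fE//.
rewrite -[leLHS]invrK lef_pV2 ?posrE ?invr_gt0 ?Q0//.
rewrite -(ler_pM2l s0).
have -> : y / K1 / y = K1^-1 by field; rewrite !gt_eqF.
apply: HM; rewrite ltr_pdivlMr//.
by near: y; apply: nbhs_pinfty_gt; exact: num_real.
Unshelve. all: end_near.
Qed.

Lemma g_pinfty : g y @[y --> +oo] --> +oo.
Proof.
apply/cvgryPge => K; near=> y.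
have e : `|g y - y / F y| <= 2^-1 * `|y / F y|.
  by near: y; apply: equiv_pinftyP => //; case: gE.
have yF : 2 * (1 + `|K|) <= y / F y.
  by near: y; move/cvgryPge : div_inverse_pinfty; exact.
have := ler_norm K; have := normr_ge0 K.
have h0 : 0 <= y / F y by apply: le_trans yF; rewrite mulr_ge0// addr_ge0.
move: e; rewrite (ger0_norm h0) ler_distl => /andP[+ _] ? ?; lra.
Unshelve. all: end_near.
Qed.

(** A monotone version may go in either direction; divergence to infinity excludes the nonincreasing
    one. *)
Let gnd : {in `]0, +oo[ &, {homo g : x y / x <= y}}.
Proof.
have [[//|gni] _] := gE.
have /cvgryPge/(_ (g 1 + 1))[M [_ HM]] := g_pinfty.
have M0 : 0 < `|M| + 1 by rewrite ltr_wpDl.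
have h1 : g 1 + 1 <= g (`|M| + 1 + 1).
  by apply: HM; have := ler_norm M; lra.
have := gni (`|M| + 1 + 1) 1; rewrite !in_itv/= !andbT ltr01.
have -> : 0 < `|M| + 1 + 1 by lra.
by move=> /(_ isT isT); have := normr_ge0 M; lra.
Qed.

Let g_below y : [set s | 0 < s /\ y <= g s] !=set0.
Proof.
have /cvgryPge/(_ y)[M [_ HM]] := g_pinfty.
exists (`|M| + 1); split; first by rewrite ltr_wpDl.
by apply: HM; rewrite (le_lt_trans (ler_norm _))// ltrDl.
Qed.

Lemma h_bracket k : 1 < k -> \forall z \near +oo,
  [/\ 0 < h z, h z / k < G z & G z < k * h z].
Proof.
move=> k1; near=> z.
(* Half of the admissible error, so that both comparisons with [G z] come out strict, as the inverse
   requires. *)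
have e : `|h z - G z| <= (1 - k^-1) / 2 * `|G z|.
  near: z; apply: equiv_pinftyP; first by case: hE.
  by rewrite divr_gt0// subr_gt0 invf_lt1//; lra.
have G1 : 1 <= G z.
  apply: (le_generalized_inverse gnd (g_below _)) => //.
  by near: z; apply: nbhs_pinfty_gt; exact: num_real.
have kk : k * k^-1 = 1 by rewrite divff// gt_eqF//; lra.
have k0 : 0 < k^-1 by rewrite invr_gt0; lra.
have kV1 : k^-1 < 1 by rewrite invf_lt1//; lra.
move: e; rewrite [`|G z|]ger0_norm; last lra.
rewrite ler_distl => /andP[e1 e2].
split; nra.
Unshelve. all: end_near.
Qed.

Lemma h_pinfty : h z @[z --> +oo] --> +oo.
Proof.
apply/cvgryPge => K; near=> z.
have [h0 h1 h2] : [/\ 0 < h z, h z / 2 < G z & G z < 2 * h z].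
  by near: z; apply: h_bracket; lra.
have : 2 * (1 + `|K|) <= G z.
  apply: (le_generalized_inverse gnd (g_below _)) => //.
  by near: z; apply: nbhs_pinfty_gt; exact: num_real.
have := ler_norm K; lra.
Unshelve. all: end_near.
Qed.

(* Up to factors [k], [F (h z) = h z / z]: this is [g (h z) = z] for
   [g x = x / F x].  As [F] is an inverse of [1 / Q], it gives
   [h z * Q (h z / z) = 1], up to powers of [k]. *)
Lemma tail_bracket k : 1 < k -> \forall z \near +oo,
  [/\ 0 < h z / z, k <= h z * Q (h z / z / k ^+ 2),
      h z * Q (k ^+ 3 * (h z / z)) <= k^-1 &
      F (k * h z) <= k ^+ 2 * (h z / z)].
Proof.
move=> k1; have k0 : 0 < k by lra.
have kV0 : 0 < k^-1 by rewrite invr_gt0.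
have kV1 : k^-1 < 1 by rewrite invf_lt1//; lra.
have gF : \forall y \near +oo,
    [/\ 0 < F y, y / F y / k <= g y & g y <= k * (y / F y)].
  near=> y.
  have F1 : 1 <= F y by near: y; move/cvgryPge : inverse_pinfty; exact.
  have y0 : 0 < y by near: y; apply: nbhs_pinfty_gt; exact: num_real.
  have yF : 0 < y / F y by rewrite divr_gt0//; lra.
  have : `|g y - y / F y| <= (1 - k^-1) * `|y / F y|.
    near: y; apply: equiv_pinftyP; first by case: gE.
    by rewrite subr_gt0.
  rewrite (ger0_norm (ltW yF)) ler_distl => /andP[e1 e2].
  have kk : k * k^-1 = 1 by rewrite divff// gt_eqF.
  split; [lra|nra|nra].
have hkV : h z / k @[z --> +oo] --> +oo.
  apply/cvgryPge => K; near=> z; rewrite ler_pdivlMr//.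
  by near: z; move/cvgryPge : h_pinfty; exact.
have hk : k * h z @[z --> +oo] --> +oo.
  apply/cvgryPge => K; near=> z; rewrite mulrC -ler_pdivrMr//.
  by near: z; move/cvgryPge : h_pinfty; exact.
near=> z; pose v := h z / z; rewrite -/v.
have z0 : 0 < z by near: z; apply: nbhs_pinfty_gt; exact: num_real.
have [h0 h1 h2] : [/\ 0 < h z, h z / k < G z & G z < k * h z].
  by near: z; apply: h_bracket.
have v0 : 0 < v by rewrite divr_gt0.
have hk0 : 0 < h z / k by rewrite divr_gt0.
have kh0 : 0 < k * h z by rewrite mulr_gt0.
have [Fa0 ga _] : [/\ 0 < F (h z / k), h z / k / F (h z / k) / k <= g (h z / k)
    & g (h z / k) <= k * (h z / k / F (h z / k))].
  by near: z; exact: (hkV _ gF).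
have [Fb0 _ gb] : [/\ 0 < F (k * h z), k * h z / F (k * h z) / k <= g (k * h z)
    & g (k * h z) <= k * (k * h z / F (k * h z))].
  by near: z; exact: (hk _ gF).
(* [h z / k] lies below the inverse of [g] at [z] and [k * h z] above it. Replacing [g y] by
   [y / F y] costs a second factor [k], whence [k ^+ 2]. *)
have glt : g (h z / k) < z by exact: lt_generalized_inverse.
have gge : z <= g (k * h z) by exact: (generalized_inverse_lt gnd (g_below _)).
have Fa : v / k ^+ 2 < F (h z / k).
  have := le_lt_trans ga glt.
  have -> : h z / k / F (h z / k) / k = h z / k / k / F (h z / k) by ring.
  have -> : v / k ^+ 2 = h z / k / k / z by rewrite /v; field; rewrite !gt_eqF.
  by rewrite !ltr_pdivrMr// (mulrC z).
have Fb : F (k * h z) <= k ^+ 2 * v.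
  have := le_trans gge gb.
  have -> : k ^+ 2 * v = k * (k * h z) / z by rewrite /v; field; rewrite gt_eqF.
  by rewrite mulrA !ler_pdivlMr// (mulrC z).
split => //.
- have vk0 : 0 < v / k ^+ 2 by rewrite divr_gt0// exprn_gt0.
  have := lt_generalized_inverse vk0 Fa; rewrite fE// => /ltW.
  by rewrite invf_ple ?posrE ?Q0// invf_div ler_pdivrMr// mulrC.
- have vk0 : 0 < k ^+ 3 * v by rewrite mulr_gt0// exprn_gt0.
  (* The third factor [k] makes the inequality strict, as [generalized_inverse_lt] demands. *)
  have Fb' : F (k * h z) < k ^+ 3 * v.
    by apply: le_lt_trans Fb _; rewrite ltr_pM2r// ltr_eXn2l.
  have := generalized_inverse_lt fnd (f_below _) Fb'; rewrite fE//.
  rewrite -[leLHS]invrK lef_pV2 ?posrE ?invr_gt0 ?Q0// invfM => Qle.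
  by rewrite mulrC -ler_pdivlMr.
Unshelve. all: end_near.
Qed.

(** The bracket with [k = 2] bounds [F (2 * h z)] by [4 * (h z / z)], and both [h] and [F]
    diverge. *)
Lemma scaling_ratio_pinfty : h z / z @[z --> +oo] --> +oo.
Proof.
apply/cvgryPge => K; have k2 : 1 < 2 :> R by lra.
near=> z.
have Fle : F (2 * h z) <= 2 ^+ 2 * (h z / z).
  by near: z; apply: filterS (tail_bracket k2) => z [].
suff : 4 * K <= F (2 * h z) by lra.
near: z; have : F (2 * h z) @[z --> +oo] --> +oo.
  apply: (@cvg_comp _ _ _ (fun z => 2 * h z) F _ (pinfty_nbhs R)).
    apply/cvgryPge => K'; near=> z; rewrite mulrC -ler_pdivrMr//.
    by near: z; move/cvgryPge : h_pinfty; exact.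
  exact: inverse_pinfty.
by move/cvgryPge; exact.
Unshelve. all: end_near.
Qed.

(** Regular variation removes the shifts [k ^+ 2] and [k ^+ 3] inside [Q] at the price of powers of
    [k]; then [k] tends to 1. *)
Lemma scaling_tail : h z * Q (h z / z) @[z --> +oo] --> (1 : R).
Proof.
have b_gt1 := b1.
suff H k : 1 < k -> \forall z \near +oo,
    k `^ (- (2 * b)) <= h z * Q (h z / z) <= k `^ (3 * b).
  have cont (p : R) : k `^ p @[k --> (1 : R)^'+] --> (1 : R).
    have c1 : {for 1, continuous (fun k : R => k `^ p)}.
      apply: differentiable_continuous; apply/derivable1_diffP.
      by apply: derivable_powR; rewrite in_itv/= andbT.
    by have := cvg_at_right_filter c1; rewrite powR1.
  apply/cvgrPdist_le => e e0.
  have [k [k1 kl kh]] : exists k, [/\ 1 < k, 1 - e <= k `^ (- (2 * b)) &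
      k `^ (3 * b) <= 1 + e].
    have near_k : \forall k \near (1 : R)^'+, [/\ 1 < k, 1 - e <= k `^ (- (2 * b)) &
      k `^ (3 * b) <= 1 + e].
      near=> k; split; near: k.
      - exact: nbhs_right_gt.
      - by have /cvgr_ge := cont (- (2 * b)); apply; lra.
      - by have /cvgr_le := cont (3 * b); apply; lra.
    by have [k] := @filter_ex _ _ _ _ near_k; exists k.
  near=> z; have /andP[? ?] : k `^ (- (2 * b)) <= h z * Q (h z / z) <= k `^ (3 * b).
    by near: z; exact: H.
  by rewrite ler_distlC; apply/andP; split; lra.
move=> k1; have k0 : 0 < k by lra.
have kV2 : 0 < (k ^+ 2)^-1 by rewrite invr_gt0 exprn_gt0.
have k3 : 0 < k ^+ 3 by rewrite exprn_gt0.
have vcvg := scaling_ratio_pinfty.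
near=> z.
have [v0 q1 q2 _] : [/\ 0 < h z / z, k <= h z * Q (h z / z / k ^+ 2),
    h z * Q (k ^+ 3 * (h z / z)) <= k^-1 & F (k * h z) <= k ^+ 2 * (h z / z)].
  by near: z; exact: tail_bracket.
have h0 : 0 < h z by near: z; apply: filterS (h_bracket k1) => z [].
(* The ratio tends to [k ^ (2 * b)]. The extra factor [k] makes the bound hold eventually and is
   cancelled by the [k] on the left of [q1]; likewise for [a2] and [q2]. *)
have a1 : Q ((k ^+ 2)^-1 * (h z / z)) / Q (h z / z) <= k `^ (2 * b + 1).
  near: z; apply: (vcvg (fun v => Q ((k ^+ 2)^-1 * v) / Q v <= k `^ (2 * b + 1))).
  have /cvgr_le := RV kV2; apply.
  rewrite powRVN ?exprn_gt0// opprK -powR_mulrn ?ltW// -powRrM.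
  by apply: ltr_gt1_powR => //; lra.
have a2 : k `^ (- (3 * b + 1)) <= Q (k ^+ 3 * (h z / z)) / Q (h z / z).
  near: z; apply: (vcvg (fun v => k `^ (- (3 * b + 1)) <= Q (k ^+ 3 * v) / Q v)).
  have /cvgr_ge := RV k3; apply.
  rewrite -powR_mulrn ?ltW// -powRrM.
  by apply: ltr_gt1_powR => //; lra.
move: a1 a2; rewrite ler_pdivrMr ?ler_pdivlMr ?Q0// => a1 a2.
have kD p : k `^ (p + 1) = k `^ p * k.
  by rewrite powRD ?(gt_eqF k0) ?implybT// powRr1 ?(ltW k0).
apply/andP; split.
  rewrite (mulrC _ (k ^- 2)) in q1.
  have := le_trans q1 (ler_wpM2l (ltW h0) a1); rewrite kD => q3.
  rewrite powRN -(ler_pM2l (powR_gt0 (2 * b) k0)) mulfV ?gt_eqF ?powR_gt0//.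
  rewrite -(ler_pM2r k0) mul1r (le_trans q3)//.
  by rewrite le_eqVlt; apply/orP; left; apply/eqP; ring.
rewrite -(ler_pM2l (powR_gt0 (- (3 * b + 1)) k0)) -powRD ?(gt_eqF k0) ?implybT//.
have -> : - (3 * b + 1) + 3 * b = -1 by ring.
rewrite powR_inv1 ?(ltW k0)// (le_trans _ q2)// mulrCA ler_pM2l//.
Unshelve. all: end_near.
Qed.

(** Inserting the power bound on [Q] into [2^-1 <= h z * Q (h z / z)] gives
    [h z ^ (b' - 1) <= 2 * C * z ^ b']. It makes [c_N] at most a power of [ln N]. *)
Lemma scaling_le_powR : exists C p, [/\ 0 < C, 0 < p &
  \forall z \near +oo, h z <= C * z `^ p].
Proof.
have b_gt1 := b1; have [C [y1 [C0 y10 H]]] := tail_le_powR.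
have b'1 : 1 < b' by rewrite /b'; lra.
have b'10 : 0 < b' - 1 by lra.
exists ((2 * C) `^ (b' - 1)^-1), (b' / (b' - 1)); split.
- by rewrite powR_gt0// mulr_gt0.
- by rewrite divr_gt0//; lra.
near=> z.
have z0 : 0 < z by near: z; apply: nbhs_pinfty_gt; exact: num_real.
have h0 : 0 < h z by near: z; have := @h_bracket 2 ltac:(lra); apply: filterS => z [].
have q : 2^-1 <= h z * Q (h z / z).
  by near: z; have /cvgr_ge := scaling_tail; apply; lra.
have v1 : y1 <= h z / z by near: z; move/cvgryPge : scaling_ratio_pinfty; exact.
have hb : h z `^ (b' - 1) <= 2 * C * z `^ b'.
  have := le_trans q (ler_wpM2l (ltW h0) (H _ v1)).
  rewrite powRM ?invr_ge0 ?(ltW h0) ?(ltW z0)// powRVN// opprK powRB ?(gt_eqF h0) ?implybT//.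
  rewrite powRr1 ?(ltW h0)// powRN => q'.
  rewrite ler_pdivrMr//.
  have hb0 := powR_gt0 b' h0.
  rewrite -(ler_pM2r (_ : 0 < (h z `^ b')^-1)) ?invr_gt0// mulfV ?gt_eqF//.
  by move: q'; rewrite -(ler_pM2l (_ : 0 < 2 :> R))// mulfV// => /le_trans; apply;
   rewrite le_eqVlt; apply/orP; left; apply/eqP; ring.
have -> : h z = (h z `^ (b' - 1)) `^ (b' - 1)^-1.
  by rewrite -powRrM mulfV ?gt_eqF// powRr1// ltW.
rewrite powRrM.
rewrite -powRM ?powR_ge0 ?mulr_ge0 ?(ltW C0)//.
by apply: ge0_ler_powR;
  rewrite ?nnegrE ?invr_ge0 ?powR_ge0 ?mulr_ge0 ?powR_ge0 ?(ltW C0) ?(ltW b'10).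
Unshelve. all: end_near.
Qed.

End scaling.

(** * Sums of powers compared with integrals *)

Section power_sums.
Context {R : realType}.
Implicit Types (x y a p s : R).

(** Convexity of a negative power, obtained from [1 + u <= expR u], used for [u = s * ln t] and for
    [u = ln t], with [t = y / x]. *)
Lemma powR_tangent x y s : 0 < x -> 0 < y -> s <= 0 ->
  x `^ s + s * x `^ (s - 1) * (y - x) <= y `^ s.
Proof.
move=> x0 y0 s0; have t0 : 0 < y / x by rewrite divr_gt0.
have -> : y `^ s = x `^ s * (y / x) `^ s.
  by rewrite -powRM ?(ltW x0) ?(ltW t0)// mulrC divfK ?gt_eqF.
have -> : x `^ s + s * x `^ (s - 1) * (y - x) = x `^ s * (1 + s * (y / x - 1)).
  rewrite powRD ?(gt_eqF x0) ?implybT// powR_inv1 ?(ltW x0)//.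
  by field; rewrite gt_eqF.
rewrite ler_pM2l ?powR_gt0// /powR gt_eqF//.
apply: le_trans (expR_ge1Dx _); rewrite lerD2l ler_wnM2l//.
have := expR_ge1Dx (ln (y / x)); rewrite lnK ?posrE//; lra.
Qed.

(** The middle term is the integral of the power [- p] over an interval of length [a], the outer
    ones its rectangle bounds; they are the tangent inequalities at the two ends. *)
Lemma powR_increment x a p : 0 < x -> 0 < a -> 1 < p ->
  a * (x + a) `^ (- p) <= (x `^ (1 - p) - (x + a) `^ (1 - p)) / (p - 1) <=
  a * x `^ (- p).
Proof.
move=> x0 a0 p1; have xa0 : 0 < x + a by rewrite addr_gt0.
have p0 : 0 < p - 1 by lra.
have sE : 1 - p - 1 = - p by ring.
rewrite ler_pdivlMr// ler_pdivrMr//; apply/andP; split.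
  have := @powR_tangent (x + a) x (1 - p) xa0 x0; rewrite sE => /(_ ltac:(lra)).
  have -> : x - (x + a) = - a by ring.
  by lra.
have := @powR_tangent x (x + a) (1 - p) x0 xa0; rewrite sE => /(_ ltac:(lra)).
have -> : x + a - x = a by ring.
by lra.
Qed.

Lemma powR_sum_ge x a p n : 0 < x -> 0 < a -> 1 < p ->
  (x `^ (1 - p) - (x + a * n%:R) `^ (1 - p)) / (p - 1) <=
  a * \sum_(j < n) (x + a * j%:R) `^ (- p).
Proof.
move=> x0 a0 p1; elim: n => [|n IH].
  by rewrite big_ord0 !mulr0 addr0 subrr mul0r.
have xn : 0 < x + a * n%:R by rewrite ltr_wpDr// mulr_ge0// ltW.
have /andP[_] := @powR_increment _ a p xn a0 p1.
rewrite big_ord_recr/= mulrDr -natr1 !mulrDr mulr1 addrA.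
have p0 : 0 < p - 1 by lra.
by move: IH; rewrite !mulrDl; lra.
Qed.

Lemma powR_sum_le x a p n : 0 < x -> 0 < a -> 1 < p ->
  a * \sum_(j < n) (x + a * j.+1%:R) `^ (- p) <=
  (x `^ (1 - p) - (x + a * n%:R) `^ (1 - p)) / (p - 1).
Proof.
move=> x0 a0 p1; elim: n => [|n IH].
  by rewrite big_ord0 !mulr0 addr0 subrr mul0r.
have xn : 0 < x + a * n%:R by rewrite ltr_wpDr// mulr_ge0// ltW.
have /andP[+ _] := @powR_increment _ a p xn a0 p1.
rewrite big_ord_recr/= mulrDr -natr1 !mulrDr mulr1 addrA.
by move: IH; rewrite !mulrDl; lra.
Qed.

Lemma powR_sum_le_bound x a p n : 0 < x -> 0 < a -> 1 < p ->
  a * \sum_(j < n) (x + a * j%:R) `^ (- p) <=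
  a * x `^ (- p) + x `^ (1 - p) / (p - 1).
Proof.
move=> x0 a0 p1; have p0 : 0 < p - 1 by lra.
case: n => [|n].
  by rewrite big_ord0 mulr0 addr_ge0 ?mulr_ge0 ?invr_ge0 ?powR_ge0 ?(ltW a0) ?(ltW p0).
rewrite big_ord_recl/= mulr0 addr0 mulrDr lerD2l.
apply: le_trans (_ : _ <= (x `^ (1 - p) - (x + a * n%:R) `^ (1 - p)) / (p - 1)) _.
  exact: powR_sum_le.
by rewrite ler_pM2r ?invr_gt0// lerBlDr lerDl powR_ge0.
Qed.

End power_sums.

Section real_probability.
Context d (T : measurableType d) (R : realType) (P : probability T R).
Implicit Types E F : set T.

Definition pr E : R := fine (P E).

Lemma prE E : measurable E -> P E = (pr E)%:E.
Proof. by move=> mE; rewrite fineK// fin_num_measure. Qed.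

Lemma pr_ge0 E : 0 <= pr E.
Proof. by rewrite fine_ge0. Qed.

Lemma pr_le1 E : measurable E -> pr E <= 1.
Proof. by move=> mE; rewrite -lee_fin -prE// probability_le1. Qed.

Lemma le_pr E F : measurable E -> measurable F -> E `<=` F -> pr E <= pr F.
Proof. by move=> mE mF EF; rewrite -lee_fin -!prE// le_measure ?inE. Qed.

Lemma prT : pr setT = 1. Proof. by rewrite /pr probability_setT. Qed.

Lemma pr0 : pr set0 = 0. Proof. by rewrite /pr measure0. Qed.

Lemma prC E : measurable E -> pr (~` E) = 1 - pr E.
Proof.
by move=> mE; rewrite /pr probability_setC// fineB// fin_num_measure.
Qed.

Lemma prU_le E F : measurable E -> measurable F ->
  pr (E `|` F) <= pr E + pr F.
Proof.
move=> mE mF; rewrite -lee_fin EFinD -!prE//; last exact: measurableU.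
by rewrite measureU2.
Qed.

Lemma pr_bigsetU_le (F : nat -> set T) n : (forall i, measurable (F i)) ->
  pr (\big[setU/set0]_(i < n) F i) <= \sum_(i < n) pr (F i).
Proof.
move=> mF; elim: n => [|n IH]; first by rewrite !big_ord0 pr0.
rewrite !big_ord_recr/=; apply: le_trans (prU_le _ _) _ => //.
  exact: bigsetU_measurable.
by rewrite lerD2r.
Qed.

Lemma le_pr_ae E F : measurable E -> measurable F ->
  {ae P, forall w, E w -> F w} -> pr E <= pr F.
Proof.
move=> mE mF [N [mN N0 EFN]].
apply: (@le_trans _ _ (pr (F `|` N))).
  apply: le_pr => //; first exact: measurableU.
  move=> w Ew; have [Fw|Fw] := pselect (F w); [by left|right].
  by apply: EFN => /= /(_ Ew).
by rewrite (le_trans (prU_le _ _))// /pr N0 addr0.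
Qed.

Lemma eq_pr_ae E F : measurable E -> measurable F ->
  {ae P, forall w, E w <-> F w} -> pr E = pr F.
Proof.
move=> mE mF EF; apply/eqP; rewrite eq_le !le_pr_ae//.
  by apply: filterS EF => w [].
by apply: filterS EF => w [].
Qed.

Lemma pr_bigcup_le (F : nat -> set T) K : (forall i, measurable (F i)) ->
  {homo F : n m / (n <= m)%N >-> n `<=` m} ->
  (forall n, pr (F n) <= K) -> pr (\bigcup_n F n) <= K.
Proof.
move=> mF ndF FK; have mUF : measurable (\bigcup_n F n) by exact: bigcupT_measurable.
have ndF' : {homo F : n m / (n <= m)%N >-> (n <= m)%O}.
  by move=> n m nm; apply/subsetPset; exact: ndF.
rewrite -lee_fin -prE// -(cvg_lim _ (nondecreasing_cvg_mu mF mUF ndF'))//.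
apply: lime_le.
  by apply/cvg_ex; eexists; exact: nondecreasing_cvg_mu.
by apply: nearW => n /=; rewrite prE// lee_fin.
Qed.

End real_probability.

(** * The limiting process *)

Section extremal_grid.
Context d (T : measurableType d) (R : realType) (P : probability T R).
Context (beta mu : R) (X : R -> R -> {RV P >-> R}).

(** At a grid time [X 0] is the maximum of the increments so far. As the thresholds are
    nondecreasing, an increment that respects its own threshold respects all later ones. *)
Lemma extremal_grid_le (h : R) (u : nat -> R) :
  extremal_process beta X -> 0 < h -> (forall i, u i <= u i.+1) ->
  {ae P, forall w, forall n,
    (forall i, (i < n)%N -> X 0 (h * i.+1%:R) w <= u i) <->
    (forall i, (i < n)%N -> X (h * i%:R) (h * i.+1%:R) w <= u i)}.
Proof.
move=> eX h0 uS.
have : {ae P, forall w, forall n, X 0 (h * n.+2%:R) w =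
    Num.max (X 0 (h * n.+1%:R) w) (X (h * n.+1%:R) (h * n.+2%:R) w)}.
  apply: ae_foralln => n; apply: (extremal_max eX) => //.
    by rewrite mulr_gt0.
  by rewrite ltr_pM2l// ltr_nat.
apply: filterS => w H; elim=> [|n IH]; first by split.
have S (p q : nat -> bool) : ((forall i, (i < n)%N -> p i) <->
      (forall i, (i < n)%N -> q i)) ->
    ((forall i, (i < n)%N -> p i) -> p n = q n) ->
    (forall i, (i < n.+1)%N -> p i) <-> (forall i, (i < n.+1)%N -> q i).
  move=> pq pqn.
  have aux (r : nat -> bool) : (forall i, (i < n.+1)%N -> r i) <->
      (forall i, (i < n)%N -> r i) /\ r n.
    split=> [h1|[h1 h2] i]; first by split => [i ilt|]; apply: h1; rewrite // ltnW.
    by rewrite ltnS leq_eqVlt => /predU1P[->//|]; exact: h1.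
  rewrite !aux; split=> -[h1 h2].
    by split; [exact/pq|rewrite -pqn].
  by have h3 := pq.2 h1; split => //; rewrite pqn.
apply: S => // {IH} hn; case: n hn => [|n] hn; first by rewrite mulr0.
rewrite H ge_max; suff -> : X 0 (h * n.+1%:R) w <= u n.+1 by [].
by apply: le_trans (uS n); exact: hn.
Qed.

Lemma pr_extremal_grid (h x : R) (n : nat) : extremal_process beta X ->
  0 < h -> 0 < mu -> 0 < x ->
  pr P (\big[setU/set0]_(i < n)
     [set w | x + mu * h * i.+1%:R < X 0 (h * i.+1%:R) w]) =
  1 - expR (- (h * \sum_(i < n) (x + mu * h * i.+1%:R) `^ (- beta))).
Proof.
move=> eX h0 mu0 x0.
pose u (i : nat) := x + mu * h * i.+1%:R.
have u0 i : 0 < u i by rewrite addr_gt0// !mulr_gt0.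
have uS i : u i <= u i.+1.
  by rewrite lerD2l ler_pM2l ?mulr_gt0// ler_nat.
have mX s t (y : R) : measurable [set w | y < X s t w].
  have -> : [set w | y < X s t w] = X s t @^-1` `]y, +oo[.
    by apply/seteqP; split => w /=; rewrite in_itv/= andbT.
  by rewrite -[_ @^-1` _]setTI; exact: (measurable_funP (X s t)).
have mXc s t (y : R) : measurable (X s t @^-1` `]-oo, y]).
  by rewrite -[_ @^-1` _]setTI; exact: (measurable_funP (X s t)).
have mU : measurable (\big[setU/set0]_(i < n)
     [set w | x + mu * h * i.+1%:R < X 0 (h * i.+1%:R) w]).
  by apply: bigsetU_measurable => i _; exact: mX.
rewrite -[LHS](subKr 1) -prC//; congr (1 - _).
pose Y (i : 'I_n) := X (h * i%:R) (h * i.+1%:R).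
rewrite (@eq_pr_ae _ _ _ _ _ (\big[setI/setT]_(i < n)
    (Y i @^-1` `]-oo, u i])))//; last 3 first.
- exact: measurableC.
- by apply: bigsetI_measurable => i _; exact: mXc.
- apply: filterS (extremal_grid_le eX h0 uS) => w /(_ n) Xw.
  rewrite -(bigcup_mkord n (fun i =>
    [set w | x + mu * h * i.+1%:R < X 0 (h * i.+1%:R) w])) -(bigcap_mkord n (fun i =>
    X (h * i%:R) (h * i.+1%:R) @^-1` `]-oo, u i])).
  rewrite setC_bigcup; split => H i /= ilt.
    rewrite in_itv/=; apply: Xw.1 => // j jlt.
    by have /negP := H j jlt; rewrite -leNgt.
  by apply/negP; rewrite -leNgt; apply: Xw.2.
have sE (i : nat) : h * i.+1%:R - h * i%:R = h.
  by rewrite -natr1 mulrDr mulr1 addrAC subrr add0r.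
have st (i : nat) : 0 <= h * i%:R <= h * i.+1%:R.
  by rewrite mulr_ge0 ?(ltW h0)//= ler_pM2l// ler_nat.
have tI : trivIset setT (fun i : 'I_n => `]h * i%:R, h * i.+1%:R[%classic).
  have aux (i j : 'I_n) z : `]h * i%:R, h * i.+1%:R[%classic z ->
      `]h * j%:R, h * j.+1%:R[%classic z -> (i <= j)%N.
    rewrite /= !in_itv/= => /andP[iz _] /andP[_ zj]; rewrite -ltnS.
    by rewrite -(ltr_nat R) -(ltr_pM2l h0) (lt_trans iz).
  move=> i j _ _ [z [iz jz]]; apply/val_inj/eqP; rewrite eqn_leq.
  by rewrite (aux _ _ z)// (aux _ _ z).
have := extremal_indep eX (s := fun i : 'I_n => h * i%:R)
  (t := fun i : 'I_n => h * i.+1%:R) (fun i => st i) tI.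
move=> /(_ (index_enum 'I_n) (fun i => Y i @^-1` `]-oo, u i])) indY.
rewrite /pr indY//; last 2 first.
- exact: index_enum_uniq.
- by move=> i _; exists `]-oo, u i]%classic => //; rewrite setTI.
have YE (i : 'I_n) : P (Y i @^-1` `]-oo, u i]) = (expR (- (h / u i `^ beta)))%:E.
  rewrite -(extremal_cdf eX)//; last exact: ltW.
  have := extremal_stationary eX (st i); rewrite sE => /(_ `]-oo, u i]%classic).
  exact.
under eq_bigr do rewrite YE.
rewrite prodEFin/= -expR_sum; congr expR.
by rewrite sumrN -mulr_sumr; under [in RHS]eq_bigr do rewrite powRN.
Qed.

End extremal_grid.

Section bigcup_partial.
Context d (T : measurableType d) (R : realType) (P : probability T R).

Lemma pr_bigcup_le_partial (F : nat -> set T) K : (forall i, measurable (F i)) ->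
  (forall n, pr P (\big[setU/set0]_(i < n) F i) <= K) -> pr P (\bigcup_n F n) <= K.
Proof.
move=> mF FK; rewrite -bigcup_bigsetU_bigcup.
apply: pr_bigcup_le => // [i|n m nm].
  by apply: bigsetU_measurable.
by apply: subset_bigsetU.
Qed.

End bigcup_partial.

Section extremal_law.
Context d (T : measurableType d) (R : realType) (P : probability T R).
Context (beta mu : R) (X : R -> R -> {RV P >-> R}).

Let grid (x h : R) (i : nat) :=
  [set w | x + mu * h * i.+1%:R < X 0 (h * i.+1%:R) w].

Let mgrid x h i : measurable (grid x h i).
Proof.
have -> : grid x h i = X 0 (h * i.+1%:R) @^-1` `]x + mu * h * i.+1%:R, +oo[.
  by apply/seteqP; split => w /=; rewrite in_itv/= andbT.
by rewrite -[_ @^-1` _]setTI; exact: (measurable_funP (X _ _)).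
Qed.

(** By right-continuity an exceedance at [t] persists on a right neighbourhood of [t], which
    contains a dyadic time. This makes the event a countable union. *)
Lemma sup_drifted_gtE x : extremal_process beta X ->
  [set w | (x%:E < sup_drifted mu X w)%E] =
  \bigcup_m \bigcup_i grid x (2^-1 ^+ m) i.
Proof.
move=> eX; apply/seteqP; split => w /=.
  move=> /ereal_sup_gt[_ [t + <-]]; rewrite /= in_itv/= andbT lte_fin => t0 xt.
  have [rc _] := extremal_cadlag eX w.
  have : \forall s \near t^'+, x + mu * s < X 0 s w.
    have c : X 0 s w - mu * s @[s --> t^'+] --> X 0 t w - mu * t.
      apply: cvgB; first by apply: rc; exact: ltW.
      by apply: cvgMr; apply: cvg_at_right_filter; exact: cvg_id.
    have /cvgr_gt := c; move=> /(_ _ xt); apply: filterS => s; lra.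
  move=> [e /= e0 He].
  have [m me] : exists m, 2^-1 ^+ m < e.
    have [m Hm] := @exprn_unbounded R 2 (e^-1 + 1) (ltr1n R 2).
    exists m; rewrite exprVn -[ltRHS]invrK ltf_pV2 ?posrE ?exprn_gt0 ?invr_gt0//.
    by rewrite (lt_le_trans _ Hm)// ltrDl.
  have h0 : 0 < 2^-1 ^+ m :> R by rewrite exprn_gt0.
  (* The first grid time after [t]: index [i] stands for the time [2^-1 ^+ m * i.+1]. *)
  exists m => //; exists (Num.truncn (t / 2^-1 ^+ m)) => //.
  rewrite /grid /= -mulrA; apply: He.
    rewrite /ball/= ltr_norml.
    have /andP[tl tr] : (Num.truncn (t / 2^-1 ^+ m))%:R <= t / 2^-1 ^+ m <
       (Num.truncn (t / 2^-1 ^+ m)).+1%:R.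
      by apply: truncn_itv; rewrite divr_ge0 ?(ltW t0) ?(ltW h0).
    move: tl tr; rewrite ler_pdivlMr// ltr_pdivrMr// -natr1; nra.
  by rewrite mulrC -ltr_pdivrMr// truncnS_gt.
move=> [m _ [i _]]; rewrite /grid/= => xi.
apply: (@lt_le_trans _ _ (X 0 (2^-1 ^+ m * i.+1%:R) w - mu * (2^-1 ^+ m * i.+1%:R))%:E).
  by rewrite lte_fin; lra.
apply: ereal_sup_ubound; exists (2^-1 ^+ m * i.+1%:R) => //=.
by rewrite in_itv/= andbT mulr_gt0// exprn_gt0.
Qed.

Lemma sup_drifted_law x : extremal_process beta X -> 1 < beta -> 0 < mu ->
  0 < x ->
  P [set w | (x%:E < sup_drifted mu X w)%E] =
  (1 - expR (- (x `^ (1 - beta) / (mu * (beta - 1)))))%:E.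
Proof.
move=> eX b1 mu0 x0; rewrite sup_drifted_gtE//.
set I := x `^ (1 - beta) / (mu * (beta - 1)).
have b0 : 0 < beta - 1 by lra.
pose U m := \bigcup_i grid x (2^-1 ^+ m) i.
have mU m : measurable (U m) by exact: bigcupT_measurable.
have h0 m : 0 < 2^-1 ^+ m :> R by rewrite exprn_gt0.
have mh0 m : 0 < mu * 2^-1 ^+ m by rewrite mulr_gt0.
rewrite prE; last exact: bigcupT_measurable.
congr EFin; apply/eqP; rewrite eq_le; apply/andP; split.
  apply: pr_bigcup_le => //.
    have US m : U m `<=` U m.+1.
      (* Dyadic grids are nested; halving the mesh turns the multiple [i.+1] into [i.*2.+2]. *)
      move=> w [i _ /= Ui]; exists (i.*2.+1) => //; move: Ui; rewrite /grid/=.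
      have hE : 2^-1 ^+ m.+1 * i.*2.+2%:R = 2^-1 ^+ m * i.+1%:R :> R.
        by rewrite -doubleS -muln2 natrM exprSr; field.
      by rewrite -!mulrA hE.
    move=> n m /subnK <-; elim: (m - n)%N => //= k IH.
    by apply: subset_trans IH _; exact: US.
  move=> m; apply: pr_bigcup_le_partial => // n.
  rewrite (pr_extremal_grid n eX (h0 m) mu0 x0) lerD2l lerN2 ler_expR lerN2.
  have := powR_sum_le n x0 (mh0 m) b1.
  rewrite -mulrA -ler_pdivlMl// => /le_trans; apply.
  rewrite /I invfM [leRHS]mulrCA ler_pM2l ?invr_gt0// ler_pM2r ?invr_gt0//.
  by rewrite lerBlDr lerDl powR_ge0.
set p := pr P _.
have lower m : 1 - expR (- (I - (x + mu * 2 ^+ m) `^ (1 - beta) / (mu * (beta - 1))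
    - 2^-1 ^+ m * x `^ (- beta))) <= p.
  (* With mesh [2^-1 ^+ m], this many cells reach time [2 ^+ m]: the mesh vanishes while the horizon
     grows. *)
  pose n := (4 ^ m)%N.
  apply: (@le_trans _ _ (pr P (\big[setU/set0]_(i < n) grid x (2^-1 ^+ m) i))); last first.
    apply: le_pr.
    - by apply: bigsetU_measurable.
    - exact: bigcupT_measurable.
    - by rewrite -bigcup_mkord => w [i _ Ui]; exists m => //; exists i.
  rewrite (pr_extremal_grid n eX (h0 m) mu0 x0) lerD2l lerN2 ler_expR lerN2.
  (* The integral is below the sum over left endpoints, whereas the process gives right endpoints;
     the missing term [j = 0] is the error [2^-1 ^+ m * x ^ (- beta)]. *)
  have := powR_sum_ge n.+1 x0 (mh0 m) b1.
  rewrite big_ord_recl mulr0 addr0 mulrDr.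
  set S := \sum_(i < n) (x + mu * 2^-1 ^+ m * i.+1%:R) `^ (- beta) => S1.
  have {}S1 : (x `^ (1 - beta) - (x + mu * 2^-1 ^+ m * n.+1%:R) `^ (1 - beta)) /
    (beta - 1) <= mu * 2^-1 ^+ m * x `^ (- beta) + mu * 2^-1 ^+ m * S := S1.
  have S2 : (x + mu * 2^-1 ^+ m * n.+1%:R) `^ (1 - beta) <=
      (x + mu * 2 ^+ m) `^ (1 - beta).
    have -> : 1 - beta = - (beta - 1) by ring.
    rewrite !powRN lef_pV2 ?posrE ?powR_gt0 ?addr_gt0 ?mulr_gt0 ?exprn_gt0//.
    apply: ge0_ler_powR; rewrite ?nnegrE ?(ltW b0) ?addr_ge0 ?mulr_ge0 ?exprn_ge0
      ?(ltW x0) ?(ltW mu0)//.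
    rewrite lerD2l -mulrA ler_pM2l// exprVn ler_pdivlMl ?exprn_gt0// -exprMn.
    by rewrite /n -natrM -natrX ler_nat; exact: leqnSn.
  rewrite -(ler_pM2l mu0) mulrA; apply: le_trans (_ : _ <=
    (x `^ (1 - beta) - (x + mu * 2^-1 ^+ m * n.+1%:R) `^ (1 - beta)) /
    (beta - 1) - mu * 2^-1 ^+ m * x `^ (- beta)) _; last by lra.
  rewrite [leLHS](_ : _ = (x `^ (1 - beta) - (x + mu * 2 ^+ m) `^ (1 - beta)) /
    (beta - 1) - mu * 2^-1 ^+ m * x `^ (- beta)); last first.
    by rewrite /I; field; rewrite !gt_eqF.
  by rewrite lerD2r ler_pM2r ?invr_gt0// lerD2l lerN2.
have lim : 1 - expR (- (I - (x + mu * 2 ^+ m) `^ (1 - beta) / (mu * (beta - 1))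
    - 2^-1 ^+ m * x `^ (- beta))) @[m --> \oo] --> 1 - expR (- I).
  apply: cvgB; first exact: cvg_cst.
  apply: (@cvg_comp _ _ _ _ expR _ (nbhs (- I))); last exact: continuous_expR.
  apply: cvgN; rewrite -[X in _ --> X]subr0 -[X in _ --> X]subr0.
  apply: cvgB.
    apply: cvgB; first exact: cvg_cst.
    rewrite -(mul0r (mu * (beta - 1))^-1); apply: cvgMl.
    have -> : 1 - beta = - (beta - 1) by ring.
    apply: (@cvg_comp _ _ _ (fun m => x + mu * 2 ^+ m)
      (fun y => y `^ (- (beta - 1))) _ (pinfty_nbhs R)); last exact: cvgr_powRN_pinfty.
    apply/cvgryPge => K; near=> m.
    have : K / mu <= 2 ^+ m.
      near: m.
      have [m Hm] := @exprn_unbounded R 2 (K / mu) (ltr1n R 2).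
      exists m => // k /= mk; apply: (le_trans Hm).
      by rewrite ler_weXn2l// ler1n.
    by rewrite ler_pdivrMr// mulrC; lra.
  rewrite -(mul0r (x `^ (- beta))); apply: cvgMl; apply: cvg_expr.
  by rewrite ger0_norm; lra.
rewrite -(cvg_lim _ lim)//; apply: limr_le; first by apply/cvg_ex; eexists; exact: lim.
by apply: nearW => m; exact: lower.
Unshelve. all: end_near.
Qed.

End extremal_law.

(** * Exponential moments *)

Section exponential_moments.
Context d (T : measurableType d) (R : realType) (P : probability T R).

Lemma expR_sub1_bounds (u : R) : u <= expR u - 1 <= u * expR u.
Proof.
apply/andP; split; first by have := expR_ge1Dx u; lra.
have := expR_ge1Dx (- u); rewrite expRN.
rewrite -(ler_pM2r (expR_gt0 u)) mulVf ?gt_eqF ?expR_gt0//; lra.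
Qed.

(* With [X] heavy-tailed, [expR (th * X)] is not integrable for any [th > 0];
   the cap [K] does not depend on [th], so it is inactive in the limit
   [th -> 0]. *)
Definition truncated_exp (X K Z : T -> R) (th : R) (w : T) : R :=
  expR (Num.min (th * X w) (K w) - th * Z w).

Lemma measurable_truncated_exp (X K Z : T -> R) th :
  measurable_fun setT X -> measurable_fun setT K -> measurable_fun setT Z ->
  measurable_fun setT (truncated_exp X K Z th).
Proof.
move=> mX mK mZ; apply: measurableT_comp => //.
apply: measurable_funB; last exact: measurable_funM.
by apply: measurable_minr => //; exact: measurable_funM.
Qed.

(** The dominating function for the difference quotients. With [m] the minimum in the exponent,
    [expR m - 1 <= m * expR m], where [th * X] bounds the factor and [K] the exponent; from below
    [u <= expR u - 1]. *)
Lemma truncated_exp_bound (X K Z : T -> R) (th : R) w :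
  0 < th <= 1 -> 0 <= X w -> 0 < K w -> 0 <= Z w ->
  `|(truncated_exp X K Z th w - 1) / th| <= X w * expR (K w) + Z w.
Proof.
move=> /andP[th0 th1] X0 K0 Z0; rewrite /truncated_exp.
set m := Num.min _ _.
have m0 : 0 <= m by rewrite le_min (mulr_ge0 (ltW th0) X0) (ltW K0).
have mK : m <= K w by rewrite ge_min lexx orbT.
have mX : m <= th * X w by rewrite ge_min lexx.
have thZ : 0 <= th * Z w by rewrite mulr_ge0// ltW.
have XK : 0 <= X w * expR (K w) by rewrite mulr_ge0// expR_ge0.
rewrite normrM normfV (gtr0_norm th0) ler_pdivrMr// ler_norml.
apply/andP; split.
  have /andP[h _] := expR_sub1_bounds (m - th * Z w).
  have thXK : 0 <= th * (X w * expR (K w)) by rewrite mulr_ge0// ltW.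
  by lra.
have /andP[_ h] := expR_sub1_bounds m.
have : expR (m - th * Z w) <= expR m by rewrite ler_expR gerBl.
have : m * expR m <= th * X w * expR (K w).
  by apply: ler_pM => //; rewrite ?expR_ge0// ler_expR.
lra.
Qed.

Lemma truncated_exp_cvg (X K Z : T -> R) (th : R^nat) w :
  (forall n, 0 < th n) -> th n @[n --> \oo] --> (0 : R) ->
  0 < K w ->
  (truncated_exp X K Z (th n) w - 1) / th n @[n --> \oo] --> X w - Z w.
Proof.
move=> th0 thc K0; set y := X w - Z w.
have c0 (z : R) : th n * z @[n --> \oo] --> 0.
  by rewrite -(mul0r z); apply: cvgMl.
have e : \forall n \near \oo,
    (truncated_exp X K Z (th n) w - 1) / th n = (expR (th n * y) - 1) / th n.
  near=> n; rewrite /truncated_exp min_l; first by rewrite /y mulrBr.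
  by near: n; have /cvgr_le := c0 (X w); apply.
apply: (cvg_trans (G := (fun n => (expR (th n * y) - 1) / th n) @ \oo)).
  by apply: near_eq_cvg; apply: filterS e => n /esym.
apply: (@squeeze_cvgr _ _ _ _ (fun=> y) (fun n => y * expR (th n * y))).
- near=> n; have /andP[h1 h2] := expR_sub1_bounds (th n * y).
  rewrite ler_pdivlMr// ler_pdivrMr//.
  by rewrite (mulrC y (th n)) h1/= mulrAC (mulrC y (th n)).
- exact: cvg_cst.
- have c1 : expR (th n * y) @[n --> \oo] --> expR 0.
    by apply: cvg_comp; [exact: c0|exact: continuous_expR].
  have c2 : y * expR (th n * y) @[n --> \oo] --> y * expR 0 by exact: cvgMr.
  by rewrite expR0 mulr1 in c2.
Unshelve. all: end_near.
Qed.

(* By dominated convergence, the left-hand side has derivative [m] at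
   [th = 0]. *)
Lemma chernoff_small (X K Z : T -> R) (m m' : R) :
  measurable_fun setT X -> measurable_fun setT K -> measurable_fun setT Z ->
  {ae P, forall w, [/\ 0 <= X w, 0 < K w & 0 <= Z w]} ->
  P.-integrable setT (EFin \o (fun w => X w * expR (K w))) ->
  P.-integrable setT (EFin \o Z) ->
  (\int[P]_w (X w - Z w)%:E = m%:E)%E -> m < m' ->
  exists2 th0, 0 < th0 & forall th, 0 < th <= th0 ->
    (\int[P]_w (truncated_exp X K Z th w)%:E <= (1 + th * m')%:E)%E.
Proof.
move=> mX mK mZ pos iX iZ im mm'; apply: contrapT => H.
(* Dominated convergence is sequential, so the failure of the claim is turned into a sequence of
   counterexamples tending to 0. *)
have /choice[th thP] : forall n : nat, exists th, 0 < th <= n.+1%:R^-1 /\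
    ((1 + th * m')%:E < \int[P]_w (truncated_exp X K Z th w)%:E)%E.
  move=> n; apply: contrapT => Hn; apply: H; exists n.+1%:R^-1 => // th thn.
  by rewrite leNgt; apply/negP => h; apply: Hn; exists th.
have th0 n : 0 < th n by have [/andP[]] := thP n.
have th1 n : th n <= 1.
  have [/andP[_ h] _] := thP n; apply: (le_trans h).
  by rewrite invf_le1// ler1n.
have thc : th n @[n --> \oo] --> (0 : R).
  apply: (@squeeze_cvgr _ _ _ _ (fun=> 0) (fun n => n.+1%:R^-1)).
  - by apply: nearW => n; have [/andP[/ltW -> ->]] := thP n.
  - exact: cvg_cst.
  - exact: cvg_harmonic.
pose D n w := (truncated_exp X K Z (th n) w - 1) / th n.
have mD n : measurable_fun setT (D n).
  apply: measurable_funM => //; apply: measurable_funB => //.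
  exact: measurable_truncated_exp.
pose G w := X w * expR (K w) + Z w.
have iG : P.-integrable setT (EFin \o G) by exact: (integrableD measurableT iX iZ).
have mDE n : measurable_fun setT (EFin \o D n) by exact/measurable_EFinP.
have mXZ : measurable_fun setT (fun w => (X w - Z w)%:E).
  by apply/measurable_EFinP; exact: measurable_funB.
have cvgD : {ae P, forall w, setT w -> (D n w)%:E @[n --> \oo] --> (X w - Z w)%:E}.
  apply: filterS pos => w [X0 K0 Z0] _; apply: cvg_EFin; first by apply: nearW.
  exact: truncated_exp_cvg.
have domD : {ae P, forall w n, setT w -> (`|(D n w)%:E| <= (G w)%:E)%E}.
  apply: filterS pos => w [X0 K0 Z0] n _; rewrite lee_fin.
  by apply: truncated_exp_bound; rewrite ?th0 ?th1.
have [_ _ dct] := @dominated_convergence _ _ _ P setT measurableT _ _ _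
  mDE mXZ cvgD iG domD.
rewrite im in dct.
have iD n : P.-integrable setT (EFin \o D n).
  apply/integrableP; split; first exact/measurable_EFinP.
  have /integrableP[_] := iG; apply: le_lt_trans.
  apply: ae_ge0_le_integral => //.
  - by apply/measurableT_comp => //; exact/measurable_EFinP.
  - by apply/measurableT_comp => //; case/integrableP: iG.
  - apply: filterS pos => w [X0 K0 Z0] _; rewrite lee_fin.
    apply: le_trans (ler_norm _).
    by apply: truncated_exp_bound; rewrite ?th0 ?th1.
have D_gt n : (m'%:E <= \int[P]_w (D n w)%:E)%E.
  have [_] := thP n.
  have -> : (fun w => (truncated_exp X K Z (th n) w)%:E) =
      (fun w => (1 : R)%:E + (th n)%:E * (D n w)%:E)%E.
    apply/funext => w; rewrite /D -EFinM -EFinD; congr EFin.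
    by rewrite mulrC divfK ?gt_eqF// addrC subrK.
  rewrite integralD//; last 2 first.
    by apply: finite_measure_integrable_cst.
    exact: (integrableZl measurableT (th n) (iD n)).
  have -> : (\int[P]_w (1 : R)%:E = 1%:E)%E.
    by rewrite integral_cst// mul1e; exact: probability_setT.
  rewrite (integralZl measurableT (iD n)).
  have /fineK <- : (\int[P]_w (D n w)%:E)%E \is a fin_num.
    exact: (integrable_fin_num measurableT (iD n)).
  rewrite -EFinM -EFinD lte_fin lee_fin ltrD2l ltr_pM2l//; exact: ltW.
have : (m'%:E <= m%:E)%E.
  rewrite -(cvg_lim _ dct)//; apply: lime_ge; first by apply/cvg_ex; eexists; exact: dct.
  exact: nearW D_gt.
by rewrite lee_fin leNgt mm'.
Qed.

End exponential_moments.

Section moments.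
Context d (T : measurableType d) (R : realType) (P : probability T R).

Lemma measurable_gt (X : {RV P >-> R}) (a : R) : measurable [set w | a < X w].
Proof.
have -> : [set w | a < X w] = X @^-1` `]a, +oo[.
  by apply/seteqP; split => w /=; rewrite in_itv/= andbT.
by rewrite -[_ @^-1` _]setTI; exact: (measurable_funP X).
Qed.

(** Layers: [Y] is at most [y 0] plus the sum of [y k.+1] over the levels [t k] that [X] has passed,
    and the expectations of these terms are bounded by a geometric series. *)
Lemma integrable_tail (X : {RV P >-> R}) (Y : T -> R) (t y : nat -> R) (K r : R) :
  measurable_fun setT Y ->
  {ae P, forall w, 0 <= Y w /\ forall n, X w <= t n -> Y w <= y n} ->
  (forall a, exists n, a <= t n) -> (forall n, 0 <= y n) -> 0 <= r < 1 ->
  (forall k, y k.+1 * pr P [set w | t k < X w] <= K * r ^+ k) ->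
  P.-integrable setT (EFin \o Y).
Proof.
move=> mY Yy tu y0 /andP[r0 r1] yK.
pose E k := [set w | t k < X w].
have mE k : measurable (E k) by exact: measurable_gt.
pose f k w : \bar R := ((y k.+1)%:E * (\1_(E k) w)%:E)%E.
have f0 k w : (0 <= f k w)%E.
  by rewrite /f -EFinM lee_fin mulr_ge0//.
have mf k : measurable_fun setT (f k).
  by apply: measurable_funeM; apply/measurable_EFinP; exact: measurable_indic.
pose g w := ((y 0%N)%:E + \sum_(0 <= k <oo) f k w)%E.
have mg : measurable_fun setT g.
  apply: emeasurable_funD => //.
  by apply: ge0_emeasurable_sum => [k w _ _|k _]; [exact: f0|exact: mf].
have g0 w : (0 <= g w)%E.
  by rewrite /g adde_ge0 ?lee_fin// nneseries_ge0// => k _ _; exact: f0.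
apply/integrableP; split; first exact/measurable_EFinP.
apply: (@le_lt_trans _ _ (\int[P]_w g w)%E).
  apply: ae_ge0_le_integral => //.
    by apply: measurableT_comp => //; exact/measurable_EFinP.
  apply: filterS Yy => w [Y0 Yt] _ /=; rewrite ger0_norm//.
  (* The first level not passed: [Y w <= y n], and for [n > 0] the preceding level is passed, so
     that a single term of the series already dominates. *)
  have [n Xn nmin] := ex_minnP (tu (X w)).
  apply: (@le_trans _ _ (y n)%:E); first by rewrite lee_fin Yt.
  case: n Xn nmin => [|n] Xn nmin.
    by rewrite /g leeDl// nneseries_ge0// => k _ _; exact: f0.
  have En : E n w.
    by rewrite /E/= ltNge; apply/negP => /nmin; rewrite ltnn.
  apply: (@le_trans _ _ (f n w)).
    by rewrite /f indicE mem_set// mule1.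
  apply: (@le_trans _ _ (\sum_(0 <= k < n.+1) f k w)%E).
    by rewrite big_nat_recr//= leeDr// sume_ge0.
  apply: (@le_trans _ _ (\sum_(0 <= k <oo) f k w)%E).
    by apply: nneseries_lim_ge => k _ _; exact: f0.
  by rewrite /g leeDr// lee_fin.
rewrite /g ge0_integralD//; last 3 first.
- by move=> w _; rewrite lee_fin.
- by move=> w _; rewrite nneseries_ge0// => k _ _; exact: f0.
- by apply: ge0_emeasurable_sum => [k w _ _|k _]; [exact: f0|exact: mf].
rewrite lte_add_pinfty//.
  rewrite integral_cst// lte_mul_pinfty ?lee_fin//.
  by rewrite (le_lt_trans (probability_le1 _ _)) ?ltry.
rewrite integral_nneseries//.
apply: (@le_lt_trans _ _ (K / (1 - r))%:E); last exact: ltry.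
apply: lime_le; first by apply: is_cvg_nneseries => k _ _; apply: integral_ge0.
apply: nearW => n.
rewrite (eq_bigr (fun k => (y k.+1 * pr P (E k))%:E)); last first.
  move=> k _; rewrite /f ge0_integralZl//; last 2 first.
    by apply/measurable_EFinP; exact: measurable_indic.
    by rewrite lee_fin.
  by rewrite integral_indic// setIT EFinM -prE.
rewrite sumEFin lee_fin.
apply: (@le_trans _ _ (\sum_(0 <= k < n) K * r ^+ k)).
  by apply: ler_sum => k _; exact: yK.
have K0 : 0 <= K.
  have := yK 0%N; rewrite expr0 mulr1; apply: le_trans.
  by rewrite mulr_ge0// pr_ge0.
have r10 : 0 < 1 - r by lra.
rewrite -mulr_sumr ler_wpM2l//.
have -> : \sum_(0 <= k < n) r ^+ k = (1 - r ^+ n) / (1 - r).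
  elim: n => [|n IH]; first by rewrite big_nil expr0 subrr mul0r.
  by rewrite big_nat_recr//= IH exprS; field; rewrite gt_eqF.
by rewrite -[leRHS]mul1r ler_pM2r ?invr_gt0// lerBlDr lerDl exprn_ge0.
Qed.

Lemma integrable_power_tail (X : {RV P >-> R}) (C y1 p : R) :
  positive_RV X -> 0 < y1 -> 1 < p ->
  (forall s, y1 <= s -> pr P [set w | s < X w] <= C * s `^ (- p)) ->
  P.-integrable setT (EFin \o (fun w => `|X w|)).
Proof.
move=> X0 y10 p1 H.
have t0 n : 0 < y1 * 2 ^+ n by rewrite mulr_gt0// exprn_gt0.
apply: (@integrable_tail X _ (fun n => y1 * 2 ^+ n) (fun n => y1 * 2 ^+ n)
    (2 * y1 * C * y1 `^ (- p)) (2 `^ (1 - p))).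
- exact: measurableT_comp.
- by apply: filterS X0 => w Xw; rewrite gtr0_norm//; split => //; exact: ltW.
- move=> a; have [n an] := @exprn_unbounded R 2 (a / y1) (ltr1n R 2).
  by exists n; rewrite mulrC -ler_pdivrMr.
- by move=> n; exact: ltW.
- rewrite powR_ge0/= -[ltRHS](powRr0 2); apply: ltr_gt1_powR; [exact: ltr1n|lra].
- move=> k; have yk : y1 <= y1 * 2 ^+ k.
    by rewrite ler_pMr// exprn_ege1// ler1n.
  apply: le_trans (ler_wpM2l (ltW (t0 _)) (H _ yk)) _.
  have hk : (2 ^+ k : R) `^ (- p) = (2 `^ (- p)) ^+ k.
    rewrite -(@powR_mulrn _ 2 k)// -(@powR_mulrn _ (2 `^ (- p)) k) ?powR_ge0//.
    exact: powRAC.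
  have h2 : (2 : R) `^ (1 - p) = 2 * 2 `^ (- p).
    by rewrite powRD ?pnatr_eq0 ?implybT// powRr1.
  rewrite powRM ?(ltW y10) ?exprn_ge0// hk h2 exprMn exprS.
  by rewrite le_eqVlt; apply/orP; left; apply/eqP; ring.
Qed.

(** The inequality [v <= expR v] at [v = e * u / p], raised to the power [p]. *)
Lemma powR_le_expR (u p e : R) : 0 <= u -> 0 < p -> 0 < e ->
  u `^ p <= (p / e) `^ p * expR (e * u).
Proof.
move=> u0 p0 e0; have pe0 : 0 < p / e by rewrite divr_gt0.
have h : u <= p / e * expR (e * u / p).
  have := expR_ge1Dx (e * u / p); set E := expR _ => hE.
  have : e * u / p <= E by lra.
  rewrite ler_pdivrMr// -ler_pdivlMl// => /le_trans; apply.
  by rewrite le_eqVlt; apply/orP; left; apply/eqP; field; rewrite gt_eqF.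
have := ge0_ler_powR (ltW p0) (_ : u \in Num.nneg)
  (_ : p / e * expR (e * u / p) \in Num.nneg) h.
rewrite !nnegrE u0 mulr_ge0 ?(ltW pe0) ?expR_ge0// => /(_ isT isT).
rewrite powRM ?(ltW pe0) ?expR_ge0//.
by rewrite -expRM -mulrA mulVf ?mulr1 ?gt_eqF.
Qed.

(** Between [c] and [q1] an intermediate [c1] is inserted: raising [c] to [c1] absorbs the factor
    [X], and the gap to [q1] yields the geometric ratio [expR (c1 - q1)] on the levels where
    [X ^ alpha] is [n0 + n]. *)
Lemma integrable_weibull (X : {RV P >-> R}) (alpha q1 c x0 : R) :
  positive_RV X -> 0 < alpha -> 0 < c -> c < q1 ->
  (forall a, x0 <= a -> pr P [set w | a < X w] <= expR (- (q1 * a `^ alpha))) ->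
  P.-integrable setT (EFin \o (fun w => `|X w| * expR (c * X w `^ alpha))).
Proof.
move=> X0 al0 c0 cq H.
have [c1 [cc1 c1q]] : exists c1, c < c1 /\ c1 < q1.
  by exists ((c + q1) / 2); split; lra.
pose e := c1 - c; have e0 : 0 < e by rewrite /e; lra.
have alV0 : 0 < alpha^-1 by rewrite invr_gt0.
have alK (z : R) : 0 <= z -> (z `^ alpha) `^ alpha^-1 = z.
  by move=> z0; rewrite -powRrM mulfV ?gt_eqF// powRr1.
have alVK (z : R) : 0 <= z -> (z `^ alpha^-1) `^ alpha = z.
  by move=> z0; rewrite -powRrM mulVf ?gt_eqF// powRr1.
(* Starts the levels beyond [x0], where the tail bound holds. *)
pose n0 := (Num.truncn (`|x0| `^ alpha)).+1.
pose s k : R := n0%:R + k%:R.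
have s0 k : 0 <= s k by rewrite addr_ge0.
have sge (a : R) k : `|a| `^ alpha <= s k -> a <= s k `^ alpha^-1.
  move=> h; rewrite (le_trans (ler_norm _))// -[leLHS]alK//.
  by apply: ge0_ler_powR; rewrite ?nnegrE ?powR_ge0// ltW.
pose C := (alpha^-1 / e) `^ alpha^-1.
have C0 : 0 <= C by exact: powR_ge0.
apply: (@integrable_tail X _ (fun n => s n `^ alpha^-1)
    (fun n => C * expR (c1 * s n)) (C * expR c1 * expR ((c1 - q1) * n0%:R))
    (expR (c1 - q1))).
- apply: measurable_funM; first exact: measurableT_comp.
  apply: measurableT_comp => //; apply: measurable_funM => //.
  by apply: (measurableT_comp (measurable_powR _)).
- apply: filterS X0 => w Xw; rewrite gtr0_norm//; split.
    by rewrite mulr_ge0 ?expR_ge0// ltW.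
  move=> n Xn.
  have Xs : X w `^ alpha <= s n.
    rewrite -[leRHS]alVK//.
    by apply: ge0_ler_powR; rewrite ?nnegrE ?powR_ge0// ltW.
  have := @powR_le_expR (X w `^ alpha) alpha^-1 e (powR_ge0 _ _) alV0 e0.
  rewrite alK ?(ltW Xw)// -/C => h.
  apply: (@le_trans _ _ (C * expR (e * X w `^ alpha) * expR (c * X w `^ alpha))).
    by rewrite ler_pM2r ?expR_gt0.
  rewrite -mulrA -expRD -mulrDl subrK ler_wpM2l// ler_expR ler_pM2l//; lra.
- move=> a; exists (Num.truncn (`|a| `^ alpha)).+1; apply: sge.
  by rewrite /s (le_trans (ltW (truncnS_gt _)))// lerDr.
- by move=> n; rewrite mulr_ge0 ?expR_ge0.
- by rewrite expR_ge0/= expR_lt1; lra.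
- move=> k; have xk : x0 <= s k `^ alpha^-1.
    by apply: sge; rewrite /s (le_trans (ltW (truncnS_gt _)))// lerDl.
  have y0 : 0 <= C * expR (c1 * s k.+1) by rewrite mulr_ge0 ?expR_ge0.
  apply: le_trans (ler_wpM2l y0 (H _ xk)) _.
  rewrite alVK// -expRM_natr -!mulrA -!expRD ler_wpM2l// ler_expR.
  rewrite /s -[k.+1%:R]natr1.
  by rewrite le_eqVlt; apply/orP; left; apply/eqP; ring.
Qed.

End moments.

(** * The jobs of the queueing model *)

Section model.
Context d (T : measurableType d) (R : realType) (P : probability T R).
Context (A : nat -> nat -> {RV P >-> R}) (B Tau : nat -> {RV P >-> R}).

Record queue_model : Prop := QueueModel {
  A_iid : iid (fun ij : nat * nat => A ij.1 ij.2) ;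
  B_iid : iid B ;
  Tau_iid : iid Tau ;
  families_indep : independent_systems P
     (tnth [tuple sigma_of (fun ij : nat * nat => A ij.1 ij.2);
                  sigma_of B; sigma_of Tau]) ;
  A_pos : forall i j, positive_RV (A i j) ;
  B_pos : forall j, positive_RV (B j) ;
  Tau_pos : forall j, positive_RV (Tau j) }.

Hypothesis M : queue_model.

Notation Z := (primitives A B Tau).

Lemma Z_indep : independent_RVs Z.
Proof.
exact: (primitives_independent (A_iid M).1 (B_iid M).1 (Tau_iid M).1
  (families_indep M)).
Qed.

Lemma ae_pos : {ae P, forall w, forall i j,
  [/\ 0 < A i j w, 0 < B j w & 0 < Tau j w]}.
Proof.
apply: ae_foralln => i; apply: ae_foralln => j.
have hA := A_pos M i j; have hB := B_pos M j; have hT := Tau_pos M j.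
by apply: filterS3 hA hB hT => w.
Qed.

Lemma A_law i j i' j' U : measurable U -> P (A i j @^-1` U) = P (A i' j' @^-1` U).
Proof. by move=> mU; have := (A_iid M).2 (i, j) (i', j') U mU. Qed.

Lemma B_law j j' U : measurable U -> P (B j @^-1` U) = P (B j' @^-1` U).
Proof. by move=> mU; have := (B_iid M).2 j j' U mU. Qed.

Lemma Tau_law j j' U : measurable U -> P (Tau j @^-1` U) = P (Tau j' @^-1` U).
Proof. by move=> mU; have := (Tau_iid M).2 j j' U mU. Qed.

(** For one server the triples of different jobs are i.i.d., which is all that the Chernoff bounds
    use; different servers share [B j] and [Tau j] and are dependent. *)
Definition triple i j (w : T) : R * (R * R) := (A i j w, (B j w, Tau j w)).

Definition job i j : set (nat * nat + (nat + nat)) :=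
  [set inl (i, j); inr (inl j); inr (inr j)].

Let mZ S k : S k ->
  measurable_fun setT (Z k : g_sigma_algebraType (gen_on Z S) -> R).
Proof. exact: measurable_gen_on. Qed.

Lemma measurable_triple_gen i j (S : set (nat * nat + (nat + nat))) :
  job i j `<=` S ->
  measurable_fun setT (triple i j : g_sigma_algebraType (gen_on Z S) -> _).
Proof.
move=> jS; apply: measurable_fun_pair.
  by apply: (mZ (k := inl (i, j))); apply: jS; left; left.
apply: measurable_fun_pair.
  by apply: (mZ (k := inr (inl j))); apply: jS; left; right.
by apply: (mZ (k := inr (inr j))); apply: jS; right.
Qed.

Lemma measurable_triple i j : measurable_fun setT (triple i j).
Proof.
by apply: measurable_fun_pair => //; apply: measurable_fun_pair.
Qed.

Lemma B_Tau_indep j : indep_mfun P (B j) (Tau j).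
Proof.
apply: (indep_mfun_gen_on (S1 := [set inr (inl j)]) (S2 := [set inr (inr j)])
  Z_indep).
- by rewrite -subset0 => k /= [-> []].
- exact: (mZ (k := inr (inl j))).
- exact: (mZ (k := inr (inr j))).
Qed.

Lemma A_BTau_indep i j : indep_mfun P (A i j) (fun w => (B j w, Tau j w)).
Proof.
apply: (indep_mfun_gen_on (S1 := [set inl (i, j)])
  (S2 := [set inr (inl j); inr (inr j)]) Z_indep).
- by rewrite -subset0 => k /= [-> [|]].
- exact: (mZ (k := inl (i, j))).
- apply: measurable_fun_pair; first by apply: (mZ (k := inr (inl j))); left.
  by apply: (mZ (k := inr (inr j))); right.
Qed.

Lemma triple_law i j i' j' E : measurable E ->
  P (triple i j @^-1` E) = P (triple i' j' @^-1` E).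
Proof.
pose BT k : {mfun T >-> (R * R)%type} := HB.pack (fun w => (B k w, Tau k w))
  (isMeasurableFun.Build _ _ _ _ _
    (measurable_fun_pair (measurable_funP (B k)) (measurable_funP (Tau k)))).
apply: (@same_law_pair _ _ _ _ _ _ _ _ _ _ (BT j) (BT j')).
- exact: A_BTau_indep.
- exact: A_BTau_indep.
- by move=> U mU; exact: A_law.
- move=> U mU; apply: same_law_pair => //.
  + exact: B_Tau_indep.
  + exact: B_Tau_indep.
  + by move=> V mV; exact: B_law.
  + by move=> V mV; exact: Tau_law.
Qed.

Lemma triple_integral i j (f : R * (R * R) -> R) :
  measurable_fun setT f -> (forall z, 0 <= f z) ->
  (\int[P]_w (f (triple i j w))%:E = \int[P]_w (f (triple 0 0 w))%:E)%E.
Proof.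
move=> mf f0.
pose X i j : {mfun T >-> (R * (R * R))%type} := HB.pack (triple i j)
  (isMeasurableFun.Build _ _ _ _ _ (measurable_triple i j)).
have E k l : (\int[P]_w (f (triple k l w))%:E =
    \int[distribution P (X k l)]_z (f z)%:E)%E.
  rewrite ge0_integral_distribution//; first exact/measurable_EFinP.
rewrite !E; apply: eq_measure_integral => U mU _; exact: triple_law.
Qed.

Lemma trivIset_job i : trivIset setT (job i).
Proof.
by move=> j k _ _ [x [[[->|->]|->]]] [[]|] => // -[].
Qed.

Lemma integral_prod_triple i k (f : R * (R * R) -> R) :
  measurable_fun setT f -> (forall z, 0 <= f z) ->
  (\int[P]_w (\prod_(j < k) f (triple i j w))%:E =
   \big[mule/1]_(j < k) \int[P]_w (f (triple 0 0 w))%:E)%E.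
Proof.
move=> mf f0.
rewrite (@ge0_integral_prod_indep _ _ _ _ _ Z (fun j w => f (triple i j w))
  (job i) k Z_indep (@trivIset_job i))//.
  by apply: eq_bigr => j _; exact: triple_integral.
move=> j; apply: measurableT_comp => //.
exact: measurable_triple_gen.
Qed.

Lemma measurable_prod_triple i k (f : R * (R * R) -> R) :
  measurable_fun setT f ->
  measurable_fun setT (fun w => \prod_(j < k) f (triple i j w)).
Proof.
move=> mf; apply: measurable_prod => j _.
by apply: measurableT_comp => //; exact: measurable_triple.
Qed.

(** Markov's inequality, with the mean of the product factored over the jobs. [f] is left general
    because deviations upwards and downwards need different exponents. *)
Lemma chernoff_prod i k (f : R * (R * R) -> R) (v s : R) :
  measurable_fun setT f -> (forall z, 0 <= f z) ->
  (\int[P]_w (f (triple 0 0 w))%:E <= v%:E)%E ->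
  pr P [set w | expR s < \prod_(j < k) f (triple i j w)] <= expR (- s) * v ^+ k.
Proof.
move=> mf f0 fv.
set W := fun w => \prod_(j < k) f (triple i j w).
have mW : measurable_fun setT W by exact: measurable_prod_triple.
have W0 w : 0 <= W w by apply: prodr_ge0.
have mE : measurable [set w | expR s < W w].
  have -> : [set w | expR s < W w] = W @^-1` `]expR s, +oo[.
    by apply/seteqP; split => w /=; rewrite in_itv/= andbT.
  by rewrite -[_ @^-1` _]setTI; exact: mW.
have v0 : 0 <= v.
  by rewrite -lee_fin; apply: le_trans fv; apply: integral_ge0 => w _; rewrite lee_fin.
rewrite expRN mulrC ler_pdivlMr ?expR_gt0//.
have h1 : ((expR s * pr P [set w | (expR s < W w)%R])%:E <= \int[P]_w (W w)%:E)%E.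
  rewrite EFinM -prE//.
  have <- : (\int[P]_w ((expR s)%:E * (\1_[set w | (expR s < W w)%R] w)%:E) =
      (expR s)%:E * P [set w | (expR s < W w)%R])%E.
    rewrite ge0_integralZl//.
    - by rewrite integral_indic// setIT.
    - by apply/measurable_EFinP; exact: measurable_indic.
  apply: ge0_le_integral => //.
  - by apply: measurable_funeM; apply/measurable_EFinP; exact: measurable_indic.
  - exact/measurable_EFinP.
  - move=> w _; rewrite -EFinM lee_fin indicE.
    have [wE|wE] := boolP (w \in _); last by rewrite mulr0.
    by rewrite mulr1; move: wE; rewrite inE/= => /ltW.
rewrite -lee_fin mulrC; apply: (le_trans h1); rewrite integral_prod_triple//.
have u0 : (0 <= \int[P]_w (f (triple 0 0 w))%:E)%E.
  by apply: integral_ge0 => w _; rewrite lee_fin.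
have uf : (\int[P]_w (f (triple 0 0 w))%:E)%E \is a fin_num.
  by rewrite ge0_fin_numE// (le_lt_trans fv)// ltry.
rewrite -(fineK uf) prodEFin prodr_const card_ord lee_fin.
by rewrite lerXn2r ?nnegrE ?fine_ge0// -lee_fin fineK.
Qed.

End model.

Section integrability.
Context d (T : measurableType d) (R : realType) (P : probability T R).
Local Open Scope ereal_scope.

(** The integral is the difference of those of the positive and negative parts, and a difference
    with an infinite term is never finite. Thus the finite drift yields integrability. *)
Lemma integrable_fin_integral (f : T -> R) (m : R) : measurable_fun setT f ->
  \int[P]_w (f w)%:E = m%:E -> P.-integrable setT (EFin \o f).
Proof.
move=> mf; have mEf : measurable_fun setT (EFin \o f) by exact/measurable_EFinP.
rewrite [X in X = _]integralE => im.
set Ip := \int[P]_(w in setT) (fun w => (f w)%:E)^\+ w in im.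
set In := \int[P]_(w in setT) (fun w => (f w)%:E)^\- w in im.
have Ip0 : 0 <= Ip by apply: integral_ge0.
have In0 : 0 <= In by apply: integral_ge0.
have [Ipf Inf] : Ip < +oo /\ In < +oo.
  by move: Ip In Ip0 In0 im => [a| |] [b| |]//= _ _ _; rewrite !ltry.
apply/integrableP; split => //.
rewrite -[X in \int[P]_(x in _) X x]/(fun x => `|(EFin \o f) x|).
under eq_integral do rewrite -/((abse \o (EFin \o f)) _) fune_abse.
rewrite ge0_integralD//; last 2 first.
- exact: measurable_funepos.
- exact: measurable_funeneg.
by rewrite lte_add_pinfty.
Qed.

End integrability.

Section drift_estimates.
Context d (T : measurableType d) (R : realType) (P : probability T R).
Context (A : nat -> nat -> {RV P >-> R}) (B Tau : nat -> {RV P >-> R}).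
Context (alpha c0 mu : R).
Hypotheses (M : queue_model A B Tau) (c0_gt0 : 0 < c0)
  (iA : P.-integrable setT
    (EFin \o (fun w => `|A 0 0 w| * expR (c0 * A 0 0 w `^ alpha))))
  (iB : P.-integrable setT (EFin \o (fun w => `|B 0 w|)))
  (drift : (\int[P]_w (A 0 0 w * B 0 w - Tau 0 w)%:E = (- mu)%:E)%E).

Let mAB : measurable_fun setT (fun w => A 0 0 w * B 0 w).
Proof. exact: measurable_funM. Qed.

Let mK : measurable_fun setT (fun w => c0 * A 0 0 w `^ alpha).
Proof.
apply: measurable_funM => //.
by apply: (measurableT_comp (measurable_powR _)).
Qed.

(** The cap depends on [A] alone, so by independence the integral of the absolute value factors into
    a weighted moment of [A] and the mean of [B]. *)
Lemma integrable_ABexp : P.-integrable setT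
  (EFin \o (fun w => A 0 0 w * B 0 w * expR (c0 * A 0 0 w `^ alpha))).
Proof.
have mf (f : R -> R) (S : set _) (k : nat * nat + (nat + nat)) :
    measurable_fun setT f -> S k ->
    measurable_fun setT (f \o primitives A B Tau k :
      g_sigma_algebraType (gen_on (primitives A B Tau) S) -> R).
  by move=> mf Sk; apply: measurableT_comp => //; exact: measurable_gen_on.
pose fA (a : R) := `|a| * expR (c0 * a `^ alpha).
have mfA : measurable_fun setT fA.
  apply: measurable_funM; first exact: normr_measurable.
  apply: measurableT_comp => //; apply: measurable_funM => //.
have mnorm : measurable_fun setT (fun b : R => `|b|) by exact: normr_measurable.
pose X : {RV P >-> R} := HB.pack (fA \o A 0 0)
  (isMeasurableFun.Build _ _ _ _ _ (measurableT_comp mfA (measurable_funP (A 0 0)))).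
pose Y : {RV P >-> R} := HB.pack ((fun b : R => `|b|) \o B 0)
  (isMeasurableFun.Build _ _ _ _ _ (measurableT_comp mnorm (measurable_funP (B 0)))).
have XY : indep_mfun P X Y.
  apply: (indep_mfun_gen_on (S1 := [set inl (0, 0)%N]) (S2 := [set inr (inl 0%N)])
    (Z_indep M)).
  - by rewrite -subset0 => k /= [-> ].
  - exact: (mf fA _ (inl (0, 0)%N)).
  - exact: (mf _ _ (inr (inl 0%N))).
apply/integrableP; split.
  by apply/measurable_EFinP; apply: measurable_funM => //; exact: measurableT_comp.
rewrite (eq_integral (fun w => (X w * Y w)%:E)); last first.
  move=> w _ /=; rewrite /fA !normrM (ger0_norm (expR_ge0 _)).
  by congr EFin; ring.
rewrite ge0_integralM_indep//; last 2 first.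
- by move=> w /=; rewrite /fA mulr_ge0 ?expR_ge0.
- by move=> w /=.
have fin (f : T -> R) : P.-integrable setT (EFin \o f) ->
    (\int[P]_w (f w)%:E)%E \is a fin_num.
  by move=> i_f; exact: (integrable_fin_num measurableT i_f).
by rewrite -ge0_fin_numE ?fin_numM ?mule_ge0//;
  do ?[apply: fin|apply: integral_ge0 => w _;
       rewrite lee_fin/= /fA ?mulr_ge0 ?expR_ge0].
Qed.

Lemma integrable_AB : P.-integrable setT (EFin \o (fun w => A 0 0 w * B 0 w)).
Proof.
apply: le_integrable integrable_ABexp => //; first exact/measurable_EFinP.
move=> w _ /=; rewrite lee_fin [leRHS]normrM ler_peMr// ger0_norm ?expR_ge0//.
by rewrite -expR0 ler_expR mulr_ge0 ?powR_ge0// ltW.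
Qed.

(** [Tau] is the difference of [A * B] and [A * B - Tau], the latter integrable because its mean is
    finite. *)
Lemma integrable_Tau : P.-integrable setT (EFin \o Tau 0).
Proof.
have mABT : measurable_fun setT (fun w => A 0 0 w * B 0 w - Tau 0 w).
  exact: measurable_funB.
have iABT := integrable_fin_integral mABT drift.
have := integrableB measurableT integrable_AB iABT.
by apply: eq_integrable => // w _ /=; rewrite -EFinB opprB addrC subrK.
Qed.

Definition upper_exp th (z : R * (R * R)) : R :=
  expR (Num.min (th * (z.1 * z.2.1)) (c0 * z.1 `^ alpha) - th * z.2.2).

Lemma upper_exp_le mu' : mu' < mu -> exists2 th0, 0 < th0 &
  forall th, 0 < th <= th0 ->
  (\int[P]_w (upper_exp th (triple A B Tau 0 0 w))%:E <= (1 - th * mu')%:E)%E.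
Proof.
move=> mumu'.
have pos : {ae P, forall w, [/\ 0 <= A 0 0 w * B 0 w,
    0 < c0 * A 0 0 w `^ alpha & 0 <= Tau 0 w]}.
  apply: filterS (ae_pos M) => w /(_ 0%N 0%N)[A0 B0 T0].
  by rewrite mulr_gt0 ?powR_gt0// mulr_ge0 ?(ltW A0) ?(ltW B0) ?(ltW T0).
have mm' : - mu < - mu' by rewrite ltrN2.
have [th0 th00 H] := chernoff_small mAB mK (measurable_funP (Tau 0)) pos
  integrable_ABexp integrable_Tau drift mm'.
by exists th0 => // th /H; rewrite mulrN.
Qed.

(** For downward deviations the roles are exchanged: [Tau], known only to be integrable, is the term
    to cap, and the constant cap 1 suffices. *)
Definition lower_exp th (z : R * (R * R)) : R :=
  expR (Num.min (th * z.2.2) 1 - th * (z.1 * z.2.1)).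

Lemma lower_exp_le mu' : mu < mu' -> exists2 th0, 0 < th0 &
  forall th, 0 < th <= th0 ->
  (\int[P]_w (lower_exp th (triple A B Tau 0 0 w))%:E <= (1 + th * mu')%:E)%E.
Proof.
move=> mumu'.
have pos : {ae P, forall w, [/\ 0 <= Tau 0 w, 0 < (1 : R) &
    0 <= A 0 0 w * B 0 w]}.
  apply: filterS (ae_pos M) => w /(_ 0%N 0%N)[A0 B0 T0].
  by rewrite mulr_ge0 ?(ltW A0) ?(ltW B0) ?(ltW T0).
have iT : P.-integrable setT (EFin \o (fun w => Tau 0 w * expR 1)).
  have := integrableZl measurableT (expR 1) integrable_Tau.
  by apply: eq_integrable => // w _ /=; rewrite -EFinM mulrC.
have drift' : (\int[P]_w (Tau 0 w - A 0 0 w * B 0 w)%:E = mu%:E)%E.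
  rewrite -[mu]opprK EFinN -drift -integralN//; last first.
    apply: (integrable_add_def measurableT).
    by apply: integrable_fin_integral drift; exact: measurable_funB.
  by apply: eq_integral => w _; rewrite -EFinN opprB.
by have := chernoff_small (measurable_funP (Tau 0)) (measurable_cst _) mAB pos
  iT integrable_AB drift' mumu'.
Qed.

Lemma measurable_upper_exp th : measurable_fun setT (upper_exp th).
Proof.
apply: measurableT_comp => //; apply: measurable_funB.
  apply: measurable_minr.
    apply: measurable_funM => //; apply: measurable_funM => //.
    by apply: measurableT_comp => //.
  apply: measurable_funM => //.
  by apply: (measurableT_comp (measurable_powR _)).
by apply: measurable_funM => //; apply: measurableT_comp.
Qed.

Lemma measurable_lower_exp th : measurable_fun setT (lower_exp th).
Proof.
apply: measurableT_comp => //; apply: measurable_funB.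
  apply: measurable_minr => //.
  by apply: measurable_funM => //; apply: measurableT_comp.
apply: measurable_funM => //; apply: measurable_funM => //.
by apply: measurableT_comp.
Qed.

End drift_estimates.

(** * Sums of tails along the growing levels *)

Section tail_sums.
Context {R : realType}.
Context (beta : R) (Q : R -> R) (b c : nat -> R).
Hypotheses (beta1 : 1 < beta)
  (Qni : forall y z, 0 < y -> y <= z -> Q z <= Q y)
  (Q0 : forall y, 0 < y -> 0 < Q y)
  (RV : forall l, 0 < l -> Q (l * y) / Q y @[y --> +oo] --> l `^ (- beta))
  (c_pinfty : c N @[N --> \oo] --> +oo)
  (v_pinfty : c N / b N @[N --> \oo] --> +oo)
  (cQ : c N * Q (c N / b N) @[N --> \oo] --> (1 : R)).

Lemma cvg_scaled_tail a : 0 < a ->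
  c N * Q (a * (c N / b N)) @[N --> \oo] --> a `^ (- beta).
Proof.
move=> a0.
have h : Q (a * (c N / b N)) / Q (c N / b N) @[N --> \oo] --> a `^ (- beta).
  exact: (cvg_comp _ _ v_pinfty (RV a0)).
rewrite -[X in _ --> X]mul1r.
apply: (cvg_trans (G := (fun N => c N * Q (c N / b N) *
    (Q (a * (c N / b N)) / Q (c N / b N))) @ \oo)); last exact: cvgM cQ h.
apply: near_eq_cvg; near=> N.
have v0 : 0 < c N / b N by near: N; move/cvgryPgt : v_pinfty; exact.
by rewrite -mulrA; congr (_ * _); rewrite mulrC divfK// gt_eqF// Q0.
Unshelve. all: end_near.
Qed.

Let Qpotter := @potter _ Q 1 beta (fun y z y1 => Qni (lt_le_trans ltr01 y1))
  (fun y y1 => Q0 (lt_le_trans ltr01 y1)) (fun l l1 => RV (lt_trans ltr01 l1)).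

Lemma powR_cst_cvg (p : R) :
  (1 + e) `^ p @[e --> (0 : R)^'+] --> (1 : R).
Proof.
have c1 : {for 1, continuous (fun k : R => k `^ p)}.
  apply: differentiable_continuous; apply/derivable1_diffP.
  by apply: derivable_powR; rewrite in_itv/= andbT.
have c2 : 1 + e @[e --> (0 : R)^'+] --> (1 : R).
  rewrite -[X in _ --> X]addr0; apply: cvgD; first exact: cvg_cst.
  by apply: cvg_at_right_filter; exact: cvg_id.
have := cvg_comp _ _ c2 (c1 : (fun k : R => k `^ p) @ (1 : R) --> (1 : R) `^ p).
by rewrite powR1.
Qed.

Lemma cvg_at_right_id : e @[e --> (0 : R)^'+] --> (0 : R).
Proof. by apply: cvg_at_right_filter; exact: cvg_id. Qed.

(** Potter's bound replaces each term by [Q (a * (c N / b N))] times a power close to [- s * beta];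
    the powers sum to about [c N / (rho * (p - 1))], and [c N * Q (a * (c N / b N))] has limit
    [a ^ (- beta)]. The parameter [e] is small enough for the losses to fit below [K]. *)
Lemma tail_sum_le a rho s K : 0 < a -> 0 < rho -> 0 < s -> 1 < s * beta ->
  a `^ (- beta) / (rho * (s * beta - 1)) < K ->
  \forall N \near \oo, forall n,
    \sum_(j < n) Q (a * (c N / b N) * (1 + rho / c N * j%:R) `^ s) <= K.
Proof.
move=> a0 rho0 s0 sb JK; have b1 := beta1.
have [e [e0 eb e1 eK]] : exists e : R, [/\ 0 < e, e <= beta, 1 < s * (beta - e) &
    (1 + e) `^ beta * a `^ (- beta) / (rho * (s * (beta - e) - 1)) < K].
  have lim : (1 + e) `^ beta * a `^ (- beta) / (rho * (s * (beta - e) - 1))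
      @[e --> (0 : R)^'+] --> 1 * a `^ (- beta) / (rho * (s * (beta - 0) - 1)).
    apply: cvgM.
      apply: cvgM; last exact: cvg_cst.
      exact: powR_cst_cvg.
    apply: cvgV; first by rewrite subr0 mulf_neq0 ?gt_eqF//; lra.
    apply: cvgMr; apply: cvgB; last exact: cvg_cst.
    by apply: cvgMr; apply: cvgB; [exact: cvg_cst|exact: cvg_at_right_id].
  have near_e : \forall e \near (0 : R)^'+, [/\ 0 < e, e <= beta, 1 < s * (beta - e) &
    (1 + e) `^ beta * a `^ (- beta) / (rho * (s * (beta - e) - 1)) < K].
    near=> e; split; near: e.
    - exact: nbhs_right_gt.
    - by apply: nbhs_right_le; lra.
    - have l2 : s * (beta - e) @[e --> (0 : R)^'+] --> s * (beta - 0).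
        by apply: cvgMr; apply: cvgB; [exact: cvg_cst|exact: cvg_at_right_id].
      by have /cvgr_gt := l2; apply; rewrite subr0.
    - by have /cvgr_lt := lim; apply; rewrite subr0 mul1r.
  by have [e] := @filter_ex _ _ _ _ near_e; exists e.
have l1 : 1 < 1 + e by lra.
have [y1 y10 pot] := Qpotter l1 e0 eb.
set p := s * (beta - e) in e1 eK.
have p0 : 0 < p - 1 by lra.
have limK : (1 + e) `^ beta * (c N * Q (a * (c N / b N))) *
    ((c N)^-1 + (rho * (p - 1))^-1) @[N --> \oo] -->
    (1 + e) `^ beta * a `^ (- beta) * (0 + (rho * (p - 1))^-1).
  apply: cvgM; first by apply: cvgMr; exact: cvg_scaled_tail.
  apply: cvgD; last exact: cvg_cst.
  by apply/gtr0_cvgV0 => //; near=> N; near: N; move/cvgryPgt : c_pinfty; exact.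
near=> N => n.
have cN0 : 0 < c N by near: N; move/cvgryPgt : c_pinfty; exact.
have v0 : 0 < c N / b N by near: N; move/cvgryPgt : v_pinfty; exact.
have vy : y1 / a <= c N / b N by near: N; move/cvgryPge : v_pinfty; exact.
have rc0 : 0 < rho / c N by rewrite divr_gt0.
have Ny : y1 <= a * (c N / b N) by rewrite mulrC -ler_pdivrMr.
have KN : (1 + e) `^ beta * (c N * Q (a * (c N / b N))) *
    ((c N)^-1 + (rho * (p - 1))^-1) <= K.
  by near: N; have /cvgr_le := limK; apply; rewrite add0r.
apply: le_trans KN.
have lb : (1 + e) `^ (beta - e) <= (1 + e) `^ beta.
  by apply: ler_powR; lra.
apply: (@le_trans _ _ (\sum_(j < n) (1 + e) `^ beta * Q (a * (c N / b N)) *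
    (1 + rho / c N * j%:R) `^ (- p))).
  apply: ler_sum => j _.
  have w1 : 1 <= 1 + rho / c N * j%:R by rewrite lerDl mulr_ge0// ltW.
  have ws1 : 1 <= (1 + rho / c N * j%:R) `^ s.
    by rewrite -[leLHS](powRr0 (1 + rho / c N * j%:R)); apply: ler_powR => //; exact: ltW.
  have /andP[_] := pot _ _ Ny ws1; rewrite mulrC => /le_trans; apply.
  rewrite -powRrM mulrN -/p mulrAC.
  rewrite ler_wpM2r ?powR_ge0// ler_wpM2r// ltW// Q0//.
  exact: lt_le_trans Ny.
rewrite -mulr_sumr.
have := powR_sum_le_bound n ltr01 rc0 e1; rewrite !powR1 => hs.
have {}hs : \sum_(j < n) (1 + rho / c N * j%:R) `^ (- p) <=
    c N * ((c N)^-1 + (rho * (p - 1))^-1).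
  rewrite -(ler_pM2l rc0); apply: (le_trans hs).
  by rewrite le_eqVlt; apply/orP; left; apply/eqP; field; rewrite !gt_eqF.
have QN0 : 0 < Q (a * (c N / b N)) by apply: Q0; exact: lt_le_trans Ny.
apply: le_trans (ler_wpM2l _ hs) _.
  by rewrite mulr_ge0 ?powR_ge0// ltW.
by rewrite le_eqVlt; apply/orP; left; apply/eqP; ring.
Unshelve. all: end_near.
Qed.

(** The same comparison with Potter's lower bound. A finite sum misses the tail of the integral, so
    [n] depends on [N]. *)
Lemma tail_sum_ge a rho K : 0 < a -> 0 < rho ->
  K < a `^ (- beta) / (rho * (beta - 1)) ->
  \forall N \near \oo, exists n,
    K <= \sum_(j < n) Q (a * (c N / b N) * (1 + rho / c N * j%:R)).
Proof.
move=> a0 rho0 JK; have b1 := beta1.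
have [e [e0 eb e1 eK]] : exists e : R, [/\ 0 < e, e <= beta, e < 1 &
    K < (1 + e) `^ (- (2 * beta)) * a `^ (- beta) * (1 - e) / (rho * (beta + e - 1))].
  have lim : (1 + e) `^ (- (2 * beta)) * a `^ (- beta) * (1 - e) / (rho * (beta + e - 1))
      @[e --> (0 : R)^'+] --> 1 * a `^ (- beta) * (1 - 0) / (rho * (beta + 0 - 1)).
    apply: cvgM.
      apply: cvgM; last by apply: cvgB; [exact: cvg_cst|exact: cvg_at_right_id].
      apply: cvgM; last exact: cvg_cst.
      exact: powR_cst_cvg.
    apply: cvgV; first by rewrite addr0 mulf_neq0 ?gt_eqF//; lra.
    apply: cvgMr; apply: cvgB; last exact: cvg_cst.
    by apply: cvgD; [exact: cvg_cst|exact: cvg_at_right_id].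
  have near_e : \forall e \near (0 : R)^'+, [/\ 0 < e, e <= beta, e < 1 &
    K < (1 + e) `^ (- (2 * beta)) * a `^ (- beta) * (1 - e) / (rho * (beta + e - 1))].
    near=> e; split; near: e.
    - exact: nbhs_right_gt.
    - by apply: nbhs_right_le; lra.
    - by apply: nbhs_right_lt; lra.
    - by have /cvgr_gt := lim; apply; rewrite subr0 addr0 mulr1 mul1r.
  by have [e] := @filter_ex _ _ _ _ near_e; exists e.
have l1 : 1 < 1 + e by lra.
have [y1 y10 pot] := Qpotter l1 e0 eb.
set p := beta + e in eK.
have p1 : 1 < p by rewrite /p; lra.
have p0 : 0 < p - 1 by lra.
have limK : (1 + e) `^ (- (2 * beta)) * (c N * Q (a * (c N / b N))) * (1 - e) /
    (rho * (p - 1)) @[N --> \oo] -->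
    (1 + e) `^ (- (2 * beta)) * a `^ (- beta) * (1 - e) / (rho * (p - 1)).
  apply: cvgMl; apply: cvgMl; apply: cvgMr; exact: cvg_scaled_tail.
near=> N.
have cN0 : 0 < c N by near: N; move/cvgryPgt : c_pinfty; exact.
have v0 : 0 < c N / b N by near: N; move/cvgryPgt : v_pinfty; exact.
have vy : y1 / a <= c N / b N by near: N; move/cvgryPge : v_pinfty; exact.
have rc0 : 0 < rho / c N by rewrite divr_gt0.
have Ny : y1 <= a * (c N / b N) by rewrite mulrC -ler_pdivrMr.
have QN0 : 0 < Q (a * (c N / b N)) by apply: Q0; exact: lt_le_trans Ny.
have KN : K <= (1 + e) `^ (- (2 * beta)) * (c N * Q (a * (c N / b N))) * (1 - e) /
    (rho * (p - 1)).
  by near: N; have /cvgr_ge := limK; apply.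
(* Far enough that the missing tail is at most a fraction [e] of the integral. *)
have [n hn] : exists n, (1 + rho / c N * n%:R) `^ (1 - p) <= e.
  have lim : (1 + rho / c N * n%:R) `^ (1 - p) @[n --> \oo] --> 0.
    have -> : 1 - p = - (p - 1) by ring.
    apply: (@cvg_comp _ _ _ (fun n => 1 + rho / c N * n%:R)
      (fun y => y `^ (- (p - 1))) _ (pinfty_nbhs R)); last exact: cvgr_powRN_pinfty.
    apply/cvgryPge => y; near=> n.
    have : y / (rho / c N) <= n%:R by near: n; exact: nbhs_infty_ger.
    by rewrite ler_pdivrMr// mulrC; lra.
  have ev : \forall n \near \oo, (1 + rho / c N * n%:R) `^ (1 - p) <= e.
    by have /cvgr_le := lim; apply.
  by have [n] := @filter_ex _ _ _ _ ev; exists n.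
exists n; apply: (le_trans KN).
have lb : (1 + e) `^ (- (2 * beta)) <= (1 + e) `^ (- p).
  by apply: ler_powR; rewrite /p; lra.
apply: (@le_trans _ _ (\sum_(j < n) (1 + e) `^ (- (2 * beta)) * Q (a * (c N / b N)) *
    (1 + rho / c N * j%:R) `^ (- p))); last first.
  apply: ler_sum => j _.
  have w1 : 1 <= 1 + rho / c N * j%:R by rewrite lerDl mulr_ge0// ltW.
  have /andP[+ _] := pot _ _ Ny w1; rewrite (mulrC (1 + _)); apply: le_trans.
  by rewrite mulrAC ler_pM2r// -/p ler_wpM2r// powR_ge0.
rewrite -mulr_sumr.
have := powR_sum_ge n ltr01 rc0 p1; rewrite !powR1 => hs.
have {}hs : c N * ((1 - e) / (rho * (p - 1))) <=
    \sum_(j < n) (1 + rho / c N * j%:R) `^ (- p).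
  rewrite -(ler_pM2l rc0); apply: le_trans hs.
  have -> : rho / c N * (c N * ((1 - e) / (rho * (p - 1)))) = (1 - e) / (p - 1).
    by field; rewrite !gt_eqF.
  by rewrite ler_pM2r ?invr_gt0// lerD2l lerN2.
apply: le_trans (ler_wpM2l _ hs); last first.
  by rewrite mulr_ge0 ?powR_ge0// ltW.
by rewrite le_eqVlt; apply/orP; left; apply/eqP; field; rewrite !gt_eqF.
Unshelve. all: end_near.
Qed.

(** Write [l = ln N] and [r] for the base of the power [kappa]. Of the exponent,
    [(1 + delta / 2) * l] beats the factor [N] with surplus [delta / 2 * l], and the remaining
    [delta / 2 * l * r ^ kappa] gives [r ^ (- 2)], whose sum is at most [1 + c N / rho]. Half of the
    surplus absorbs this, since [c N] is at most a power of [l]. *)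
Lemma exp_sum_small (C p delta kappa rho e : R) :
  0 < C -> 0 < p -> 0 < delta -> 0 < kappa -> 0 < rho -> 0 < e ->
  (\forall N \near \oo, c N <= C * ln (N%:R : R) `^ p) ->
  ln (N%:R : R) @[N --> \oo] --> +oo ->
  \forall N \near \oo, forall n, N%:R * \sum_(k < n)
    expR (- ((1 + delta) * ln (N%:R : R) * (1 + rho / c N * k%:R) `^ kappa)) <= e.
Proof.
move=> C0 p0 d0 k0 rho0 e0 cC lnoo.
pose C1 := 1 + C * (p / (delta / 4)) `^ p / rho.
have C10 : 0 < C1.
  by rewrite ltr_pwDl// mulr_ge0 ?invr_ge0 ?mulr_ge0 ?powR_ge0// ltW.
near=> N => n.
have N0 : 0 < N%:R :> R by rewrite ltr0n; near: N; exists 1%N.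
have cN0 : 0 < c N by near: N; move/cvgryPgt : c_pinfty; exact.
have rc0 : 0 < rho / c N by rewrite divr_gt0.
have l0 : 0 < ln (N%:R : R) by near: N; move/cvgryPgt : lnoo; exact.
have lk : 2 * (2 / kappa / delta) <= ln (N%:R : R).
  by near: N; move/cvgryPge : lnoo; exact.
have le : 4 / delta * ln (C1 / e) <= ln (N%:R : R).
  by near: N; move/cvgryPge : lnoo; exact.
have cl : c N <= C * ln (N%:R : R) `^ p by near: N.
have eN : N%:R = expR (ln (N%:R : R)) by rewrite lnK.
rewrite [X in X * _ <= _]eN; move: l0 lk le cl; set l := ln (N%:R : R) => l0 lk le cl.
have term k : expR (- ((1 + delta) * l * (1 + rho / c N * k%:R) `^ kappa)) <=
    expR (- ((1 + delta / 2) * l)) * (1 + rho / c N * k%:R) `^ (- 2).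
  set r := 1 + rho / c N * k%:R.
  have r1 : 1 <= r by rewrite lerDl mulr_ge0// ltW.
  have rk1 : 1 <= r `^ kappa.
    by rewrite -[leLHS](powRr0 r); apply: ler_powR => //; exact: ltW.
  have h := @powR_le_expR R (r `^ kappa) (2 / kappa) (delta / 2 * l) (powR_ge0 _ _)
    (divr_gt0 (ltr0n _ 2) k0) (mulr_gt0 (divr_gt0 d0 (ltr0n _ 2)) l0).
  have h2 : (2 / kappa / (delta / 2 * l)) `^ (2 / kappa) <= 1.
    apply: (@le_trans _ _ ((1 : R) `^ (2 / kappa))); last by rewrite powR1.
    have k2 : 0 <= 2 / kappa by rewrite divr_ge0// ltW.
    have dl : 0 < delta / 2 * l by rewrite mulr_gt0// divr_gt0.
    apply: ge0_ler_powR; rewrite ?nnegrE ?ler01//.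
      by rewrite divr_ge0// ltW.
    rewrite ler_pdivrMr// mul1r.
    move: lk; rewrite -(ler_pM2l (_ : 0 < delta / 2)) ?divr_gt0//.
    suff -> : delta / 2 * (2 * (2 / kappa / delta)) = 2 / kappa by [].
    by field; rewrite !gt_eqF.
  have {h h2} h : r `^ 2 <= expR (delta / 2 * l * r `^ kappa).
    have -> : r `^ 2 = (r `^ kappa) `^ (2 / kappa).
      by rewrite -powRrM mulrC divfK// gt_eqF.
    by apply: (le_trans h); rewrite ler_piMl ?expR_ge0.
  apply: (@le_trans _ _ (expR (- ((1 + delta / 2) * l)) *
      expR (- (delta / 2 * l * r `^ kappa)))).
    have hp : 0 <= (1 + delta / 2) * l * (r `^ kappa - 1).
      by rewrite mulr_ge0 ?subr_ge0// mulr_ge0 ?addr_ge0 ?divr_ge0// ltW.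
    rewrite -expRD ler_expR; lra.
  rewrite ler_pM2l ?expR_gt0// expRN powRN lef_pV2 ?posrE ?expR_gt0//.
  by rewrite powR_gt0// (lt_le_trans ltr01 r1).
apply: (@le_trans _ _ (expR l * \sum_(k < n) expR (- ((1 + delta / 2) * l)) *
    (1 + rho / c N * k%:R) `^ (- 2))).
  by rewrite ler_pM2l ?expR_gt0//; apply: ler_sum => k _; exact: term.
rewrite -mulr_sumr mulrA -expRD.
have := powR_sum_le_bound n ltr01 rc0 (ltr1n R 2); rewrite !powR1 => hs.
have {}hs : \sum_(k < n) (1 + rho / c N * k%:R) `^ (- 2) <= 1 + C * l `^ p / rho.
  apply: (@le_trans _ _ (1 + c N / rho)); last by rewrite lerD2l ler_pM2r ?invr_gt0.
  rewrite -(ler_pM2l rc0); apply: (le_trans hs).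
  by rewrite le_eqVlt; apply/orP; left; apply/eqP; field; rewrite !gt_eqF.
have lp := @powR_le_expR R l p (delta / 4) (ltW l0) p0 (divr_gt0 d0 (ltr0n _ 4)).
have {}hs : \sum_(k < n) (1 + rho / c N * k%:R) `^ (- 2) <= C1 * expR (delta / 4 * l).
  apply: (le_trans hs); rewrite /C1 mulrDl lerD//.
    by rewrite mul1r -expR0 ler_expR mulr_ge0// ltW// divr_gt0.
  rewrite [leRHS]mulrAC ler_pM2r ?invr_gt0//.
  by rewrite -[leRHS]mulrA ler_pM2l.
apply: le_trans (ler_wpM2l (expR_ge0 _) hs) _.
rewrite mulrCA -expRD -ler_pdivlMl//.
have -> : l - (1 + delta / 2) * l + delta / 4 * l = - (delta / 4 * l) by field.
have -> : C1^-1 * e = (C1 / e)^-1 by rewrite invf_div mulrC.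
rewrite -[leRHS]lnK ?posrE ?invr_gt0 ?divr_gt0// ler_expR lnV ?posrE ?divr_gt0// lerN2.
rewrite -(ler_pM2l (_ : 0 < 4 / delta)) ?divr_gt0//; apply: (le_trans le).
by rewrite le_eqVlt; apply/orP; left; apply/eqP; field; rewrite gt_eqF.
Unshelve. all: end_near.
Qed.

End tail_sums.

Section integrable_tail_small.
Context d (T : measurableType d) (R : realType) (P : probability T R).

(** Plain Markov only bounds [u * P (X > u)]. Applied to [X] on the event [n < X], whose
    contribution to the integral vanishes by dominated convergence, it makes the product small. *)
Lemma mul_tail_small (X : {RV P >-> R}) (e : R) :
  P.-integrable setT (EFin \o X) -> 0 < e ->
  exists2 u0, 0 < u0 & forall u, u0 <= u -> u * pr P [set w | u < X w] <= e.
Proof.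
move=> iX e0.
pose g n w : \bar R := (`|X w| * \1_[set w | n%:R < X w] w)%:E.
have mE (a : R) : measurable [set w | a < X w] by exact: measurable_gt.
have mg n : measurable_fun setT (g n).
  apply/measurable_EFinP; apply: measurable_funM; first exact: measurableT_comp.
  exact: measurable_indic.
have ig : P.-integrable setT (fun w => `|X w|%:E) by exact: (integrable_abse iX).
have g0 : {ae P, forall w, setT w -> g n w @[n --> \oo] --> (0 : \bar R)}.
  apply: aeW => w _; apply: cvg_near_cst; near=> n.
  rewrite /g indicE memNset ?mulr0//= => /lt_geF.
  have : X w <= n%:R by near: n; exact: nbhs_infty_ger.
  by move=> ->.
have dg : {ae P, forall w n, setT w -> (`|g n w| <= `|X w|%:E)%E}.
  apply: aeW => w n _; rewrite /g /= lee_fin normrM normr_id ler_piMr//.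
  by rewrite indicE; case: (_ \in _); rewrite ?normr1 ?normr0.
have [_ _ dct] := @dominated_convergence _ _ _ P setT measurableT _ _ _
  mg (measurable_cst _) g0 ig dg.
rewrite integral0 in dct.
have ev : \forall n \near \oo, (\int[P]_w (g n w) < e%:E)%E.
  move/fine_cvgP : dct => [fin /cvgr_lt/(_ _ e0) lt].
  near=> n; rewrite -[X in (X < _)%E]fineK ?lte_fin; near: n => //.
have [n hn] := @filter_ex _ _ _ _ ev.
exists n.+1%:R => // u nu.
have u0 : 0 < u by apply: lt_le_trans nu; rewrite ltr0n.
rewrite -lee_fin EFinM -prE//; apply: le_trans (ltW hn).
have <- : (\int[P]_w (u%:E * (\1_[set w | (u < X w)%R] w)%:E) =
    u%:E * P [set w | (u < X w)%R])%E.
  rewrite ge0_integralZl//.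
  - by rewrite integral_indic// setIT.
  - by apply/measurable_EFinP; exact: measurable_indic.
  - by rewrite lee_fin ltW.
apply: ge0_le_integral => //.
- by move=> w _; rewrite -EFinM lee_fin mulr_ge0// ltW.
- by apply: measurable_funeM; apply/measurable_EFinP; exact: measurable_indic.
- move=> w _; rewrite -EFinM /g lee_fin !indicE.
  have [wE|_] := boolP (w \in [set w | u < X w]); last by rewrite mulr0 mulr_ge0.
  move: wE; rewrite inE/= => uX.
  rewrite mem_set ?mulr1 /=; first by rewrite (le_trans (ltW uX))// ler_norm.
  by apply: le_lt_trans uX; apply: le_trans nu; rewrite ler_nat.
Unshelve. all: end_near.
Qed.

End integrable_tail_small.

(** * The walks *)

Section walk.
Context d (T : measurableType d) (R : realType) (P : probability T R).
Context (A : nat -> nat -> {RV P >-> R}) (B Tau : nat -> {RV P >-> R}).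

Definition walk i k w : R := \sum_(j < k) (A i j w * B j w - Tau j w).

Lemma measurable_walk_gen i k (S : set (nat * nat + (nat + nat))) :
  (forall j, (j < k)%N -> job i j `<=` S) ->
  measurable_fun setT
    (walk i k : g_sigma_algebraType (gen_on (primitives A B Tau) S) -> R).
Proof.
move=> jS; apply: measurable_sum => j.
have mZ x : S x -> measurable_fun setT (primitives A B Tau x :
    g_sigma_algebraType (gen_on (primitives A B Tau) S) -> R).
  exact: measurable_gen_on.
have jSj := jS j (ltn_ord j).
apply: measurable_funB.
  apply: measurable_funM.
    by apply: (mZ (inl (i, nat_of_ord j))); apply: jSj; left; left.
  by apply: (mZ (inr (inl (nat_of_ord j)))); apply: jSj; left; right.
by apply: (mZ (inr (inr (nat_of_ord j)))); apply: jSj; right.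
Qed.

Lemma measurable_walk i k : measurable_fun setT (walk i k).
Proof.
apply: (gen_on_mfun (S := setT)).
exact: measurable_walk_gen.
Qed.

Lemma measurable_walk_lt i k (a : R) : measurable [set w | walk i k w < a].
Proof.
have -> : [set w | walk i k w < a] = walk i k @^-1` `]-oo, a[.
  by apply/seteqP; split => w /=; rewrite in_itv.
by rewrite -[_ @^-1` _]setTI; exact: measurable_walk.
Qed.

Lemma measurable_walk_gt i k (a : R) : measurable [set w | a < walk i k w].
Proof.
have -> : [set w | a < walk i k w] = walk i k @^-1` `]a, +oo[.
  by apply/seteqP; split => w /=; rewrite in_itv/= andbT.
by rewrite -[_ @^-1` _]setTI; exact: measurable_walk.
Qed.

Context (alpha c0 mu : R).
Hypotheses (M : queue_model A B Tau) (c0_gt0 : 0 < c0)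
  (iA : P.-integrable setT
    (EFin \o (fun w => `|A 0 0 w| * expR (c0 * A 0 0 w `^ alpha))))
  (iB : P.-integrable setT (EFin \o (fun w => `|B 0 w|)))
  (drift : (\int[P]_w (A 0 0 w * B 0 w - Tau 0 w)%:E = (- mu)%:E)%E).

Lemma pr_Tau_gt j a : pr P [set w | a < Tau j w] = pr P [set w | a < Tau 0 w].
Proof.
rewrite /pr; congr fine.
have E k : [set w | a < Tau k w] = Tau k @^-1` `]a, +oo[.
  by apply/seteqP; split => w /=; rewrite in_itv/= andbT.
by rewrite !E; exact: (Tau_law M).
Qed.

Lemma pr_bigcup_Tau_le n a :
  pr P (\big[setU/set0]_(j < n) [set w | a < Tau j w]) <=
  n%:R * pr P [set w | a < Tau 0 w].
Proof.
apply: le_trans (pr_bigsetU_le P n (F := fun j => [set w | a < Tau j w]) _) _.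
  by move=> j; exact: measurable_gt.
under eq_bigr do rewrite pr_Tau_gt.
by rewrite sumr_const card_ord mulr_natl.
Qed.

(** A weak law uniform in the number [j] of steps, with the slack [eta * c] covering small [j].
    Chernoff is used with [th = lam / (j + c)]. The cap 1 is inactive unless some [Tau l] exceeds
    [th^-1]; as [j <= lam * th^-1], the union of these events is small by integrability of [Tau]. *)
Lemma walk_lower_tail (eps eta tol : R) : 0 < mu -> 0 < eps -> 0 < eta ->
  0 < tol -> exists2 c1, 0 < c1 & forall c i j, c1 <= c ->
  pr P [set w | walk i j w < - (mu * (1 + eps) * j%:R + eta * c)] <= tol.
Proof.
move=> mu0 eps0 eta0 tol0.
have mumu : mu < mu * (1 + eps / 2).
  by rewrite ltr_pMr// ltrDl divr_gt0.
have [th0 th00 Hth] := lower_exp_le M c0_gt0 iA iB drift mumu.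
(* The deviation left after the drift is at least [eta' * (j + c)], so [th] times it is at least
   [lam * eta'], whatever [j] is. *)
pose eta' := Num.min (mu * (eps / 2)) eta.
have eta'0 : 0 < eta' by rewrite lt_min eta0 mulr_gt0// divr_gt0.
(* Makes [expR (- (lam * eta'))] at most [tol / 2]. *)
pose lam := 1 + `|ln (tol / 2)| / eta'.
have lam0 : 0 < lam by rewrite ltr_pwDl// divr_ge0// ltW.
have tol2 : 0 < tol / (2 * lam) by rewrite divr_gt0// mulr_gt0.
have [u0 u00 Hu] := mul_tail_small (integrable_Tau M c0_gt0 iA iB drift) tol2.
(* The first bound ensures [th <= th0], the second [u0 <= th^-1]. *)
exists (Num.max (lam / th0) (lam * u0)).
  by rewrite lt_max divr_gt0.
move=> c i j; rewrite ge_max => /andP[cth cu].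
have c0' : 0 < c by apply: lt_le_trans cth; rewrite divr_gt0.
have jc0 : 0 < j%:R + c by rewrite ltr_wpDl.
pose th := lam / (j%:R + c).
have thp : 0 < th by rewrite divr_gt0.
have thV : th^-1 = (j%:R + c) / lam by rewrite invf_div.
have th_le : th <= th0.
  rewrite ler_pdivrMr// mulrC -ler_pdivrMr//; apply: le_trans cth _.
  by rewrite lerDr.
have uV : u0 <= th^-1.
  by rewrite thV ler_pdivlMr// mulrC; apply: (le_trans cu); rewrite lerDr.
set s := mu * (1 + eps) * j%:R + eta * c.
pose V := [set w | expR (th * s) < \prod_(l < j) lower_exp th (triple A B Tau i l w)].
have mV : measurable V.
  have -> : V = (fun w => \prod_(l < j) lower_exp th (triple A B Tau i l w))
      @^-1` `]expR (th * s), +oo[.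
    by apply/seteqP; split => w /=; rewrite in_itv/= andbT.
  rewrite -[_ @^-1` _]setTI; apply: measurable_prod_triple => //.
  exact: measurable_lower_exp.
have mE1 : measurable (\big[setU/set0]_(l < j) [set w | th^-1 < Tau l w]).
  by apply: bigsetU_measurable => l _; exact: measurable_gt.
apply: (@le_trans _ _
  (pr P ((\big[setU/set0]_(l < j) [set w | th^-1 < Tau l w]) `|` V))).
  apply: le_pr; [exact: measurable_walk_lt|exact: measurableU|].
  move=> w /= wlt.
  have [hT|hT] := pselect (exists2 l, (l < j)%N & th^-1 < Tau l w).
    left; rewrite -(bigcup_mkord j (fun l => [set w | th^-1 < Tau l w])).
    by case: hT => l lj hl; exists l.
  right; rewrite /V/= /lower_exp -expR_sum ltr_expR.
  rewrite (eq_bigr (fun l : 'I_j => - th * (A i l w * B l w - Tau l w))).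
    by rewrite -mulr_sumr -/(walk i j w) mulNr -mulrN ltr_pM2l// ltrNr.
  move=> l _ /=; rewrite min_l; first by ring.
  rewrite mulrC -ler_pdivlMr// mul1r leNgt; apply/negP => hl.
  by apply: hT; exists l.
apply: le_trans (prU_le _ _ _) _ => //.
have -> : tol = tol / 2 + tol / 2 by field.
apply: lerD.
  apply: (le_trans (pr_bigcup_Tau_le _ _)).
  apply: (@le_trans _ _ (lam * (th^-1 * pr P [set w | th^-1 < Tau 0 w]))).
    rewrite mulrA ler_wpM2r ?pr_ge0// thV mulrC divfK ?gt_eqF//.
    by rewrite lerDl ltW.
  apply: le_trans (ler_wpM2l (ltW lam0) (Hu _ uV)) _.
  by rewrite le_eqVlt; apply/orP; left; apply/eqP; field; rewrite gt_eqF.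
have := Hth th; rewrite thp th_le => /(_ isT) Hv.
have f0 (z : R * (R * R)) : 0 <= lower_exp th z by exact: expR_ge0.
apply: (le_trans (chernoff_prod M i j (th * s) (measurable_lower_exp th) f0 Hv)).
have v1 : 1 + th * (mu * (1 + eps / 2)) <= expR (th * (mu * (1 + eps / 2))).
  exact: expR_ge1Dx.
have v0 : 0 <= 1 + th * (mu * (1 + eps / 2)).
  by rewrite addr_ge0// mulr_ge0 ?(ltW thp)// mulr_ge0 ?(ltW mu0)// addr_ge0// divr_ge0// ltW.
have vj : (1 + th * (mu * (1 + eps / 2))) ^+ j <=
    expR (th * (mu * (1 + eps / 2)) * j%:R).
  by rewrite expRM_natr lerXn2r ?nnegrE ?expR_ge0.
apply: le_trans (ler_wpM2l (expR_ge0 _) vj) _.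
rewrite -expRD -[leRHS]lnK ?posrE ?divr_gt0// ler_expR.
have -> : - (th * s) + th * (mu * (1 + eps / 2)) * j%:R =
    - (th * (mu * (eps / 2) * j%:R + eta * c)) by rewrite /s; field.
apply: (@le_trans _ _ (- (lam * eta'))).
  rewrite lerN2 /th mulrAC ler_pdivlMr// -(mulrA lam) ler_pM2l// mulrDr lerD//.
    by rewrite ler_wpM2r// ge_min lexx.
  by rewrite ler_pM2r// ge_min lexx orbT.
rewrite /lam mulrDl mul1r divfK ?gt_eqF//.
have := ler_norm (- ln (tol / 2)); rewrite normrN; lra.
Qed.

End walk.

Lemma in_bigsetU (T : Type) (F : nat -> set T) n w :
  (\big[setU/set0]_(i < n) F i) w <-> exists2 i, (i < n)%N & F i w.
Proof.
rewrite -bigcup_mkord; split=> [[i /= ilt Fi]|[i ilt Fi]]; by exists i.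
Qed.

Lemma in_bigsetU2 (T : Type) (F : nat -> nat -> set T) N n w :
  (\big[setU/set0]_(i < N) \big[setU/set0]_(k < n) F i k) w <->
  exists i k, [/\ (i < N)%N, (k < n)%N & F i k w].
Proof.
rewrite (in_bigsetU (fun i => \big[setU/set0]_(k < n) F i k)).
split=> [[i iN /(in_bigsetU (F i))[k kn Fk]]|[i [k [iN kn Fk]]]].
  by exists i, k.
by exists i => //; apply/(in_bigsetU (F i)); exists k.
Qed.

Section double_union.
Context d (T : measurableType d) (R : realType) (P : probability T R).

Lemma measurable_bigsetU2 (F : nat -> nat -> set T) N n :
  (forall i k, measurable (F i k)) ->
  measurable (\big[setU/set0]_(i < N) \big[setU/set0]_(k < n) F i k).
Proof.
by move=> mF; apply: bigsetU_measurable => i _; apply: bigsetU_measurable.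
Qed.

Lemma pr_bigsetU2_le (F : nat -> nat -> set T) (a : nat -> R) N n :
  (forall i k, measurable (F i k)) -> (forall i k, pr P (F i k) <= a k) ->
  pr P (\big[setU/set0]_(i < N) \big[setU/set0]_(k < n) F i k) <=
  N%:R * \sum_(k < n) a k.
Proof.
move=> mF Fa.
apply: le_trans (pr_bigsetU_le P N (F := fun i => \big[setU/set0]_(k < n) F i k) _) _.
  by move=> i; apply: bigsetU_measurable.
apply: (@le_trans _ _ (\sum_(i < N) \sum_(k < n) a k)); last first.
  by rewrite sumr_const card_ord mulr_natl.
apply: ler_sum => i _; apply: le_trans (pr_bigsetU_le P n (mF i)) _.
by apply: ler_sum.
Qed.

End double_union.

Section steady_state.
Context d (T : measurableType d) (R : realType) (P : probability T R).
Context (A : nat -> nat -> {RV P >-> R}) (B Tau : nat -> {RV P >-> R}).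

(** The exceedance at a finite horizon, with walks of fewer than [n] steps. It increases with [n],
    and the union over [n] is the event of the steady state. *)
Definition exceed N n (X : R) : set T :=
  \big[setU/set0]_(i < N) \big[setU/set0]_(k < n) [set w | X < walk A B Tau i k w].

Lemma measurable_exceed N n X : measurable (exceed N n X).
Proof.
apply: (measurable_bigsetU2 (F := fun i k => [set w | X < walk A B Tau i k w])).
by move=> i k; exact: measurable_walk_gt.
Qed.

Lemma exceedP N n X w : exceed N n X w <->
  exists i k, [/\ (i < N)%N, (k < n)%N & X < walk A B Tau i k w].
Proof. exact: (in_bigsetU2 (fun i k => [set w | X < walk A B Tau i k w])). Qed.

Lemma exceed_homo N X : {homo (fun n => exceed N n X) : n m / (n <= m)%N >-> n `<=` m}.
Proof.
move=> n m nm w /exceedP[i [k [iN kn kw]]].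
by apply/exceedP; exists i, k; split => //; exact: leq_trans nm.
Qed.

Lemma max_steady_waiting_gtE N X :
  [set w | (X%:E < max_steady_waiting A B Tau N w)%E] =
  \bigcup_n exceed N n X.
Proof.
have maxE (f : nat -> \bar R) n : (X%:E < \big[maxe/-oo%E]_(i < n) f i)%E <->
    exists2 i, (i < n)%N & (X%:E < f i)%E.
  elim: n => [|n IH]; first by rewrite big_ord0; split=> // -[].
  rewrite big_ord_recr/= lt_max; split=> [/orP[/IH[i ilt Xi]|Xn]|[i]].
  - by exists i => //; exact: ltnW.
  - by exists n.
  - rewrite ltnS leq_eqVlt => /predU1P[-> ->|ilt Xi]; first by rewrite orbT.
    by apply/orP; left; apply/IH; exists i.
apply/seteqP; split=> w.
  move=> /= /(maxE (fun i => ereal_sup (range (fun k : nat =>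
      (\sum_(j < k) (A i j w * B j w - Tau j w))%:E)))) [i iN].
  move=> /ereal_sup_gt[_ [k _ <-]]; rewrite lte_fin => Xk.
  by exists k.+1 => //; apply/exceedP; exists i, k.
move=> [n _ /exceedP[i [k [iN kn Xk]]]] /=.
apply/(maxE (fun i => ereal_sup (range (fun k : nat =>
      (\sum_(j < k) (A i j w * B j w - Tau j w))%:E)))); exists i => //.
apply: lt_le_trans (ereal_sup_ubound _); last by exists k.
by rewrite lte_fin.
Qed.

Context (alpha c0 mu : R).
Hypotheses (M : queue_model A B Tau) (c0_gt0 : 0 < c0)
  (iA : P.-integrable setT
    (EFin \o (fun w => `|A 0 0 w| * expR (c0 * A 0 0 w `^ alpha))))
  (iB : P.-integrable setT (EFin \o (fun w => `|B 0 w|)))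
  (drift : (\int[P]_w (A 0 0 w * B 0 w - Tau 0 w)%:E = (- mu)%:E)%E).

Lemma pr_A_gt i j a : pr P [set w | a < A i j w] = pr P [set w | a < A 0 0 w].
Proof.
rewrite /pr; congr fine.
have E k l : [set w | a < A k l w] = A k l @^-1` `]a, +oo[.
  by apply/seteqP; split => w /=; rewrite in_itv/= andbT.
by rewrite !E; exact: (A_law M).
Qed.

(* [th k * y k <= c0 * m k `^ (alpha - 1)] makes the cap [c0 * A `^ alpha] in
   [upper_exp] inactive when [A <= m k] and [B <= y k], since then
   [A * B <= y k * m k `^ (1 - alpha) * A `^ alpha]. *)
Lemma pr_exceed_le N n (X mu' : R) (m y th : nat -> R) :
  alpha < 1 ->
  (forall k, 0 < th k) ->
  (forall k, \int[P]_w (upper_exp alpha c0 (th k) (triple A B Tau 0 0 w))%:E <=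
     (1 - th k * mu')%:E)%E ->
  (forall j k, (j <= k)%N -> m j <= m k /\ y j <= y k) ->
  (forall k, 0 < m k) ->
  (forall k, th k * y k <= c0 * m k `^ (alpha - 1)) ->
  pr P (exceed N n X) <=
  pr P (\big[setU/set0]_(j < n) [set w | y j < B j w]) +
  (N%:R * \sum_(j < n) pr P [set w | m j < A 0 0 w] +
   N%:R * \sum_(k < n) expR (- (th k * (X + mu' * k%:R)))).
Proof.
move=> al1 th0 thv my m0 thy.
(* [B j] is common to all servers, so this union carries no factor [N], unlike [F2] and [F3]. It
   alone survives in the limit. *)
pose F1 := \big[setU/set0]_(j < n) [set w | y j < B j w].
pose F2 := \big[setU/set0]_(i < N) \big[setU/set0]_(j < n) [set w | m j < A i j w].
pose V i k := [set w | expR (th k * X) <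
  \prod_(l < k) upper_exp alpha c0 (th k) (triple A B Tau i l w)].
pose F3 := \big[setU/set0]_(i < N) \big[setU/set0]_(k < n) V i k.
have mV i k : measurable (V i k).
  have -> : V i k = (fun w => \prod_(l < k) upper_exp alpha c0 (th k)
      (triple A B Tau i l w)) @^-1` `]expR (th k * X), +oo[.
    by apply/seteqP; split => w /=; rewrite in_itv/= andbT.
  rewrite -[_ @^-1` _]setTI; apply: measurable_prod_triple => //.
  exact: measurable_upper_exp.
have mF1 : measurable F1.
  by apply: bigsetU_measurable => l _; exact: measurable_gt.
have mF2 : measurable F2.
  apply: (measurable_bigsetU2 (F := fun i j => [set w | m j < A i j w])).
  by move=> i k; exact: measurable_gt.
have mF3 : measurable F3 by exact: (measurable_bigsetU2 (F := V)).
have mF23 : measurable (F2 `|` F3) by exact: measurableU.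
apply: (@le_trans _ _ (pr P (F1 `|` (F2 `|` F3)))).
  apply: le_pr_ae; [exact: measurable_exceed|exact: measurableU|].
  apply: filterS (ae_pos M) => w pos /exceedP[i [k [iN kn kw]]].
  have [|hB] := pselect (F1 w); first by left.
  have [|hA] := pselect (F2 w); first by right; left.
  right; right; apply/(in_bigsetU2 V); exists i, k; split => //.
  have By l : (l < k)%N -> B l w <= y k.
    move=> lk; rewrite (le_trans _ (my _ _ (ltnW lk)).2)// leNgt; apply/negP => h.
    apply: hB; apply/(in_bigsetU (fun j => [set w | y j < B j w])).
    by exists l => //; exact: ltn_trans kn.
  have Am l : (l < k)%N -> A i l w <= m k.
    move=> lk; rewrite (le_trans _ (my _ _ (ltnW lk)).1)// leNgt; apply/negP => h.
    apply: hA; apply/(in_bigsetU2 (fun i j => [set w | m j < A i j w])).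
    by exists i, l; split => //; exact: ltn_trans kn.
  rewrite /V/= /upper_exp -expR_sum ltr_expR.
  rewrite (eq_bigr (fun l : 'I_k => th k * (A i l w * B l w - Tau l w))).
    by rewrite -mulr_sumr ltr_pM2l.
  move=> l _ /=; have [A0 B0 T0] := pos i l.
  rewrite min_l; first by ring.
  have h1 : th k * B l w <= c0 * m k `^ (alpha - 1).
    by apply: le_trans (thy k); rewrite ler_pM2l// By.
  (* The exponent is negative as [alpha < 1]: this is where an upper bound on [A] weakens the cap
     condition to its worst case [A = m k]. *)
  have h2 : m k `^ (alpha - 1) <= A i l w `^ (alpha - 1).
    have -> : alpha - 1 = - (1 - alpha) by ring.
    rewrite !powRN lef_pV2 ?posrE ?powR_gt0//.
    by apply: ge0_ler_powR; rewrite ?nnegrE ?subr_ge0 ?(ltW al1) ?(ltW A0) ?(ltW (m0 k))// Am.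
  have -> : A i l w `^ alpha = A i l w * A i l w `^ (alpha - 1).
    by rewrite -[X in X * _]powRr1 ?(ltW A0)// -powRD ?(gt_eqF A0) ?implybT// addrC subrK.
  have h3 : th k * B l w <= c0 * A i l w `^ (alpha - 1).
    by apply: (le_trans h1); rewrite ler_pM2l.
  by rewrite mulrCA [leRHS]mulrCA ler_pM2l.
apply: le_trans (prU_le _ mF1 mF23) _; rewrite lerD2l.
apply: le_trans (prU_le _ mF2 mF3) _; apply: lerD.
  apply: (@pr_bigsetU2_le _ _ _ _ (fun i j => [set w | m j < A i j w])
      (fun j => pr P [set w | m j < A 0 0 w])).
    by move=> i k; exact: measurable_gt.
  by move=> i k; rewrite pr_A_gt.
apply: (@pr_bigsetU2_le _ _ _ _ V (fun k => expR (- (th k * (X + mu' * k%:R))))) => //.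
move=> i k.
have f0 (z : R * (R * R)) : 0 <= upper_exp alpha c0 (th k) z by exact: expR_ge0.
apply: (le_trans (chernoff_prod M i k (th k * X)
  (measurable_upper_exp alpha c0 (th k)) f0 (thv k))).
have v1 : 1 - th k * mu' <= expR (- (th k * mu')) by exact: expR_ge1Dx.
have v0 : 0 <= 1 - th k * mu'.
  rewrite -lee_fin; apply: le_trans (thv k).
  by apply: integral_ge0 => w _; rewrite lee_fin.
have vj : (1 - th k * mu') ^+ k <= expR (- (th k * mu') * k%:R).
  by rewrite expRM_natr lerXn2r ?nnegrE ?expR_ge0.
apply: le_trans (ler_wpM2l (expR_ge0 _) vj) _.
rewrite -expRD ler_expR.
by rewrite le_eqVlt; apply/orP; left; apply/eqP; ring.
Qed.

End steady_state.

Section lower_event.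
Context d (T : measurableType d) (R : realType) (P : probability T R).
Context (A : nat -> nat -> {RV P >-> R}) (B Tau : nat -> {RV P >-> R}).
Hypothesis M : queue_model A B Tau.

Notation Z := (primitives A B Tau).
Notation sig S := <<s gen_on Z S >>.

Lemma sig_measurable S E : sig S E -> measurable E.
Proof. by apply: g_sigma_sub_measurable; exact: gen_on_measurable. Qed.

Lemma pr_indep S1 S2 E1 E2 : S1 `&` S2 = set0 -> sig S1 E1 -> sig S2 E2 ->
  pr P (E1 `&` E2) = pr P E1 * pr P E2.
Proof.
move=> S12 s1 s2; rewrite /pr (indep2_gen_on (Z_indep M) S12 s1 s2).
have m1 := sig_measurable s1; have m2 := sig_measurable s2.
by rewrite fineM// fin_num_measure.
Qed.

Lemma sig_gt S x a : S x -> sig S [set w | a < Z x w].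
Proof.
move=> Sx; have -> : [set w | a < Z x w] = Z x @^-1` `]a, +oo[.
  by apply/seteqP; split => w /=; rewrite in_itv/= andbT.
have := @measurable_gen_on _ _ _ _ _ Z _ _ Sx measurableT `]a, +oo[%classic.
by rewrite setTI; exact.
Qed.

Lemma sig_setI S E F : sig S E -> sig S F -> sig S (E `&` F).
Proof. exact: (@measurableI _ (g_sigma_algebraType (gen_on Z S))). Qed.

Lemma sig_setC S E : sig S E -> sig S (~` E).
Proof. exact: (@measurableC _ (g_sigma_algebraType (gen_on Z S))). Qed.

Lemma sig_bigsetI S (F : nat -> set T) n : (forall i, sig S (F i)) ->
  sig S (\big[setI/setT]_(i < n) F i).
Proof.
move=> sF; apply: (@bigsetI_measurable _ (g_sigma_algebraType (gen_on Z S))).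
by move=> i _; exact: sF.
Qed.

Lemma pr_B_gt j a : pr P [set w | a < B j w] = pr P [set w | a < B 0 w].
Proof.
rewrite /pr; congr fine.
have E k : [set w | a < B k w] = B k @^-1` `]a, +oo[.
  by apply/seteqP; split => w /=; rewrite in_itv/= andbT.
by rewrite !E; exact: (B_law M).
Qed.

Lemma pr_A_le_all N j a :
  pr P (\big[setI/setT]_(i < N) [set w | A i j w <= a]) =
  (1 - pr P [set w | a < A 0 0 w]) ^+ N.
Proof.
have mA i : measurable [set w | A i j w <= a].
  have -> : [set w | A i j w <= a] = ~` [set w | a < A i j w].
    by apply/seteqP; split => w /=; rewrite leNgt => /negP.
  by apply: measurableC; exact: measurable_gt.
have pA i : pr P [set w | A i j w <= a] = 1 - pr P [set w | a < A 0 0 w].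
  rewrite -(pr_A_gt M i j) -prC; last exact: measurable_gt.
  by congr (pr P _); apply/seteqP; split => w /=; rewrite leNgt => /negP.
elim: N => [|N IH]; first by rewrite big_ord0 prT expr0.
rewrite big_ord_recr/= (pr_indep (S1 := [set x | exists2 i, (i < N)%N & x = inl (i, j)])
    (S2 := [set inl (N, j)])).
- by rewrite IH pA exprSr.
- by rewrite -subset0 => x [[i iN ->]] /= [iE]; rewrite iE ltnn in iN.
- apply: (@bigsetI_measurable _ (g_sigma_algebraType (gen_on Z _))) => i _.
  have -> : [set w | A i j w <= a] = ~` [set w | a < Z (inl (nat_of_ord i, j)) w].
    by apply/seteqP; split => w /=; rewrite leNgt => /negP.
  by apply: sig_setC; apply: sig_gt; exists (nat_of_ord i).
- have -> : [set w | A N j w <= a] = ~` [set w | a < Z (inl (N, j)) w].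
    by apply/seteqP; split => w /=; rewrite leNgt => /negP.
  by apply: sig_setC; apply: sig_gt.
Qed.

Lemma pr_exists_B_gt n (y : nat -> R) :
  pr P (\big[setU/set0]_(j < n) [set w | y j < B j w]) =
  1 - \prod_(j < n) (1 - pr P [set w | y j < B 0 w]).
Proof.
pose G j := [set w | y j < B j w].
have mG j : measurable (G j) by exact: measurable_gt.
have mU : measurable (\big[setU/set0]_(j < n) G j).
  by apply: bigsetU_measurable.
rewrite -[LHS](subKr 1) -prC//; congr (1 - _).
have -> : ~` (\big[setU/set0]_(j < n) G j) = \big[setI/setT]_(j < n) ~` G j.
  by rewrite setC_bigsetU.
elim: n {mU} => [|n IH]; first by rewrite !big_ord0 prT.
rewrite !big_ord_recr/= (pr_indep
    (S1 := [set x | exists2 j, (j < n)%N & x = inr (inl j)])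
    (S2 := [set inr (inl n)])).
- by rewrite IH prC// /G pr_B_gt.
- by rewrite -subset0 => x [[i iN ->]] /= [iE]; rewrite iE ltnn in iN.
- apply: (@bigsetI_measurable _ (g_sigma_algebraType (gen_on Z _))) => i _.
  apply: sig_setC; apply: (sig_gt (x := inr (inl (nat_of_ord i)))).
  by exists (nat_of_ord i).
- by apply: sig_setC; apply: (sig_gt (x := inr (inl n))).
Qed.

(* If [y j < B j] and some [A i j] exceeds [a], then server [i] exceeds [X]
   right after job [j], unless [Tau j] is large or the walk of [i] is low before
   job [j]; with [i] the first such server, the failure events are independent of
   [B j]. *)
Lemma pr_exceed_ge N n (X s a tol : R) (y l : nat -> R) :
  0 < a -> (forall j, 0 < y j) ->
  (forall i j, pr P [set w | walk A B Tau i j w < - l j] <= tol) -> 0 <= tol ->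
  (forall j, X <= a * y j - l j - s) ->
  pr P (\big[setU/set0]_(j < n) [set w | y j < B j w]) -
    (\sum_(j < n) pr P [set w | y j < B 0 w]) *
    (pr P [set w | s < Tau 0 w] + (1 - pr P [set w | a < A 0 0 w]) ^+ N + tol) <=
  pr P (exceed A B Tau N n.+1 X).
Proof.
move=> a0 y0 wtol tol0 Xy.
pose G j := [set w | y j < B j w].
pose H j := [set w | s < Tau j w].
pose none j := \big[setI/setT]_(i < N) [set w | A i j w <= a].
(* Server [i] is the first whose factor for job [j] exceeds [a]. These events are disjoint in [i],
   so the sum over servers costs a factor at most 1 instead of [N]. *)
pose F i j := [set w | a < A i j w] `&` \big[setI/setT]_(k < i) [set w | A k j w <= a].
pose W i j := [set w | walk A B Tau i j w < - l j].
pose FW j := \big[setU/set0]_(i < N) (F i j `&` W i j).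
(* The factors of job [j] for all servers, the earlier jobs ([past j]) and [B j] use disjoint sets
   of primitives; hence the choice of the server, its walk before job [j] and the length of job [j]
   are independent. *)
pose Acol j : set (nat * nat + (nat + nat)) := [set x | exists i, x = inl (i, j)].
pose past j : set (nat * nat + (nat + nat)) :=
  [set x | exists i l, (l < j)%N /\ job i l x].
have AleE i j : [set w | A i j w <= a] = ~` [set w | a < Z (inl (i, j)) w].
  by apply/seteqP; split => w /=; rewrite leNgt => /negP.
have sA i j : sig (Acol j) [set w | A i j w <= a].
  by rewrite AleE; apply: sig_setC; apply: sig_gt; exists i.
have sG j : sig [set inr (inl j)] (G j) by exact: (sig_gt (x := inr (inl j))).
have sH j : sig [set inr (inr j)] (H j) by exact: (sig_gt (x := inr (inr j))).
have snone j : sig (Acol j) (none j).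
  by apply: (sig_bigsetI (F := fun i => [set w | A i j w <= a])).
have sF i j : sig (Acol j) (F i j).
  apply: sig_setI; first by apply: (sig_gt (x := inl (i, j))); exists i.
  by apply: (sig_bigsetI (F := fun i => [set w | A i j w <= a])).
have sW i j : sig (past j) (W i j).
  have jp k : (k < j)%N -> job i k `<=` past j by move=> kj x jx; exists i, k.
  have mw := measurable_walk_gen (A := A) (B := B) (Tau := Tau) jp.
  have -> : W i j = walk A B Tau i j @^-1` `]-oo, - l j[.
    by apply/seteqP; split => w /=; rewrite in_itv.
  have := mw measurableT `]-oo, - l j[%classic; rewrite setTI; exact.
have mG j := sig_measurable (sG j).
have mH j := sig_measurable (sH j).
have mnone j := sig_measurable (snone j).
have mF i j := sig_measurable (sF i j).
have mW i j := sig_measurable (sW i j).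
have mFW j : measurable (FW j).
  by apply: bigsetU_measurable => i _; exact: measurableI.
pose bad j := H j `|` (none j `|` FW j).
have mbad j : measurable (bad j).
  by apply: measurableU => //; exact: measurableU.
have disj1 j : Acol j `&` past j = set0.
  rewrite -subset0 => x [[i ->]] [i' [l' [l'j]]].
  by case=> [[[_ jE]|]|] //; rewrite jE ltnn in l'j.
have disj2 j : [set inr (inl j)] `&` (Acol j `|` past j) = set0.
  rewrite -subset0 => x [-> [[i //]|[i' [l' [l'j]]]]].
  by case=> [[|[jE]]|] //; rewrite jE ltnn in l'j.
have sigS S S' E : S `<=` S' -> sig S E -> sig S' E.
  by move=> SS'; exact: (gen_onS SS').
have sumF j : \sum_(i < N) pr P (F i j) <= 1.
  have tF : trivIset setT (fun i => F i j).
    have aux i k w : (i < k)%N -> F i j w -> F k j w -> False.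
      move=> ik [/= aA _] [_].
      rewrite -(bigcap_mkord k (fun k => [set w | A k j w <= a])) => /(_ i ik) /=.
      by rewrite leNgt aA.
    move=> i k _ _ [w [Fi Fk]]; apply/eqP; case: ltngtP => // ik.
      by have := aux _ _ _ ik Fi Fk.
    by have := aux _ _ _ ik Fk Fi.
  have mUF : measurable (\big[setU/set0]_(i < N) F i j).
    by apply: bigsetU_measurable => i _; exact: mF.
  apply: le_trans (pr_le1 P mUF).
  have tFN : trivIset `I_N (fun i => F i j) by exact: sub_trivIset tF.
  rewrite /pr (measure_semi_additive_ord_I P (fun k _ => mF k j) tFN mUF).
  rewrite [in leRHS](eq_bigr (fun i : 'I_N => (pr P (F i j))%:E)); last first.
    by move=> i _; exact: prE.
  by rewrite sumEFin.
have pG j : pr P (G j `&` bad j) <= pr P [set w | y j < B 0 w] *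
    (pr P [set w | s < Tau 0 w] + (1 - pr P [set w | a < A 0 0 w]) ^+ N + tol).
  rewrite -(pr_B_gt j) -/(G j).
  have GFW : G j `&` FW j = \big[setU/set0]_(i < N) (G j `&` (F i j `&` W i j)).
    by rewrite /FW big_distrr.
  rewrite setIUr setIUr GFW -addrA !mulrDr.
  have m1 : measurable (G j `&` H j) by exact: measurableI.
  have m2 : measurable (G j `&` none j) by exact: measurableI.
  have m3 : measurable (\big[setU/set0]_(i < N) (G j `&` (F i j `&` W i j))).
    by rewrite -GFW; exact: measurableI.
  apply: le_trans (prU_le _ m1 (measurableU _ _ m2 m3)) _; apply: lerD.
    rewrite (pr_indep _ (sG j) (sH j)); last first.
      by rewrite -subset0 => x /= [->].
    by rewrite (pr_Tau_gt M).
  apply: le_trans (prU_le _ m2 m3) _; apply: lerD.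
    rewrite (pr_indep _ (sG j) (snone j)); last first.
      by rewrite -subset0 => x /= [-> [i]].
    by rewrite /none pr_A_le_all.
  apply: le_trans (pr_bigsetU_le P N (F := fun i => G j `&` (F i j `&` W i j)) _) _.
    by move=> i; do 2 apply: measurableI => //.
  have E i : pr P (G j `&` (F i j `&` W i j)) <= pr P (G j) * pr P (F i j) * tol.
    rewrite (pr_indep (disj2 j) (sG j)).
      rewrite (pr_indep (disj1 j) (sF i j) (sW i j)) mulrA.
      by rewrite ler_wpM2l ?mulr_ge0 ?pr_ge0//; exact: wtol.
    by apply: sig_setI; [apply: sigS (sF i j)|apply: sigS (sW i j)] => x; [left|right].
  apply: (@le_trans _ _ (\sum_(i < N) pr P (G j) * pr P (F i j) * tol)).
    by apply: ler_sum => i _; exact: E.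
  rewrite -mulr_suml -mulr_sumr -mulrA ler_wpM2l ?pr_ge0//.
  by rewrite ler_piMl.
rewrite lerBlDr.
pose GB j := G j `&` bad j.
have mGB j : measurable (GB j) by exact: measurableI.
have mUGB : measurable (\big[setU/set0]_(j < n) GB j) by exact: bigsetU_measurable.
have mex := measurable_exceed A B Tau N n.+1 X.
apply: (@le_trans _ _ (pr P (exceed A B Tau N n.+1 X `|`
    \big[setU/set0]_(j < n) GB j))).
  apply: le_pr; [by apply: bigsetU_measurable => j _; exact: mG|exact: measurableU|].
  move=> w /(in_bigsetU G)[j jn Gj].
  have [bj|nbj] := pselect (bad j w).
    by right; apply/(in_bigsetU GB); exists j.
  left.
  have nH : ~ H j w by move=> h; apply: nbj; left.
  have nnone : ~ none j w by move=> h; apply: nbj; right; left.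
  have nFW : ~ FW j w by move=> h; apply: nbj; right; right.
  have exi : exists i, (i < N)%N && (a < A i j w).
    apply: contrapT => h; apply: nnone.
    rewrite /none -(bigcap_mkord N (fun i => [set w | A i j w <= a])) => i /= iN.
    by rewrite leNgt; apply/negP => h'; apply: h; exists i; rewrite iN.
  have [i /andP[iN aA] imin] := ex_minnP exi.
  have Fi : F i j w.
    split => //; rewrite -(bigcap_mkord i (fun i => [set w | A i j w <= a])) => k /= ki.
    rewrite leNgt; apply/negP => h; have := imin k.
    by rewrite (ltn_trans ki iN) h => /(_ isT); rewrite leqNgt ki.
  have nW : - l j <= walk A B Tau i j w.
    rewrite leNgt; apply/negP => h; apply: nFW.
    by apply/(in_bigsetU (fun i => F i j `&` W i j)); exists i.
  (* [walk i j] stops before job [j]; including that job takes [j.+1] steps, hence the horizon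
     [n.+1]. *)
  apply/exceedP; exists i, j.+1; split => //.
  rewrite /walk big_ord_recr/= -/(walk A B Tau i j w).
  have Ts : Tau j w <= s by rewrite leNgt; apply/negP.
  have AB : a * y j < A i j w * B j w.
    by apply: ltr_pM => //; [exact: ltW|exact: ltW].
  by have := Xy j; lra.
apply: (le_trans (prU_le _ mex mUGB)); rewrite lerD2l.
apply: (le_trans (pr_bigsetU_le P n mGB)).
rewrite mulr_suml; apply: ler_sum => j _; exact: pG.
Qed.

End lower_event.

(** * Asymptotics *)

Section products.
Context {R : realType}.

Lemma prod_1B_le (p : nat -> R) n : (forall j, 0 <= p j <= 1) ->
  \prod_(j < n) (1 - p j) <= expR (- \sum_(j < n) p j).
Proof.
move=> p01; rewrite -sumrN expR_sum; apply: ler_prod => j _.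
have /andP[p0 p1] := p01 j; rewrite subr_ge0 p1/=.
exact: expR_ge1Dx.
Qed.

(** The reciprocal of [1 - p] is [1 + p / (1 - p)], at most [expR (p / (1 - p))]. *)
Lemma prod_1B_ge (p : nat -> R) pm n : (forall j, 0 <= p j <= pm) -> pm < 1 ->
  expR (- ((\sum_(j < n) p j) / (1 - pm))) <= \prod_(j < n) (1 - p j).
Proof.
move=> p01 pm1; rewrite mulr_suml -sumrN expR_sum; apply: ler_prod => j _.
have /andP[p0 p1] := p01 j; rewrite expR_ge0/=.
have pj0 : 0 < 1 - p j by lra.
have pm0 : 0 < 1 - pm by lra.
apply: (@le_trans _ _ (expR (- (p j / (1 - p j))))).
  rewrite ler_expR lerN2 ler_wpM2l// lef_pV2 ?posrE//; lra.
rewrite expRN -[leRHS]invrK lef_pV2 ?posrE ?expR_gt0 ?invr_gt0//.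
apply: le_trans (expR_ge1Dx _); rewrite le_eqVlt; apply/orP; left; apply/eqP.
by field; rewrite gt_eqF.
Qed.

End products.

Section asymptotics.
Context d (T : measurableType d) (R : realType) (P : probability T R).
Context (A : nat -> nat -> {RV P >-> R}) (B Tau : nat -> {RV P >-> R}).
Context (alpha q beta mu x : R) (b c : nat -> R).
Let Q y := pr P [set w | y < B 0 w].
Let I := x `^ (1 - beta) / (mu * (beta - 1)).
Hypotheses (M : queue_model A B Tau)
  (al0 : 0 < alpha) (al1 : alpha < 1) (q0 : 0 < q) (be1 : 1 < beta)
  (mu0 : 0 < mu) (x0 : 0 < x)
  (A_le : forall q1, q1 < q -> exists a0, forall a, a0 <= a ->
     pr P [set w | a < A 0 0 w] <= expR (- (q1 * a `^ alpha)))
  (A_ge : forall q2, q < q2 -> exists a0, forall a, a0 <= a ->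
     expR (- (q2 * a `^ alpha)) <= pr P [set w | a < A 0 0 w])
  (iB : P.-integrable setT (EFin \o (fun w => `|B 0 w|)))
  (drift : (\int[P]_w (A 0 0 w * B 0 w - Tau 0 w)%:E = (- mu)%:E)%E)
  (Q0 : forall y, 0 < y -> 0 < Q y)
  (RV : forall l, 0 < l -> Q (l * y) / Q y @[y --> +oo] --> l `^ (- beta))
  (b_pinfty : b N @[N --> \oo] --> +oo)
  (bE : \forall N \near \oo, q * b N `^ alpha = ln (N%:R : R))
  (c_pinfty : c N @[N --> \oo] --> +oo)
  (v_pinfty : c N / b N @[N --> \oo] --> +oo)
  (cQ : c N * Q (c N / b N) @[N --> \oo] --> (1 : R))
  (ln_pinfty : ln (N%:R : R) @[N --> \oo] --> +oo)
  (c_le : exists C p, [/\ 0 < C, 0 < p &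
     \forall N \near \oo, c N <= C * ln (N%:R : R) `^ p]).

Let Qni y z : 0 < y -> y <= z -> Q z <= Q y.
Proof.
move=> _ yz; apply: le_pr; [exact: measurable_gt|exact: measurable_gt|].
by move=> w /=; exact: le_lt_trans.
Qed.

Let iA c0 : 0 < c0 -> c0 < q -> P.-integrable setT
    (EFin \o (fun w => `|A 0 0 w| * expR (c0 * A 0 0 w `^ alpha))).
Proof.
move=> c00 c0q; have [a0 Ha] : exists a0, forall a, a0 <= a ->
     pr P [set w | a < A 0 0 w] <= expR (- ((c0 + q) / 2 * a `^ alpha)).
  by apply: A_le; lra.
by apply: (integrable_weibull (A_pos M 0 0) al0 c00 _ Ha); lra.
Qed.

Let I_gt0 : 0 < I.
Proof. by rewrite divr_gt0 ?powR_gt0// mulr_gt0// subr_gt0. Qed.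

(** The shape in which the tail sums deliver the limit, with [a = x] and [rho = mu / x]: the level
    is [x * c N * (1 + mu / x / c N * j)]. *)
Let IE : I = x `^ (- beta) / (mu / x * (beta - 1)).
Proof.
rewrite /I powRD ?(gt_eqF x0) ?implybT// powRr1 ?(ltW x0)//.
by field; rewrite !gt_eqF// subr_gt0.
Qed.

Let cvg_tail0 a : 0 < a -> Q (a * (c N / b N)) @[N --> \oo] --> (0 : R).
Proof.
move=> a0.
have h := cvg_scaled_tail Q0 RV v_pinfty cQ a0.
have cV : (c N)^-1 @[N --> \oo] --> (0 : R).
  by apply/gtr0_cvgV0 => //; move/cvgryPgt : c_pinfty; exact.
rewrite -(mulr0 (a `^ (- beta))).
apply: (cvg_trans (G := (fun N => c N * Q (a * (c N / b N)) * (c N)^-1) @ \oo)).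
  apply: near_eq_cvg; near=> N.
  have cN0 : 0 < c N by near: N; move/cvgryPgt : c_pinfty; exact.
  by rewrite mulrC mulrA mulVf ?mul1r// gt_eqF.
exact: cvgM h cV.
Unshelve. all: end_near.
Qed.

(** [ln N] is [q * b N * b N ^ (alpha - 1)], where the last factor vanishes and [b N <= c N]
    eventually. It brings the Chernoff exponents below [th0]. *)
Let ln_div_c K : 0 < K -> \forall N \near \oo, ln (N%:R : R) <= K * c N.
Proof.
move=> K0; have h_al1 := al1; have h_q0 := q0.
have lim : b N `^ (- (1 - alpha)) @[N --> \oo] --> (0 : R).
  apply: (@cvg_comp _ _ _ b (fun y => y `^ (- (1 - alpha))) _ (pinfty_nbhs R)) => //.
  by apply: cvgr_powRN_pinfty; lra.
near=> N.
have b0 : 0 < b N by near: N; move/cvgryPgt : b_pinfty; exact.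
have <- : q * b N `^ alpha = ln (N%:R : R) by near: N.
have bK : b N `^ (- (1 - alpha)) <= K / q.
  by near: N; have /cvgr_le := lim; apply; rewrite divr_gt0.
have cb : b N <= c N.
  have : 1 <= c N / b N by near: N; move/cvgryPge : v_pinfty; exact.
  by rewrite ler_pdivlMr// mul1r.
have -> : alpha = 1 + - (1 - alpha) by ring.
rewrite powRD ?(gt_eqF b0) ?implybT// powRr1 ?(ltW b0)//.
apply: (@le_trans _ _ (q * (b N * (K / q)))).
  by rewrite ler_pM2l// ler_pM2l.
have -> : q * (b N * (K / q)) = K * b N by field; rewrite gt_eqF.
by rewrite ler_pM2l.
Unshelve. all: end_near.
Qed.

Let choose_upper eta : 0 < eta -> exists e, [/\ 0 < e, e < 1, 1 < (1 - e) * beta &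
  (x * (1 + e) `^ (- 3)) `^ (- beta) /
    (mu * (1 - e) / x * ((1 - e) * beta - 1)) < I + eta].
Proof.
move=> eta0; have h_be1 := be1; have h_mu0 := mu0; have h_x0 := x0.
have id1 : 1 - e @[e --> (0 : R)^'+] --> 1 - (0 : R).
  by apply: cvgB; [exact: cvg_cst|exact: cvg_at_right_id].
have lim : (1 + e) `^ (3 * beta) * x `^ (- beta) /
    (mu * (1 - e) / x * ((1 - e) * beta - 1)) @[e --> (0 : R)^'+] -->
    1 * x `^ (- beta) / (mu * (1 - 0) / x * ((1 - 0) * beta - 1)).
  apply: cvgM; first by apply: cvgMl; exact: powR_cst_cvg.
  apply: cvgV.
    by rewrite subr0 mulr1 mul1r mulf_neq0 ?gt_eqF ?divr_gt0// subr_gt0.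
  apply: cvgM; first by apply: cvgMl; apply: cvgMr.
  by apply: cvgB; [exact: cvgMl|exact: cvg_cst].
have sb : (1 - e) * beta @[e --> (0 : R)^'+] --> (1 - 0) * beta by exact: cvgMl.
have near_e : \forall e \near (0 : R)^'+, [/\ 0 < e, e < 1, 1 < (1 - e) * beta &
    (1 + e) `^ (3 * beta) * x `^ (- beta) /
    (mu * (1 - e) / x * ((1 - e) * beta - 1)) < I + eta].
  near=> e; split; near: e.
  - exact: nbhs_right_gt.
  - by apply: nbhs_right_lt; lra.
  - by have /cvgr_gt := sb; apply; rewrite subr0 mul1r.
  - have /cvgr_lt := lim; apply; rewrite subr0 mulr1 !mul1r -IE.
    by rewrite ltrDl.
have [e [e0 e1 es eI]] := @filter_ex _ _ _ _ near_e.
exists e; split => //; rewrite powRM ?powR_ge0 ?(ltW x0)// -powRrM.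
by have -> : - 3 * - beta = 3 * beta; [ring|rewrite (mulrC (x `^ _))].
Unshelve. all: end_near.
Qed.

Lemma exceed_limsup eta : 0 < eta -> \forall N \near \oo, forall n,
  pr P (exceed A B Tau N n (x * c N)) <= 1 - expR (- I) + eta.
Proof.
move=> eta0.
have h_al0 := al0; have h_al1 := al1; have h_q0 := q0; have h_be1 := be1.
have h_mu0 := mu0; have h_x0 := x0; have hI0 := I_gt0.
have eta4 : 0 < eta / 4 by lra.
have [e [e0 e1 es eJ]] := choose_upper eta4.
have l1 : 1 < 1 + e by lra.
have l0 : 0 < 1 + e by lra.
pose rho := mu * (1 - e) / x.
have rho0 : 0 < rho by rewrite divr_gt0// mulr_gt0// subr_gt0.
(* The power [- 3] serves the cap condition [thy], which reduces to comparing the exponents [1 - 3]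
   and [- 1 + (alpha - 1)] of [1 + e]. *)
pose a := x * (1 + e) `^ (- 3).
have a0 : 0 < a by rewrite mulr_gt0// powR_gt0.
have s0 : 0 < 1 - e by lra.
pose K' := I + eta / 2.
have K'0 : 0 < K' by rewrite /K'; lra.
pose c0 := q / (1 + e).
have c00 : 0 < c0 by rewrite divr_gt0.
have c0q : c0 < q by rewrite ltr_pdivrMr// ltr_pMr.
have mumu : mu * (1 - e) < mu by rewrite gtr_pMr//; lra.
have [th0 th00 Hth] := upper_exp_le M c00 (iA c00 c0q) iB drift mumu.
(* [m j ^ alpha] gains [(1 + e) ^ alpha] over [b N ^ alpha]. Half of this exponent pays for
   [q1 < q], the other half is the surplus [1 + d1] needed against the factor [N]. *)
pose q1 := q * (1 + e) `^ (- (alpha / 2)).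
have q1q : q1 < q.
  by rewrite gtr_pMr// -[ltRHS](powRr0 (1 + e)) ltr_gt1_powR//; lra.
have [A0 HA] := A_le q1q.
pose d1 := (1 + e) `^ (alpha / 2) - 1.
have d10 : 0 < d1.
  by rewrite subr_gt0 -[ltLHS](powRr0 (1 + e)) ltr_gt1_powR//; lra.
pose kappa := e * alpha.
have kappa0 : 0 < kappa by rewrite mulr_gt0.
have [C [p [C0 p0 cC]]] := c_le.
have eta8 : 0 < eta / 4 / 2 by lra.
have D1 := exp_sum_small c_pinfty C0 p0 d10 kappa0 rho0 eta8 cC ln_pinfty.
have D2 := exp_sum_small c_pinfty C0 p0 e0 kappa0 rho0 eta8 cC ln_pinfty.
have S := tail_sum_le be1 Qni Q0 RV c_pinfty v_pinfty cQ a0 rho0 s0 es eJ.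
(* So small that the division by [1 - pm] in [prod_1B_ge] raises the sum from [I + eta / 4] to at
   most [K']. *)
have Qa : \forall N \near \oo, Q (a * (c N / b N)) <= 1 - (I + eta / 4) / K'.
  have /cvgr_le := cvg_tail0 a0; apply.
  by rewrite subr_gt0 ltr_pdivrMr// mul1r /K'; lra.
have lc := @ln_div_c (th0 * x / (1 + e)) ltac:(by rewrite divr_gt0// mulr_gt0).
near=> N => n.
have cN0 : 0 < c N by near: N; move/cvgryPgt : c_pinfty; exact.
have v0 : 0 < c N / b N by near: N; move/cvgryPgt : v_pinfty; exact.
have bN0 : 0 < b N by near: N; move/cvgryPgt : b_pinfty; exact.
have bA : A0 <= b N by near: N; move/cvgryPge : b_pinfty; exact.
have lnE : q * b N `^ alpha = ln (N%:R : R) by near: N.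
have ln0 : 0 < ln (N%:R : R) by near: N; move/cvgryPgt : ln_pinfty; exact.
have rc0 : 0 < rho / c N by rewrite divr_gt0.
have SN : forall n, \sum_(j < n) Q (a * (c N / b N) *
    (1 + rho / c N * j%:R) `^ (1 - e)) <= I + eta / 4 by near: N.
have QN : Q (a * (c N / b N)) <= 1 - (I + eta / 4) / K' by near: N.
have D1N : forall n, N%:R * \sum_(k < n) expR (- ((1 + d1) * ln (N%:R : R) *
    (1 + rho / c N * k%:R) `^ kappa)) <= eta / 4 / 2 by near: N.
have D2N : forall n, N%:R * \sum_(k < n) expR (- ((1 + e) * ln (N%:R : R) *
    (1 + rho / c N * k%:R) `^ kappa)) <= eta / 4 / 2 by near: N.
have lcN : ln (N%:R : R) <= th0 * x / (1 + e) * c N by near: N.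
pose r (k : nat) : R := 1 + rho / c N * k%:R.
have r1 k : 1 <= r k by rewrite lerDl mulr_ge0// ltW.
have r0 k : 0 < r k by rewrite (lt_le_trans ltr01).
have rS j k : (j <= k)%N -> r j <= r k.
  by move=> jk; rewrite lerD2l ler_pM2l// ler_nat.
(* Both tail sums must converge: the powers [e] and [1 - e] share the growth
   [r k] of the level [x * c N + mu * k] between [A] and [B]. *)
pose m (k : nat) := (1 + e) * b N * r k `^ e.
pose y (k : nat) := a * (c N / b N) * r k `^ (1 - e).
pose th (k : nat) := (1 + e) * ln (N%:R : R) * r k `^ (kappa - 1) / (x * c N).
have rp0 k u : 0 < r k `^ u by rewrite powR_gt0.
have m0 k : 0 < m k by rewrite !mulr_gt0.
have thp k : 0 < th k by rewrite divr_gt0 ?mulr_gt0.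
have mul_r k u : r k `^ (u - 1) * r k = r k `^ u.
  by rewrite -[X in _ * X]powRr1 ?(ltW (r0 k))// -powRD ?(gt_eqF (r0 k)) ?implybT// subrK.
(* [th k] is defined so that this holds: the level is [x * c N * r k], and the product is [1 + e]
   times [ln N] with the growth [r k ^ kappa] that makes the sum over [k] converge. *)
have thX k : th k * (x * c N + mu * (1 - e) * k%:R) =
    (1 + e) * ln (N%:R : R) * r k `^ kappa.
  have -> : x * c N + mu * (1 - e) * k%:R = x * c N * r k.
    by rewrite /r /rho; field; rewrite !gt_eqF.
  by rewrite -(mul_r k kappa) /th; field; rewrite !gt_eqF.
have kappa1 : kappa - 1 <= 0.
  by rewrite subr_le0 -[leRHS]mulr1 /kappa ler_pM// ltW.
have thle k : th k <= th0.
  rewrite ler_pdivrMr ?mulr_gt0//.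
  apply: (@le_trans _ _ ((1 + e) * ln (N%:R : R))).
    rewrite ler_piMr ?mulr_ge0 ?(ltW l0) ?(ltW ln0)//.
    by rewrite -[leRHS](powRr0 (r k)); apply: ler_powR.
  rewrite -ler_pdivlMl//; apply: (le_trans lcN).
  by rewrite le_eqVlt; apply/orP; left; apply/eqP; field; rewrite gt_eqF.
have thv k : (\int[P]_w (upper_exp alpha c0 (th k) (triple A B Tau 0 0 w))%:E <=
    (1 - th k * (mu * (1 - e)))%:E)%E.
  by apply: Hth; rewrite thp thle.
have av0 : 0 < a * (c N / b N) by exact: mulr_gt0.
have my j k : (j <= k)%N -> m j <= m k /\ y j <= y k.
  move=> jk; split.
    rewrite ler_pM2l ?mulr_gt0//.
    by apply: ge0_ler_powR; rewrite ?nnegrE ?(ltW e0) ?(ltW (r0 _))// rS.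
  rewrite ler_pM2l//.
  by apply: ge0_ler_powR; rewrite ?nnegrE ?(ltW s0) ?(ltW (r0 _))// rS.
(* With [ln N = q * b N ^ alpha] the powers of [b N] agree, and [kappa = e * alpha] makes those of
   [r k] agree, as [(kappa - 1) + (1 - e) = e * (alpha - 1)]. Only powers of [1 + e] remain. *)
have thy k : th k * y k <= c0 * m k `^ (alpha - 1).
  have bE1 : b N `^ alpha = b N `^ (alpha - 1) * b N.
    by rewrite -[X in _ * X]powRr1 ?(ltW bN0)// -powRD ?(gt_eqF bN0) ?implybT// subrK.
  have rE1 : r k `^ (kappa - 1) * r k `^ (1 - e) = r k `^ (e * (alpha - 1)).
    rewrite -powRD ?(gt_eqF (r0 k)) ?implybT//; congr (_ `^ _).
    by rewrite /kappa; ring.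
  have -> : th k * y k = q * b N `^ (alpha - 1) * r k `^ (e * (alpha - 1)) *
      ((1 + e) * (1 + e) `^ (- 3)).
    rewrite /th /y /a -lnE bE1 -rE1; field.
    by rewrite !gt_eqF.
  have -> : c0 * m k `^ (alpha - 1) =
      q * b N `^ (alpha - 1) * r k `^ (e * (alpha - 1)) *
      ((1 + e)^-1 * (1 + e) `^ (alpha - 1)).
    rewrite /m powRM ?mulr_ge0 ?(ltW l0) ?(ltW bN0) ?(ltW (rp0 _ _))//.
    rewrite powRM ?(ltW l0) ?(ltW bN0)// -powRrM /c0; ring.
  rewrite ler_pM2l ?mulr_gt0 ?powR_gt0//.
  have -> : (1 + e) * (1 + e) `^ (- 3) = (1 + e) `^ (1 + - 3).
    by rewrite powRD ?(gt_eqF l0) ?implybT// powRr1 ?(ltW l0).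
  have -> : (1 + e)^-1 * (1 + e) `^ (alpha - 1) = (1 + e) `^ (- 1 + (alpha - 1)).
    by rewrite [RHS]powRD ?(gt_eqF l0) ?implybT// powR_inv1 ?(ltW l0).
  by apply: ler_powR; lra.
apply: (le_trans (pr_exceed_le M c00 N n (x * c N) al1 thp thv my m0 thy)).
have -> : 1 - expR (- I) + eta = 1 - expR (- I) + eta / 2 + (eta / 4 / 2 * 2 + eta / 4)
  by field.
apply: lerD; last first.
  apply: (@le_trans _ _ (eta / 4 / 2 + eta / 4 / 2)); last by lra.
  apply: lerD.
    apply: le_trans (D1N n); rewrite ler_wpM2l//; apply: ler_sum => j _.
    have mA : A0 <= m j.
      apply: (le_trans bA); rewrite /m mulrAC ler_peMl ?(ltW bN0)//.
      apply: (@le_trans _ _ (1 * 1)); first by rewrite mulr1.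
      rewrite ler_pM ?ler01 ?(ltW l1)//.
      by rewrite -[leLHS](powRr0 (r j)); apply: ler_powR => //; exact: ltW.
    apply: (le_trans (HA _ mA)); rewrite ler_expR lerN2.
    rewrite le_eqVlt; apply/orP; left; apply/eqP.
    rewrite /m powRM ?mulr_ge0 ?(ltW l0) ?(ltW bN0) ?(ltW (rp0 _ _))//.
    rewrite powRM ?(ltW l0) ?(ltW bN0)// -powRrM -/kappa -/(r j) -lnE /d1 /q1.
    have -> : (1 + e) `^ alpha = (1 + e) `^ (alpha / 2) * (1 + e) `^ (alpha / 2).
      by rewrite -powRD ?(gt_eqF l0) ?implybT//; congr (_ `^ _); field.
    by rewrite powRN; field; rewrite gt_eqF// powR_gt0.
  apply: le_trans (D2N n); rewrite ler_wpM2l//; apply: ler_sum => j _.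
  by rewrite thX.
rewrite (pr_exists_B_gt M).
have IK : (I + eta / 4) / K' < 1 by rewrite ltr_pdivrMr// mul1r /K'; lra.
have Q1 : Q (a * (c N / b N)) < 1.
  apply: (le_lt_trans QN); rewrite gtrBl divr_gt0//; lra.
have pQ (j : nat) : 0 <= pr P [set w | y j < B 0 w] <= Q (a * (c N / b N)).
  rewrite pr_ge0/=; apply: Qni => //.
  rewrite ler_peMr ?(ltW av0)//.
  by rewrite -[leLHS](powRr0 (r j)); apply: ler_powR => //; exact: ltW.
have := prod_1B_ge n pQ Q1.
set Sn := \sum_(j < n) _ => hp.
have SnK : Sn / (1 - Q (a * (c N / b N))) <= K'.
  rewrite ler_pdivrMr ?subr_gt0//; apply: (le_trans (SN n)).
  rewrite -ler_pdivrMl// mulrC; lra.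
have : expR (- K') <= expR (- (Sn / (1 - Q (a * (c N / b N))))).
  by rewrite ler_expR lerN2.
have : expR (- I) - eta / 2 <= expR (- K').
  have -> : - K' = - I + - (eta / 2) by rewrite /K'; ring.
  rewrite expRD.
  have h1 : expR (- I) <= 1 by rewrite expR_le1; lra.
  have h2 := expR_ge1Dx (- (eta / 2)).
  have h3 := expR_gt0 (- I).
  apply: (@le_trans _ _ (expR (- I) * (1 - eta / 2))); last by rewrite ler_pM2l.
  by nra.
move: hp; lra.
Unshelve. all: end_near.
Qed.

Let choose_lower K : K < I -> exists e, [/\ 0 < e, e < 1 &
  K < (x * (1 + e) `^ 2) `^ (- beta) / (mu / x * (beta - 1))].
Proof.
move=> KI; have h_be1 := be1; have h_mu0 := mu0; have h_x0 := x0.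
have lim : (1 + e) `^ (- (2 * beta)) * (x `^ (- beta) / (mu / x * (beta - 1)))
    @[e --> (0 : R)^'+] --> 1 * (x `^ (- beta) / (mu / x * (beta - 1))).
  by apply: cvgMl; exact: powR_cst_cvg.
have near_e : \forall e \near (0 : R)^'+, [/\ 0 < e, e < 1 &
    K < (1 + e) `^ (- (2 * beta)) * (x `^ (- beta) / (mu / x * (beta - 1)))].
  near=> e; split; near: e.
  - exact: nbhs_right_gt.
  - by apply: nbhs_right_lt.
  - by have /cvgr_gt := lim; apply; rewrite mul1r -IE.
have [e [e0 e1 eI]] := @filter_ex _ _ _ _ near_e.
exists e; split => //; rewrite powRM ?powR_ge0 ?(ltW x0)// -powRrM mulrN.
by rewrite (mulrC (x `^ _)); move: eI; rewrite mulrA.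
Unshelve. all: end_near.
Qed.

Lemma exceed_liminf eta : 0 < eta -> \forall N \near \oo, exists n,
  1 - expR (- I) - eta <= pr P (exceed A B Tau N n (x * c N)).
Proof.
move=> eta0.
have h_al0 := al0; have h_al1 := al1; have h_q0 := q0; have h_be1 := be1.
have h_mu0 := mu0; have h_x0 := x0.
(* Solves [expR (- K) = expR (- I) + eta / 2]: one half of the error; the other half goes to the
   failure events. *)
pose K := - ln (expR (- I) + eta / 2).
have KE : expR (- K) = expR (- I) + eta / 2.
  by rewrite opprK lnK// posrE addr_gt0 ?expR_gt0// divr_gt0.
have KI : K < I.
  by rewrite -ltrN2 -ltr_expR KE ltrDl divr_gt0.
have [e [e0 e1 eK]] := choose_lower KI.
have l1 : 1 < 1 + e by lra.
have l0 : 0 < 1 + e by lra.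
(* One factor [1 + e] compensates the threshold [b N / (1 + e)] for [A]; the other leaves
   [x * e * c N] and [mu * e * j] as slack for the walk and for [Tau j]. *)
pose a := x * (1 + e) `^ 2.
have a0 : 0 < a by rewrite mulr_gt0// powR_gt0.
have rho0 : 0 < mu / x by rewrite divr_gt0.
pose J := a `^ (- beta) / (mu / x * (beta - 1)).
have J0 : 0 < J.
  by rewrite divr_gt0 ?powR_gt0// mulr_gt0// subr_gt0.
(* Three failure probabilities, each at most [tol], are multiplied by a sum that is at most
   [J + 1]. *)
pose tol := eta / 2 / (3 * (J + 1)).
have tol0 : 0 < tol by rewrite divr_gt0 ?divr_gt0// mulr_gt0//; lra.
have q20 : 0 < q / 2 by rewrite divr_gt0.
have q2q : q / 2 < q by lra.
have xe0 : 0 < x * e / 2 by rewrite divr_gt0// mulr_gt0.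
have [c1 c10 Hwalk] :=
  walk_lower_tail M q20 (iA q20 q2q) iB drift mu0 e0 xe0 tol0.
have iT := integrable_Tau M q20 (iA q20 q2q) iB drift.
have [u0 u00 Hu] := mul_tail_small iT tol0.
(* With it [b N / (1 + e)] is exceeded by one factor with probability at least [N ^ (d2 - 1)], so
   all [N] factors stay below it with probability at most [expR (- N ^ d2)]. *)
pose q2 := q * (1 + e) `^ (alpha / 2).
have qq2 : q < q2.
  by rewrite ltr_pMr// -[ltLHS](powRr0 (1 + e)) ltr_gt1_powR//; lra.
have [A0 HA] := A_ge qq2.
pose d2 := 1 - (1 + e) `^ (- (alpha / 2)).
have d20 : 0 < d2.
  by rewrite subr_gt0 -[ltRHS](powRr0 (1 + e)) ltr_gt1_powR//; lra.
have Sge := tail_sum_ge be1 Qni Q0 RV c_pinfty v_pinfty cQ a0 rho0 eK.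
(* The number of jobs [n] is only known to exist, so the sum that multiplies the failure
   probabilities has to be bounded for every [n]. *)
have Sle : \forall N \near \oo, forall n,
    \sum_(j < n) Q (a * (c N / b N) * (1 + mu / x / c N * j%:R) `^ 1) <= J + 1.
  apply: (tail_sum_le be1 Qni Q0 RV c_pinfty v_pinfty cQ) => //.
  - by rewrite mul1r.
  - by rewrite mul1r ltrDl.
near=> N.
have cN0 : 0 < c N by near: N; move/cvgryPgt : c_pinfty; exact.
have v0 : 0 < c N / b N by near: N; move/cvgryPgt : v_pinfty; exact.
have bN0 : 0 < b N by near: N; move/cvgryPgt : b_pinfty; exact.
have bA : A0 * (1 + e) <= b N by near: N; move/cvgryPge : b_pinfty; exact.
have lnE : q * b N `^ alpha = ln (N%:R : R) by near: N.
have N0 : 0 < N%:R :> R by near: N; exact: nbhs_infty_gtr.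
have lntol : - ln tol / d2 <= ln (N%:R : R).
  by near: N; move/cvgryPge : ln_pinfty; exact.
have cN1 : c1 <= c N by near: N; move/cvgryPge : c_pinfty; exact.
have cNu : Num.max u0 1 / (x * e / 2) <= c N.
  by near: N; move/cvgryPge : c_pinfty; exact.
have [n Sn] : exists n, K <=
  \sum_(j < n) Q (a * (c N / b N) * (1 + mu / x / c N * j%:R)) by near: N.
have SnJ : forall n,
    \sum_(j < n) Q (a * (c N / b N) * (1 + mu / x / c N * j%:R) `^ 1) <= J + 1.
  by near: N.
exists n.+1.
pose y (j : nat) := a * (c N / b N) * (1 + mu / x / c N * j%:R).
have r0 (j : nat) : 0 < 1 + mu / x / c N * j%:R.
  by rewrite ltr_wpDr// mulr_ge0// divr_ge0// ltW.
have y0 j : 0 < y j by rewrite mulr_gt0// mulr_gt0.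
pose l (j : nat) := mu * (1 + e) * j%:R + x * e / 2 * c N.
have aN0 : 0 < b N / (1 + e) by rewrite divr_gt0.
have Xy j : x * c N <= b N / (1 + e) * y j - l j - x * e / 2 * c N.
  rewrite le_eqVlt; apply/orP; left; apply/eqP.
  by rewrite /y /l /a powR_mulrn ?(ltW l0)//; field; rewrite !gt_eqF.
have wl i j : pr P [set w | walk A B Tau i j w < - l j] <= tol.
  exact: Hwalk.
have ge := pr_exceed_ge M N n aN0 y0 wl (ltW tol0) Xy.
have tT : pr P [set w | x * e / 2 * c N < Tau 0 w] <= tol.
  have su : Num.max u0 1 <= x * e / 2 * c N.
    by rewrite -ler_pdivrMl// mulrC.
  have [su0 su1] : u0 <= x * e / 2 * c N /\ 1 <= x * e / 2 * c N.
    by move: su; rewrite ge_max => /andP[].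
  apply: le_trans (Hu _ su0).
  by rewrite ler_peMl// pr_ge0.
have tA : (1 - pr P [set w | b N / (1 + e) < A 0 0 w]) ^+ N <= tol.
  have pA : expR (- (q2 * (b N / (1 + e)) `^ alpha)) <=
      pr P [set w | b N / (1 + e) < A 0 0 w].
    by apply: HA; rewrite ler_pdivlMr.
  have E : q2 * (b N / (1 + e)) `^ alpha = (1 - d2) * ln (N%:R : R).
    rewrite powRM ?invr_ge0 ?(ltW bN0) ?(ltW l0)// -powR_inv1 ?(ltW l0)//.
    rewrite -powRrM -lnE /q2 /d2 mulN1r.
    have -> : - alpha = - (alpha / 2) + - (alpha / 2) by field.
    rewrite [_ `^ (_ + _)]powRD ?(gt_eqF l0) ?implybT//.
    by rewrite powRN; field; rewrite gt_eqF// powR_gt0.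
  rewrite E in pA.
  apply: (@le_trans _ _ (expR (- pr P [set w | b N / (1 + e) < A 0 0 w]) ^+ N)).
    apply: lerXn2r; rewrite ?nnegrE ?expR_ge0// ?subr_ge0 ?pr_le1//.
      exact: measurable_gt.
    exact: expR_ge1Dx.
  rewrite -expRM_natl -[leRHS]lnK ?posrE// ler_expR.
  rewrite mulrN lerNl.
  apply: (@le_trans _ _ (N%:R * expR (- ((1 - d2) * ln (N%:R : R))))); last first.
    by rewrite ler_pM2l.
  rewrite -{1}(@lnK _ (N%:R : R)) ?posrE// -expRD.
  have -> : ln (N%:R : R) + - ((1 - d2) * ln N%:R) = ln (N%:R : R) * d2 by ring.
  apply: (@le_trans _ _ (ln (N%:R : R) * d2)); first by rewrite -ler_pdivrMr.
  by apply: le_trans (expR_ge1Dx _); rewrite lerDr.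
have SJ : \sum_(j < n) pr P [set w | y j < B 0 w] <= J + 1.
  apply: le_trans (SnJ n); apply: ler_sum => j _.
  by rewrite powRr1 ?(ltW (r0 _)).
apply: le_trans ge; rewrite (pr_exists_B_gt M).
have p01 (j : nat) : 0 <= pr P [set w | y j < B 0 w] <= 1.
  by rewrite pr_ge0 pr_le1//; exact: measurable_gt.
have S0 : 0 <= \sum_(j < n) pr P [set w | y j < B 0 w].
  by apply: sumr_ge0 => j _; exact: pr_ge0.
have pS := prod_1B_le n p01.
have eS : expR (- \sum_(j < n) pr P [set w | y j < B 0 w]) <= expR (- K).
  by rewrite ler_expR lerN2.
have tE : (J + 1) * (tol * 3) = eta / 2.
  by rewrite /tol; field; rewrite gt_eqF//; lra.
set t1 := pr P [set w | _ < Tau 0 w] in tT *.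
set t2 := (1 - _) ^+ N in tA *.
set S := \sum_(j < n) _ in SJ S0 pS eS *.
set Pr := \prod_(j < n) _ in pS *.
have St : S * (t1 + t2 + tol) <= eta / 2.
  rewrite -tE; apply: (@le_trans _ _ (S * (tol * 3))).
    by apply: ler_wpM2l => //; lra.
  by rewrite ler_pM2r// mulr_gt0.
move: pS eS St; rewrite KE; lra.
Unshelve. all: end_near.
Qed.

End asymptotics.

(** * From the hypotheses on the tails to explicit bounds *)

Section tails.
Context {R : realType}.
Implicit Types (F L Q : R -> R) (a q : R).

Lemma weibull_tail_le F alpha q : 0 < q -> (forall a, 0 <= F a) ->
  equiv_pinfty (fun a => ln (F a)) (fun a => - (q * a `^ alpha)) ->
  forall q1, q1 < q -> exists a0, forall a, a0 <= a ->
    F a <= expR (- (q1 * a `^ alpha)).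
Proof.
move=> q0 F0 Fe q1 q1q.
have e0 : 0 < (q - q1) / q by rewrite divr_gt0// subr_gt0.
have [K [_ HK]] := equiv_pinftyP Fe e0.
exists (K + 1) => a Ka; have /HK /= : K < a by lra.
have p0 : 0 <= a `^ alpha by exact: powR_ge0.
rewrite normrN (ger0_norm (mulr_ge0 (ltW q0) p0)) ler_distl => /andP[_ +].
have -> : - (q * a `^ alpha) + (q - q1) / q * (q * a `^ alpha) =
    - (q1 * a `^ alpha) by field; rewrite gt_eqF.
move=> lnF; have [Fa0|Fa0] := ltP 0 (F a).
  by rewrite -[leLHS]lnK ?posrE// ler_expR.
by apply: le_trans Fa0 _; exact: expR_ge0.
Qed.

Lemma weibull_tail_ge F alpha q : 0 < q -> (forall a, 0 <= F a) ->
  equiv_pinfty (fun a => ln (F a)) (fun a => - (q * a `^ alpha)) ->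
  forall q2, q < q2 -> exists a0, forall a, a0 <= a ->
    expR (- (q2 * a `^ alpha)) <= F a.
Proof.
move=> q0 F0 Fe q2 qq2; pose e := Num.min ((q2 - q) / q) 2^-1.
have e0 : 0 < e by rewrite lt_min invr_gt0 ltr0n andbT divr_gt0// subr_gt0.
have eq2 : e * q <= q2 - q by rewrite -ler_pdivlMr// ge_min lexx.
have e1 : e < 1.
  by rewrite (@le_lt_trans _ _ (2^-1))//; [rewrite ge_min lexx orbT|lra].
have [K [_ HK]] := equiv_pinftyP Fe e0.
exists (Num.max (K + 1) 1) => a; rewrite ge_max => /andP[Ka a1].
have /HK /= : K < a by lra.
have a0 : 0 < a by lra.
have p0 : 0 < a `^ alpha by rewrite powR_gt0.
have qp0 : 0 < q * a `^ alpha by rewrite mulr_gt0.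
rewrite normrN (gtr0_norm qp0) ler_distl => /andP[lnF lnF'].
(* [ln 0] is 0 by convention, so [F a = 0] has to be excluded: [e < 1] forces [ln (F a)] to be
   negative. *)
have Fa0 : 0 < F a.
  rewrite lt_neqAle F0 andbT; apply: contraTN lnF' => /eqP <-.
  by rewrite ln0// -ltNge; nra.
rewrite -[leRHS]lnK ?posrE// ler_expR.
apply: le_trans lnF; rewrite -opprD lerN2 [e * _]mulrA -mulrDl ler_pM2r//.
by lra.
Qed.

Lemma slowly_varying_tail L Q beta : slowly_varying L ->
  (forall y, 0 < y -> Q y = L y / y `^ beta) ->
  forall l, 0 < l -> Q (l * y) / Q y @[y --> +oo] --> l `^ (- beta).
Proof.
move=> [_ L0 sv] QE l l0; rewrite -[X in _ --> X]mul1r.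
apply: (cvg_trans (G := (fun y => L (l * y) / L y * l `^ (- beta)) @ +oo)).
  apply: near_eq_cvg; near=> y.
  have y0 : 0 < y by near: y; apply: nbhs_pinfty_gt; exact: num_real.
  have Ly : 0 < L y by near: y.
  have yb : 0 < y `^ beta by rewrite powR_gt0.
  have lb : 0 < l `^ beta by rewrite powR_gt0.
  rewrite !QE ?mulr_gt0// powRM ?(ltW l0) ?(ltW y0)// powRN.
  by field; rewrite !gt_eqF.
by apply: cvgMl; exact: sv.
Unshelve. all: end_near.
Qed.

(** [L] is known to be positive only near infinity; monotonicity of the tail carries positivity back
    to every [y > 0]. *)
Lemma slowly_varying_tail_gt0 L Q beta : slowly_varying L ->
  (forall y, 0 < y -> Q y = L y / y `^ beta) ->
  (forall y z, 0 < y -> y <= z -> Q z <= Q y) ->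
  forall y, 0 < y -> 0 < Q y.
Proof.
move=> [_ [K [_ HK]] _] QE Qni y y0; pose z := Num.max y (K + 1).
have yz : y <= z by rewrite le_max lexx.
have Kz : K < z by rewrite lt_max; apply/orP; right; lra.
apply: lt_le_trans (Qni _ _ y0 yz).
have z0 : 0 < z by exact: lt_le_trans yz.
by rewrite QE// divr_gt0 ?powR_gt0//; exact: HK.
Qed.

Lemma ln_nat_pinfty : ln (N%:R : R) @[N --> \oo] --> +oo.
Proof.
apply/cvgryPge => K; near=> N.
have KN : expR K <= N%:R :> R by near: N; exact: nbhs_infty_ger.
by rewrite -ler_expR lnK ?posrE//; apply: lt_le_trans KN; exact: expR_gt0.
Unshelve. all: end_near.
Qed.

Lemma b_scaleE alpha q : 0 < alpha -> 0 < q ->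
  \forall N \near \oo, q * b_scale alpha q N `^ alpha = ln (N%:R : R).
Proof.
move=> al0 q0; near=> N.
have lnN : 0 <= ln (N%:R : R).
  by near: N; move/cvgryPge : ln_nat_pinfty; exact.
rewrite /b_scale -powRrM mulVf ?gt_eqF// powRr1 ?divr_ge0 ?(ltW q0)//.
by rewrite mulrC divfK// gt_eqF.
Unshelve. all: end_near.
Qed.

Lemma b_scale_pinfty alpha q : 0 < alpha -> 0 < q ->
  b_scale alpha q N @[N --> \oo] --> +oo.
Proof.
move=> al0 q0.
apply: (@cvg_comp _ _ _ (fun N : nat => ln (N%:R : R) / q)
  (fun u => u `^ alpha^-1) _ (pinfty_nbhs R)).
  apply/cvgryPge => K; near=> N; rewrite ler_pdivlMr//.
  by near: N; move/cvgryPge : ln_nat_pinfty; exact.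
by apply: cvgr_powR_pinfty; rewrite invr_gt0.
Unshelve. all: end_near.
Qed.

End tails.

Theorem theorem3 (R : realType) (alpha q beta mu : R)
  (alpha_itv : 0 < alpha < 1) (q_gt0 : 0 < q) (beta_gt1 : 1 < beta)
  (mu_gt0 : 0 < mu)
  (* the queueing model *)
  (d : measure_display) (Omega : measurableType d) (P : probability Omega R)
  (A : nat -> nat -> {RV P >-> R}) (B Tau : nat -> {RV P >-> R})
  (A_iid : iid (fun ij : nat * nat => A ij.1 ij.2))
  (B_iid : iid B) (Tau_iid : iid Tau)
  (families_indep : independent_systems P
     (tnth [tuple sigma_of (fun ij : nat * nat => A ij.1 ij.2);
                  sigma_of B; sigma_of Tau]))
  (A_pos : forall i j, positive_RV (A i j))
  (B_pos : forall j, positive_RV (B j))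
  (Tau_pos : forall j, positive_RV (Tau j))
  (A_tail : forall i j,
     equiv_pinfty (fun x => ln (fine (ccdf (A i j) x)))
                  (fun x => - (q * x `^ alpha)))
  (L : R -> R) (L_slow : slowly_varying L)
  (B_tail : forall j x, 0 < x -> ccdf (B j) x = (L x / x `^ beta)%:E)
  (drift : forall i j, ('E_P[(fun w => A i j w * B j w - Tau j w)%R] = (- mu)%:E)%E)
  (* the scaling *)
  (Lt : R -> R) (Lt_scaling : inverse_scaling beta L Lt)
  (* the limiting process *)
  (d' : measure_display) (Omega' : measurableType d')
  (P' : probability Omega' R) (X : R -> R -> {RV P' >-> R})
  (X_extremal : extremal_process beta X)
  (x : R) (x_gt0 : 0 < x) :
  P [set w | ((x * c_scale alpha q beta Lt N)%:E
               < max_steady_waiting A B Tau N w)%E] @[N --> \oo]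
  --> P' [set w | (x%:E < sup_drifted mu X w)%E].
Proof.
have /andP[al0 al1] := alpha_itv.
have M : queue_model A B Tau by [].
have prA a : pr P [set w | a < A 0 0 w] = fine (ccdf (A 0 0) a).
  rewrite /pr /ccdf /distribution /pushforward; congr (fine (P _)).
  by apply/seteqP; split => w /=; rewrite in_itv/= andbT.
pose Q y := pr P [set w | y < B 0 w].
have QE y : 0 < y -> Q y = L y / y `^ beta.
  move=> y0; have := B_tail 0%N y y0 => /(congr1 (@fine R)) /= <-.
  rewrite /Q /pr /ccdf /distribution /pushforward; congr (fine (P _)).
  by apply/seteqP; split => w /=; rewrite in_itv/= andbT.
have Qni y z : 0 < y -> y <= z -> Q z <= Q y.
  move=> _ yz; apply: le_pr; [exact: measurable_gt|exact: measurable_gt|].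
  by move=> w /=; exact: le_lt_trans.
have Q0 := slowly_varying_tail_gt0 L_slow QE Qni.
have RV := slowly_varying_tail L_slow QE.
have A_le : forall q1, q1 < q -> exists a0, forall a, a0 <= a ->
     pr P [set w | a < A 0 0 w] <= expR (- (q1 * a `^ alpha)).
  apply: (weibull_tail_le q_gt0) => [a|]; first exact: pr_ge0.
  by under eq_fun do rewrite prA; exact: A_tail.
have A_ge : forall q2, q < q2 -> exists a0, forall a, a0 <= a ->
     expR (- (q2 * a `^ alpha)) <= pr P [set w | a < A 0 0 w].
  apply: (weibull_tail_ge q_gt0) => [a|]; first exact: pr_ge0.
  by under eq_fun do rewrite prA; exact: A_tail.
have iB : P.-integrable setT (EFin \o (fun w => `|B 0 w|)).
  have [C [y1 [C0 y10 H]]] := tail_le_powR beta_gt1 Qni Q0 RV.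
  by apply: (integrable_power_tail (B_pos 0%N) y10 _ H); lra.
have dr : (\int[P]_w (A 0 0 w * B 0 w - Tau 0 w)%:E = (- mu)%:E)%E.
  by have := drift 0%N 0%N; rewrite unlock.
have [_ [g [h [gE hE LtE]]]] := Lt_scaling.
have fE s : 0 < s -> s `^ beta / L s = (Q s)^-1.
  by move=> s0; rewrite QE// invf_div.
have boo := b_scale_pinfty al0 q_gt0.
pose b := b_scale alpha q; pose c := c_scale alpha q beta Lt.
(* The scaling identity is given for positive arguments, and [b N] is positive only eventually. *)
have cE : \forall N \near \oo, h (b N) = c N.
  near=> N; rewrite /c /c_scale -/(b N) LtE//.
  by near: N; move/cvgryPgt : boo; exact.
have coo : c N @[N --> \oo] --> +oo.
  apply: cvg_trans (near_eq_cvg cE) _.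
  exact: (cvg_comp _ _ boo (h_pinfty beta_gt1 Qni Q0 RV fE gE hE)).
have voo : c N / b N @[N --> \oo] --> +oo.
  apply: (cvg_trans (G := (fun N => h (b N) / b N) @ \oo)).
    by apply: near_eq_cvg; apply: filterS cE => N ->.
  exact: (cvg_comp _ _ boo (scaling_ratio_pinfty beta_gt1 Qni Q0 RV fE gE hE)).
have cQ : c N * Q (c N / b N) @[N --> \oo] --> (1 : R).
  apply: (cvg_trans (G := (fun N => h (b N) * Q (h (b N) / b N)) @ \oo)).
    by apply: near_eq_cvg; apply: filterS cE => N ->.
  exact: (cvg_comp _ _ boo (scaling_tail beta_gt1 Qni Q0 RV fE gE hE)).
have bE := b_scaleE al0 q_gt0.
have lnoo := @ln_nat_pinfty R.
have c_le : exists C p, [/\ 0 < C, 0 < p &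
    \forall N \near \oo, c N <= C * ln (N%:R : R) `^ p].
  have [C [p [C0 p0 [K [_ HK]]]]] :=
    scaling_le_powR beta_gt1 Qni Q0 RV fE gE hE.
  exists (C * q^-1 `^ (alpha^-1 * p)), (alpha^-1 * p); split.
  - by rewrite mulr_gt0// powR_gt0// invr_gt0.
  - by rewrite mulr_gt0// invr_gt0.
  near=> N; have <- : h (b N) = c N by near: N.
  have lnN : 0 <= ln (N%:R : R) by near: N; move/cvgryPge : lnoo; exact.
  apply: le_trans (HK _ _) _.
    by near: N; move/cvgryPgt : boo; exact.
  rewrite /b /b_scale -powRrM powRM ?invr_ge0 ?(ltW q_gt0)//.
  by rewrite -mulrA [_ `^ _ * _]mulrC.
have up := exceed_limsup M al0 al1 q_gt0 beta_gt1 mu_gt0 x_gt0 A_le iB dr Q0 RV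
  boo bE coo voo cQ lnoo c_le.
have lo := exceed_liminf M al0 al1 q_gt0 beta_gt1 mu_gt0 x_gt0 A_le A_ge iB dr
  Q0 RV boo bE coo voo cQ lnoo.
rewrite (sup_drifted_law X_extremal beta_gt1 mu_gt0 x_gt0).
have mU N : measurable (\bigcup_n exceed A B Tau N n (x * c N)).
  by apply: bigcupT_measurable => n; exact: measurable_exceed.
apply: (cvg_trans (G := (fun N =>
    (pr P (\bigcup_n exceed A B Tau N n (x * c N)))%:E) @ \oo)).
  by apply: near_eq_cvg; near=> N; rewrite max_steady_waiting_gtE prE.
apply: cvg_EFin; first by near=> N.
(* The lower bound at a single horizon passes to the union by inclusion; the upper one, uniform in
   the horizon, passes by continuity from below. *)
apply/cvgrPdist_le => eta eta0; near=> N; rewrite /= distrC ler_distl.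
apply/andP; split.
  have [n Hn] : exists n, 1 - expR (- (x `^ (1 - beta) / (mu * (beta - 1)))) - eta
    <= pr P (exceed A B Tau N n (x * c N)) by near: N; exact: lo.
  apply: (le_trans Hn); apply: le_pr => //; first exact: measurable_exceed.
  by move=> w wn; exists n.
apply: pr_bigcup_le.
- by move=> n; exact: measurable_exceed.
- exact: exceed_homo.
- by near: N; exact: up.
Unshelve. all: end_near.
Qed.
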